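(* Let $c,f>0$. Consider one of the following two sets of side conditions on a negative definite measure $\nu\in\mathfrak{Ndm}$: (A) $\operatorname{Tr}_V(\nu(\hat K))=c$ and $\operatorname{Tr}_V(-S\,\nu(\hat K))\le f$; (B) $\operatorname{Tr}_V(\nu(\hat K))=c$ and $|\nu(\hat K)|\le f$ (spectral weight). Let $N\subset\mathfrak{Ndm}$ be the set of negative definite measures satisfying (A), respectively (B), and let $(\nu^{(j)})_{j\in\mathbb N}$ be a minimizing sequence for the causal variational principle on $N$, i.e. $\nu^{(j)}\in N$ for all $j$ and $\lim_{j\to\infty}\mathcal S(\nu^{(j)})=\inf_{\tilde\nu\in N}\mathcal S(\tilde\nu)$. Then there exist a sequence $(U_j)_{j\in\mathbb N}$ of operators on $V$ that are unitary with respect to $\prec\cdot\mid\cdot\succ$ and a subsequence $(\nu^{(j_k)})_{k\in\mathbb N}$ such that $(U_{j_k}\,\nu^{(j_k)}\,U_{j_k}^{-1})_{k\in\mathbb N}$ converges weakly to some non-trivial negative definite measure $\nu\neq 0$. Moreover, $$\mathcal S(\nu)\le\liminf_{k\to\infty}\mathcal S(\nu^{(j_k)}),$$ and the limit measure $\nu\in\mathfrak{Ndm}$ satisfies the side conditions (A), respectively (B). In particular, $\nu$ is a non-trivial minimizer, i.e. $\nu \in N$ and $\mathcal S(\nu)\le\mathcal S(\tilde\nu)$ for all $\tilde\nu\in N$. The same statements remain true if ''$\le f$'' is replaced by ''$=f$'' throughout in (A), respectively (B) (in the hypothesis, in the definition of $N$, and in the conclusion).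
   Context: Let $n\ge1$ and $V=\mathbb C^{2n}$ with standard basis $(\mathfrak e_i)_{i=1,\dots,2n}$ and Euclidean inner product $\langle\cdot\mid\cdot\rangle$ (linear in the second argument). Let $S=\operatorname{diag}(1,\dots,1,-1,\dots,-1)$ ($n$ entries $1$, $n$ entries $-1$) and define the indefinite inner product $\prec u\mid v\succ=\langle u\mid Sv\rangle$. $\mathrm L(V)$ is the set of linear operators on $V$; $A^*$ denotes the adjoint with respect to $\prec\cdot\mid\cdot\succ$, and $U\in\mathrm L(V)$ is unitary (with respect to $\prec\cdot\mid\cdot\succ$) if it is invertible with $U^{-1}=U^*$. The spectral weight of $A\in\mathrm L(V)$ is $|A|=\sum_{i=1}^{2n}|\lambda_i|$, where $\lambda_i$ are the eigenvalues of $A$ counted with algebraic multiplicity. Minkowski space $M\simeq\mathbb R^4$ carries Lebesgue measure $\mu$; momentum space is $\hat M\simeq\mathbb R^4$; the pairing is $k\xi=k^0\xi^0-\sum_{i=1}^3k^i\xi^i$ for $k\in\hat M$, $\xi\in M$. $\hat K\subset\hat M$ is a fixed compact set with Borel $\sigma$-algebra $\mathcal B(\hat K)$. A negative definite measure on $\hat K$ is a (countably additive) vector-valued measure $\nu:\mathcal B(\hat K)\to\mathrm L(V)$ such that $\Omega\mapsto\prec u\mid-\nu(\Omega)u\succ$ is a positive finite measure for every $u\in V$; the class of these is $\mathfrak{Ndm}$. For $u,v\in V$, $\prec u\mid\nu\,v\succ$ denotes the complex measure $\Omega\mapsto\prec u\mid\nu(\Omega)v\succ$, and for bounded Borel $g:\hat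 K\to\mathbb C$ the operator $\int_{\hat K}g\,d\nu\in\mathrm L(V)$ is defined by $\prec u\mid(\int g\,d\nu)v\succ=\int_{\hat K}g\;d\prec u\mid\nu\,v\succ$ for all $u,v\in V$. For $U\in \mathrm L(V)$ invertible, $U\nu U^{-1}$ is the measure $\Omega\mapsto U\nu(\Omega)U^{-1}$. A sequence $\nu_k$ converges weakly to $\nu$ if $\int_{\hat K}g\;d\prec u\mid\nu_k v\succ\to\int_{\hat K}g\;d\prec u\mid\nu\,v\succ$ for all $u,v\in V$ and all bounded continuous $g:\hat K\to\mathbb C$. For $\nu\in\mathfrak{Ndm}$ and $\xi\in M$ set $P[\nu](\xi)=\int_{\hat K}e^{ik\xi}\,d\nu(k)\in\mathrm L(V)$, the closed chain $A[\nu](\xi)=P[\nu](\xi)\,P[\nu](-\xi)$, the Lagrangian $\mathcal L[\nu](\xi)=|A[\nu](\xi)^2|-\frac1{2n}|A[\nu](\xi)|^2\ge0$, and the causal action $\mathcal S(\nu)=\int_M\mathcal L[\nu](\xi)\,d\mu(\xi)\in[0,\infty]$. *)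

(* Defs.v *)
From HB Require Import structures.
From mathcomp Require Import all_boot all_order all_algebra complex.
From mathcomp Require Import all_classical all_reals all_analysis.
Set Implicit Arguments.
Unset Strict Implicit.
Unset Printing Implicit Defensive.
Import Order.TTheory GRing.Theory Num.Theory.
Import numFieldNormedType.Exports.
Local Open Scope classical_set_scope.
Local Open Scope ring_scope.
Local Open Scope complex_scope.

(* Used for both position and momentum space; the time component of x is
   x.1.1.1. *)
Notation four_vector R := (R * R * R * R)%type.

Notation momentum R := (g_sigma_algebraType (@open (four_vector R))).

Section VectorMeasures.
Variables (R : realType) (K : set (four_vector R)).

Definition borel_subsets : set (set (momentum R)) :=
  [set Om | @measurable _ (momentum R) Om /\ Om `<=` K].

Definition countably_additive (W : normedModType R[i])
    (m : set (momentum R) -> W) : Prop :=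
  m set0 = 0 /\
  forall F : (set (momentum R))^nat,
    (forall i, borel_subsets (F i)) -> trivIset setT F ->
    (\sum_(0 <= i < N) m (F i)) @[N --> \oo] --> m (\bigcup_i F i).

(* A W-valued measure on the Borel subsets of K; the values of the underlying
   function at other sets are irrelevant. *)
Record vmeasure (W : normedModType R[i]) := VMeasure {
  vmeasure_fun :> set (momentum R) -> W ;
  vmeasureP : countably_additive vmeasure_fun }.

Lemma countably_additive_comp (W W' : normedModType R[i]) (f : W -> W')
    (m : vmeasure W) :
  continuous f -> {morph f : x y / x + y} ->
  countably_additive (fun Om => f (m Om)).
Proof.
move=> cf fD; have f0 : f 0 = 0.
  by apply: (addIr (f 0)); rewrite -fD !add0r.
have [m0 ma] := vmeasureP m; split; first by rewrite m0 f0.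
move=> F mF tF; under eq_fun do
  rewrite -(big_morph f fD f0 (op1 := +%R)).
by apply: continuous_cvg; [exact: cf | exact: ma].
Qed.

Notation complex_measure := (vmeasure (R[i]^o)).

Hypothesis cK : compact K.

Lemma measurable_compact : measurable (K : set (momentum R)).
Proof.
rewrite -[K]setCK; apply: measurableC; apply: sub_sigma_algebra.
rewrite /= openC; apply: compact_closed => //; exact: norm_hausdorff.
Qed.


Section Charge.
Variables (h : R[i]^o -> R^o) (ch : continuous h).
Variable hD : {morph h : x y / x + y}.
Variable m : complex_measure.

Let c (Om : set (momentum R)) : \bar R := (h (m (Om `&` K)))%:E.

Let c0 : c set0 = 0%E.
Proof.
rewrite /c set0I (vmeasureP m).1; congr _%:E.
by apply: (addIr (h 0)); rewrite -hD !add0r.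
Qed.

Let cfin Om : measurable Om -> c Om \is a fin_num.
Proof. by []. Qed.

Let csigma : semi_sigma_additive c.
Proof.
have h0 : h 0 = 0 by apply: (addIr (h 0)); rewrite -hD !add0r.
move=> F mF tF mUF; rewrite /c setI_bigcupl.
have mFK i : borel_subsets (F i `&` K).
  by split; [apply: measurableI => //; exact: measurable_compact|exact: subIsetr].
have e := (vmeasureP m).2 _ mFK (trivIset_setIr tF).
under eq_fun do rewrite sumEFin -(big_morph h hD h0 (op1 := +%R)).
have e2 := cvg_comp _ _ e (@ch _).
by apply: cvg_EFin; [near=> N | exact: e2].
Unshelve. all: by end_near. Qed.

Definition part_charge : {charge set (momentum R) -> \bar R} :=
  HB.pack c (isCharge.Build _ _ _ c c0 cfin csigma).

End Charge.

Let ReD : {morph (@complex.Re R : R[i]^o -> R^o) : x y / x + y}.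
Proof. by move=> [a b] [c d]. Qed.

Let ImD : {morph (@complex.Im R : R[i]^o -> R^o) : x y / x + y}.
Proof. by move=> [a b] [c d]. Qed.

Let Re_le (z : R[i]) : `|complex.Re z|%:C <= `|z|.
Proof. exact: normc_ge_Re. Qed.

Let Im_le (z : R[i]) : `|complex.Im z|%:C <= `|z|.
Proof.
by case: z => a b; rewrite normc_def lecR /= -sqrtr_sqr ler_wsqrtr// lerDr sqr_ge0.
Qed.

Let Re_continuous : continuous (@complex.Re R : R[i]^o -> R^o).
Proof.
move=> z; apply/(@cvgrPdist_lt _ _ _ (nbhs (z : R[i]^o))) => e e0.
have : \forall w \near (z : R[i]^o), `|z - w| < e%:C.
  apply/nbhs_normP; exists e%:C => //=; by rewrite ltcR.
apply: filterS => w; rewrite -ltcR; apply: le_lt_trans.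
by rewrite (_ : _ - _ = complex.Re (z - w)) ?Re_le//; case: z w => ? ? [].
Qed.

Let Im_continuous : continuous (@complex.Im R : R[i]^o -> R^o).
Proof.
move=> z; apply/(@cvgrPdist_lt _ _ _ (nbhs (z : R[i]^o))) => e e0.
have : \forall w \near (z : R[i]^o), `|z - w| < e%:C.
  apply/nbhs_normP; exists e%:C => //=; by rewrite ltcR.
apply: filterS => w; rewrite -ltcR; apply: le_lt_trans.
by rewrite (_ : _ - _ = complex.Im (z - w)) ?Im_le//; case: z w => ? ? [].
Qed.

Definition Re_charge (m : complex_measure) : {charge set (momentum R) -> \bar R} :=
  part_charge Re_continuous ReD m.

Definition Im_charge (m : complex_measure) : {charge set (momentum R) -> \bar R} :=
  part_charge Im_continuous ImD m.


(* Integration over K with respect to a signed measure, via its Jordan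
   decomposition. *)
Definition charge_integral (c : {charge set (momentum R) -> \bar R})
    (g : four_vector R -> R) : R :=
  let P_spec := cid (Hahn_decomposition c) in
  let N_spec := cid (projT2 P_spec) in
  \int[jordan_pos (projT2 N_spec)]_(k in K) g k -
  \int[jordan_neg (projT2 N_spec)]_(k in K) g k.

Definition complex_integral (m : complex_measure) (g : four_vector R -> R[i]) : R[i] :=
  let g_re k := complex.Re (g k) in
  let g_im k := complex.Im (g k) in
  (charge_integral (Re_charge m) g_re - charge_integral (Im_charge m) g_im) +i*
  (charge_integral (Re_charge m) g_im + charge_integral (Im_charge m) g_re).

End VectorMeasures.

Section IndefiniteInnerProduct.
Variables (R : realType) (n : nat).
Implicit Types (u v : 'cV[R[i]]_(n + n)) (A B U : 'M[R[i]]_(n + n)).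

Definition signature : 'M[R[i]]_(n + n) := block_mx 1%:M 0 0 (- 1%:M).

Definition euclidean_product u v : R[i] := \sum_i (u i 0)^* * v i 0.

Definition krein_product u v : R[i] := euclidean_product u (signature *m v).

(* B is the adjoint of A for the indefinite product. *)
Definition krein_adjoint A B : Prop :=
  forall u v, krein_product (B *m u) v = krein_product u (A *m v).

Definition krein_unitary U : Prop :=
  U \in unitmx /\ krein_adjoint U (invmx U).

(* The roots of the characteristic polynomial, with multiplicity. *)
Definition eigenvalues A : seq R[i] :=
  sval (closed_field_poly_normal (char_poly A)).

Definition spectral_weight A : R :=
  \sum_(l <- eigenvalues A) complex.Re `|l|.

Lemma mx_linear_continuous (W : normedModType R[i])
    (f : 'M[R[i]]_(n + n) -> W) : linear f -> continuous (f : 'M[R[i]^o]_(n + n) -> W).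
Proof.
move=> fL; have fD : {morph f : x y / x + y}.
  by move=> x y; rewrite -[x]scale1r fL !scale1r.
have f0 : f 0 = 0 by apply: (addIr (f 0)); rewrite -fD !add0r.
have fZ a x : f (a *: x) = a *: f x.
  by rewrite -[X in f X]addr0 fL f0 addr0.
have -> : f = fun A => \sum_i \sum_j A i j *: f (delta_mx i j).
  apply/funext => A; rewrite {1}[A]matrix_sum_delta (big_morph f fD f0).
  apply: eq_bigr => i _; rewrite (big_morph f fD f0).
  by apply: eq_bigr => j _; rewrite fZ.
apply: continuous_big => [|i _]; first exact: add_continuous.
apply: continuous_big => [|j _]; first exact: add_continuous.
move=> A; apply: (@cvgZr_tmp _ _ _ (nbhs (A : 'M[R[i]^o]_(n + n))) _ (fun B => B i j)).
exact: (@coord_continuous _ _ _ i j A).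
Qed.

Lemma krein_productP u v : linear (fun A => krein_product u (A *m v) : R[i]^o).
Proof.
move=> a A B; rewrite /krein_product /euclidean_product scaler_sumr -big_split.
apply: eq_bigr => i _; rewrite mulmxDl mulmxDr -scalemxAl -scalemxAr !mxE /=.
by rewrite mulrDr mulrCA.
Qed.

Lemma conjugationP U : linear (fun A => U *m A *m invmx U).
Proof. by move=> a A B; rewrite mulmxDr mulmxDl -scalemxAr -scalemxAl. Qed.

End IndefiniteInnerProduct.

Notation operator_measure K n := (vmeasure K 'M[_[i]^o]_(n + n)).

Section OperatorMeasures.
Variables (R : realType) (n : nat) (K : set (four_vector R)).
Implicit Types (nu : operator_measure K n).
Implicit Types (u v : 'cV[R[i]]_(n + n)) (U : 'M[R[i]]_(n + n)).

Lemma matrix_element_subproof nu u v :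
  countably_additive K (fun Om => krein_product u (nu Om *m v) : R[i]^o).
Proof.
have fL := krein_productP u v.
apply: (countably_additive_comp nu (mx_linear_continuous fL)) => x y.
by move: (fL 1 x y); rewrite !scale1r.
Qed.

Definition matrix_element nu u v : vmeasure K R[i]^o :=
  VMeasure (matrix_element_subproof nu u v).

Lemma conjugate_measure_subproof U nu :
  countably_additive K (fun Om => U *m nu Om *m invmx U).
Proof.
apply: (countably_additive_comp nu (mx_linear_continuous (conjugationP U))).
by move=> x y; rewrite mulmxDr mulmxDl.
Qed.

Definition conjugate_measure U nu : operator_measure K n :=
  VMeasure (conjugate_measure_subproof U nu).

(* A finite measure on the Borel subsets of K is presented as the restriction of
   a finite measure on the whole momentum space. *)
Definition negative_definite nu : Prop :=
  forall u, exists mu : {finite_measure set (momentum R) -> \bar R},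
    forall Om, borel_subsets K Om ->
      krein_product u (- nu Om *m u) = (fine (mu Om))%:C.

Definition nontrivial nu : Prop :=
  exists2 Om, borel_subsets K Om & nu Om != 0.

Hypothesis cK : compact K.

(* For g bounded and Borel on K such an operator exists, as complex_integral is
   linear in the measure, and it is unique, as the product is nondegenerate. *)
Definition operator_integral nu (g : four_vector R -> R[i]) : 'M[R[i]]_(n + n) :=
  xget 0 [set B | forall u v,
    krein_product u (B *m v) = complex_integral cK (matrix_element nu u v) g].

Definition converges_weakly (nus : nat -> operator_measure K n) nu : Prop :=
  forall u v (g : four_vector R -> R[i]^o),
    {within K, continuous g} -> [bounded g k | k in K] ->
    complex_integral cK (matrix_element (nus j) u v) g @[j --> \oo] -->
      (complex_integral cK (matrix_element nu u v) g : R[i]^o).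

Definition lorentz_pairing (k xi : four_vector R) : R :=
  k.1.1.1 * xi.1.1.1 - (k.1.1.2 * xi.1.1.2 + k.1.2 * xi.1.2 + k.2 * xi.2).

Definition expi (t : R) : R[i] := cos t +i* sin t.

Definition fourier_kernel nu (xi : four_vector R) : 'M[R[i]]_(n + n) :=
  operator_integral nu (fun k => expi (lorentz_pairing k xi)).

Definition closed_chain nu (xi : four_vector R) : 'M[R[i]]_(n + n) :=
  fourier_kernel nu xi *m fourier_kernel nu (- xi).

Definition lagrangian nu (xi : four_vector R) : R :=
  let A := closed_chain nu xi in
  spectral_weight (A *m A) - (2 * n)%:R^-1 * spectral_weight A ^+ 2.

Definition causal_action nu : \bar R :=
  (\int[lebesgue_measure \x lebesgue_measure \x lebesgue_measure
      \x lebesgue_measure]_xi (lagrangian nu xi)%:E)%E.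

Variant side_quantity := TraceQuantity | WeightQuantity.

Variant side_bound := AtMost | Exactly.

Definition side_value (q : side_quantity) nu : R[i] :=
  match q with
  | TraceQuantity => \tr (- signature R n *m nu K)
  | WeightQuantity => (spectral_weight (nu K))%:C
  end.

(* The order on R[i] satisfies z <= f%:C iff Im z = 0 and Re z <= f; side_value
   is real whenever nu is negative definite. *)
Definition admissible (q : side_quantity) (b : side_bound) (c f : R) :
    set (operator_measure K n) :=
  [set nu | [/\ negative_definite nu, \tr (nu K) = c%:C &
    match b with
    | AtMost => side_value q nu <= f%:C
    | Exactly => side_value q nu = f%:C
    end]].

End OperatorMeasures.

(* Main.v *)
Require Import Defs.
From HB Require Import structures.
From mathcomp Require Import all_boot all_order all_algebra all_fingroup complex.
From mathcomp Require Import all_classical all_reals all_analysis measurable_realfun.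
From mathcomp Require Import ring lra.
Set Implicit Arguments.
Unset Strict Implicit.
Unset Printing Implicit Defensive.
Import Order.TTheory GRing.Theory Num.Theory.
Import numFieldNormedType.Exports.
Local Open Scope classical_set_scope.
Local Open Scope complex_scope.
Local Open Scope ring_scope.

(* After conjugating each measure by a pseudo-unitary matrix, the nonnegative
   trace Tr(-S nu(K)) is bounded: this is the side condition (A) itself, while
   under (B) a definite nu(K) is diagonalized pseudo-unitarily, after a small
   perturbation, which makes that trace equal to the spectral weight. The matrices
   -S nu(A) are positive semidefinite, so all their entries are bounded uniformly
   in A.

   Weak compactness is reduced to Helly's selection theorem on the line. A
   Schoenberg space-filling curve p covers K by the image of [0,1]; along a
   subsequence the masses of the sets p([0,t]) in K, t rational, converge, and
   their right limits are distribution functions on the line whose Stieltjes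
   measures, pushed forward by p, are the limit measures. Since p is not injective,
   convergence of integrals of continuous functions is checked on partitions of
   [0,1] instead of by transporting the measures back. The quadratic dependence on
   u passes to the limit, so that polarization yields an operator-valued measure.

   The Fourier kernels then converge pointwise, and so do the Lagrangians, because
   the eigenvalues depend continuously on the matrix. The Lagrangian is invariant
   under conjugation and nonnegative, and Fatou's lemma gives lower semicontinuity
   of the action; the side conditions pass to the limit through nu(K). *)

(** * Convergence of complex sequences *)

(** The pseudo-unitary group is not compact, and the spectral weight is constant on its orbits, so a
    bound on the weight leaves the entries of [nu K] unbounded; hence the conjugation under (B).
    Under (A) the identity is taken. A semidefinite [nu K] with degenerate form need not be
    diagonalizable by a pseudo-unitary matrix. Only a bound is wanted, so a definite perturbation is
    diagonalized and the resulting matrix is applied to the unperturbed measure; this costs the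
    [+ 1] in the common bound [f + 1]. There is one scalar measure for each vector [u], uncountably
    many in all. Selection is therefore made on the matrix entries at rational parameters, a
    countable family that determines the masses for every [u]. The limit masses at rational
    parameters need not be masses of the limit measure, which may charge a boundary; hence the right
    limits. The curve may leave [K], so that the limit measure lives on [K] is proved separately.
    The limit is non-trivial because the constant 1 is a test function on the compact [K]: no mass
    escapes, and the trace [c > 0] survives. *)

(* An inductive wrapper: unification never unfolds the topology of [R[i]]. *)
Record ccvg (R : realType) (z : nat -> R[i]) (a : R[i]) : Prop :=
  CCvg { ccvg_lim : (z : nat -> R[i]^o) @ \oo --> (a : R[i]^o) }.

Notation "z ~~> a" := (ccvg z a) (at level 70, no associativity) : ring_scope.

Section ComplexSequences.
Variable R : realType.
Implicit Types (z w : nat -> R[i]) (a b : R[i]).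

Lemma norm_ReC a : (complex.Re `|a|)%:C = `|a|.
Proof. by rewrite RRe_real //; exact: normr_real. Qed.

Lemma ReD a b : complex.Re (a + b) = complex.Re a + complex.Re b.
Proof. by case: a b => ? ? []. Qed.

Lemma ImD a b : complex.Im (a + b) = complex.Im a + complex.Im b.
Proof. by case: a b => ? ? []. Qed.

Lemma ReB a b : complex.Re (a - b) = complex.Re a - complex.Re b.
Proof. by case: a b => ? ? []. Qed.

Lemma ImB a b : complex.Im (a - b) = complex.Im a - complex.Im b.
Proof. by case: a b => ? ? []. Qed.

Lemma Re_norm_ge0 a : 0 <= complex.Re `|a|.
Proof. by rewrite -lecR norm_ReC; exact: normr_ge0. Qed.

Lemma Re_normM a b : complex.Re `|a * b| = complex.Re `|a| * complex.Re `|b|.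
Proof. by apply: complexI; rewrite rmorphM /= !norm_ReC normrM. Qed.

Lemma ler_Re_normD a b :
  complex.Re `|a + b| <= complex.Re `|a| + complex.Re `|b|.
Proof. by rewrite -lecR rmorphD /= !norm_ReC ler_normD. Qed.

Lemma ler_norm_Re a : `|complex.Re a| <= complex.Re `|a|.
Proof. by rewrite -lecR norm_ReC; exact: normc_ge_Re. Qed.

Lemma ler_norm_Im a : `|complex.Im a| <= complex.Re `|a|.
Proof.
by rewrite -lecR norm_ReC; case: a => a b;
  rewrite normc_def lecR /= -sqrtr_sqr ler_wsqrtr// lerDr sqr_ge0.
Qed.

Lemma ler_Re_norm_parts a :
  complex.Re `|a| <= `|complex.Re a| + `|complex.Im a|.
Proof.
rewrite [X in complex.Re `|X|]complexE (le_trans (ler_Re_normD _ _))//.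
rewrite Re_normM !normc_def /= !expr0n expr1n !addr0 add0r sqrtr1 mul1r.
by rewrite !sqrtr_sqr.
Qed.

Lemma ccvgP z a : z ~~> a <->
  forall e : R, 0 < e -> \forall n \near \oo, complex.Re `|a - z n| < e.
Proof.
split=> [[/cvgrPdist_lt h] e e0|h].
  have /h : 0 < e%:C by rewrite ltcR.
  by apply: filterS => n; rewrite -norm_ReC ltcR.
split; apply/cvgrPdist_lt => e e0.
have eE : (complex.Re e)%:C = e by rewrite RRe_real // gtr0_real.
have /h : 0 < complex.Re e by rewrite -ltcR eE.
by apply: filterS => n; rewrite -ltcR norm_ReC eE.
Qed.

Lemma ccvg_ReIm z a : z ~~> a <->
  (fun n => complex.Re (z n)) @ \oo --> complex.Re a /\
  (fun n => complex.Im (z n)) @ \oo --> complex.Im a.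
Proof.
split=> [/ccvgP h|[/cvgrPdist_lt h1 /cvgrPdist_lt h2]].
  split; apply/cvgrPdist_lt => e /h; apply: filterS => n; apply: le_lt_trans.
    by rewrite -ReB; exact: ler_norm_Re.
  by rewrite -ImB; exact: ler_norm_Im.
apply/ccvgP => e e0; have e20 : 0 < e / 2 by rewrite divr_gt0.
near=> n; apply: (le_lt_trans (ler_Re_norm_parts _)).
rewrite (splitr e) ltrD//.
  by rewrite ReB; near: n; exact: h1.
by rewrite ImB; near: n; exact: h2.
Unshelve. all: by end_near. Qed.

Lemma ccvg_norm z a : z ~~> a ->
  (fun n => complex.Re `|z n|) @ \oo --> complex.Re `|a|.
Proof.
move=> /ccvgP h; apply/cvgrPdist_lt => e /h; apply: filterS => n.
have h1 := ler_Re_normD (a - z n) (z n); have h2 := ler_Re_normD (z n - a) a.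
rewrite !subrK in h1 h2; rewrite distrC in h2.
by apply: le_lt_trans; rewrite ler_norml; apply/andP; split; lra.
Qed.

Lemma ccvg_real (x : nat -> R) (l : R) :
  x @ \oo --> l -> (fun n => (x n)%:C) ~~> l%:C.
Proof. by move=> h; apply/ccvg_ReIm; split=> //=; exact: cvg_cst. Qed.

Lemma ccvgD z w a b : z ~~> a -> w ~~> b -> (fun n => z n + w n) ~~> a + b.
Proof.
move=> /ccvg_ReIm[h1 h2] /ccvg_ReIm[h3 h4]; apply/ccvg_ReIm.
by rewrite ReD ImD; split; [under eq_fun do rewrite ReD|
  under eq_fun do rewrite ImD]; exact: cvgD.
Qed.

Lemma ccvgM z w a b : z ~~> a -> w ~~> b -> (fun n => z n * w n) ~~> a * b.
Proof.
have ReM (u v : R[i]) : complex.Re (u * v) =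
  complex.Re u * complex.Re v - complex.Im u * complex.Im v by case: u v => ? ? [].
have ImM (u v : R[i]) : complex.Im (u * v) =
  complex.Re u * complex.Im v + complex.Im u * complex.Re v by case: u v => ? ? [].
move=> /ccvg_ReIm[h1 h2] /ccvg_ReIm[h3 h4]; apply/ccvg_ReIm.
rewrite ReM ImM; split.
  by under eq_fun do rewrite ReM; apply: cvgB; exact: cvgM.
by under eq_fun do rewrite ImM; apply: cvgD; exact: cvgM.
Qed.

Lemma ccvg_cst a : (fun=> a) ~~> a.
Proof. by split; exact: cvg_cst. Qed.

Lemma ccvgN z a : z ~~> a -> (fun n => - z n) ~~> - a.
Proof.
move=> h; rewrite -mulN1r; under eq_fun do rewrite -mulN1r.
exact: ccvgM (ccvg_cst _) h.
Qed.

Lemma ccvg_unique z a b : z ~~> a -> z ~~> b -> a = b.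
Proof.
by move=> [h1] [h2]; apply: (cvg_unique _ h1 h2); exact: norm_hausdorff.
Qed.

Lemma ccvg_sum (I : Type) (r : seq I) (P : pred I) (z : nat -> I -> R[i])
    (a : I -> R[i]) :
  (forall i, P i -> z^~ i ~~> a i) ->
  (fun n => \sum_(i <- r | P i) z n i) ~~> \sum_(i <- r | P i) a i.
Proof.
move=> h; elim: r => [|i r IH].
  by under eq_fun do rewrite big_nil; rewrite big_nil; exact: ccvg_cst.
under eq_fun do rewrite big_cons; rewrite big_cons.
by case: ifPn => [/h hi|//]; exact: ccvgD.
Qed.

End ComplexSequences.

(** * The spectral weight *)

Section SpectralWeight.
Variable R : realType.

Lemma char_poly_conj (F : fieldType) m (P A : 'M[F]_m) :
  P \in unitmx -> char_poly (P *m A *m invmx P) = char_poly A.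
Proof.
move=> Pu; rewrite /char_poly /char_poly_mx.
have PV : map_mx polyC P *m map_mx polyC (invmx P) = 1%:M :> 'M[{poly F}]_m.
  by rewrite -map_mxM mulmxV// map_mx1.
have -> : 'X%:M - map_mx polyC (P *m A *m invmx P) =
    map_mx polyC P *m ('X%:M - map_mx polyC A) *m map_mx polyC (invmx P).
  by rewrite mulmxBr mulmxBl scalar_mxC -(mulmxA 'X%:M) PV mulmx1 !map_mxM.
by rewrite !det_mulmx mulrAC -det_mulmx PV det1 mul1r.
Qed.

Lemma Re_norm_prod (I : Type) (r : seq I) (P : pred I) (F : I -> R[i]) :
  complex.Re `|\prod_(i <- r | P i) F i| =
  \prod_(i <- r | P i) complex.Re `|F i|.
Proof.
apply: (big_morph (fun z => complex.Re `|z|)) => [a b|]; first exact: Re_normM.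
by rewrite normr1.
Qed.

Lemma coef_cvg_prod (I : Type) (r : seq I) (P : pred I)
    (p : nat -> I -> {poly R[i]}) (q : I -> {poly R[i]}) :
  (forall i, P i -> forall k, (fun n => (p n i)`_k) ~~> (q i)`_k) ->
  forall k, (fun n => (\prod_(i <- r | P i) p n i)`_k) ~~>
            (\prod_(i <- r | P i) q i)`_k.
Proof.
move=> h; elim: r => [|i r IH] k.
  by under eq_fun do rewrite big_nil; rewrite big_nil; exact: ccvg_cst.
under eq_fun do rewrite big_cons; rewrite big_cons.
case: ifPn => [/h hi|_]; last exact: IH.
under eq_fun do rewrite coefM; rewrite coefM.
by apply: ccvg_sum => j _; exact: ccvgM.
Qed.

(** By the Leibniz formula each coefficient is a polynomial in the entries. *)
Lemma char_poly_cvg m (A : nat -> 'M[R[i]]_m) (B : 'M[R[i]]_m) :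
  (forall i j, (fun n => A n i j) ~~> B i j) ->
  forall k, (fun n => (char_poly (A n))`_k) ~~> (char_poly B)`_k.
Proof.
move=> AB k; rewrite /char_poly /determinant.
under eq_fun do rewrite coef_sum; rewrite coef_sum.
apply: ccvg_sum => s _.
under eq_fun do rewrite mulr_sign; rewrite mulr_sign.
have h : (fun n => (\prod_i char_poly_mx (A n) i ((s : 'S_m) i))`_k) ~~>
    (\prod_i char_poly_mx B i ((s : 'S_m) i))`_k.
  apply: coef_cvg_prod => i _ l; rewrite /char_poly_mx !mxE coefB coefC.
  under eq_fun do rewrite !mxE coefB coefC.
  apply: ccvgD; first exact: ccvg_cst.
  by apply: ccvgN; case: eqP => _; [exact: AB|exact: ccvg_cst].
by case: ifP => _ //; under eq_fun do rewrite coefN; rewrite coefN; exact: ccvgN.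
Qed.

(* The coefficients of the cofactor are recovered from the top degree down. *)
Lemma coef_cvg_deflate (p : nat -> {poly R[i]}) (q : {poly R[i]}) y x d :
  (forall n, size (p n) <= d)%N -> (size q <= d)%N -> y ~~> x ->
  (forall k, (fun n => (('X - (y n)%:P) * p n)`_k) ~~> (('X - x%:P) * q)`_k) ->
  forall k, (fun n => (p n)`_k) ~~> q`_k.
Proof.
move=> sp sq yx h k.
have [m] := ubnP (d - k); elim: m k => // m IH k; rewrite ltnS => km.
have [dk|kd] := leqP d k.
  rewrite nth_default ?(leq_trans sq)//.
  under eq_fun do rewrite nth_default ?(leq_trans (sp _))//.
  exact: ccvg_cst.
have rec (r : {poly R[i]}) z : r`_k = (('X - z%:P) * r)`_k.+1 + z * r`_k.+1.
  by rewrite mulrBl coefB -commr_polyX coefMX coefCM subrK.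
rewrite (rec q x); under eq_fun => j do rewrite (rec (p j) (y j)).
apply: ccvgD; first exact: h.
apply: ccvgM => //; apply: IH.
by rewrite subnS prednK ?subn_gt0.
Qed.

Lemma horner_cvg (p : nat -> {poly R[i]}) (q : {poly R[i]}) x d :
  (forall n, size (p n) <= d)%N -> (size q <= d)%N ->
  (forall k, (fun n => (p n)`_k) ~~> q`_k) ->
  (fun n => (p n).[x]) ~~> q.[x].
Proof.
move=> sp sq h; rewrite (horner_coef_wide _ sq).
under eq_fun do rewrite (horner_coef_wide _ (sp _)).
by apply: ccvg_sum => i _; apply: ccvgM => //; exact: ccvg_cst.
Qed.

(** The smallest factor is at most the geometric mean of all factors. The product is the absolute
    value at [x] of the monic polynomial with roots [s], so a small value forces a nearby root. *)
Lemma closest_root (s : seq R[i]) x : (0 < size s)%N ->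
  exists2 y, y \in s &
    complex.Re `|x - y| ^+ size s <= \prod_(z <- s) complex.Re `|x - z|.
Proof.
case: s => // z s _.
have [y ys hy] : exists2 y, y \in z :: s & forall w, w \in z :: s ->
    complex.Re `|x - y| <= complex.Re `|x - w|.
  elim: s z => [|w s IH] z.
    by exists z; rewrite ?inE// => ?; rewrite inE => /eqP->.
  have [y ys hy] := IH w.
  have [h|h] := leP (complex.Re `|x - z|) (complex.Re `|x - y|).
    exists z; first by rewrite inE eqxx.
    by move=> v; rewrite inE => /predU1P[->//|/hy]; exact: le_trans.
  exists y; first by rewrite inE ys orbT.
  by move=> v; rewrite inE => /predU1P[->|/hy//]; exact: ltW.
exists y => //; rewrite -[X in _ ^+ X <= _](card_ord (size (z :: s))) -prodr_const.
rewrite [leRHS](big_nth 0) big_mkord; apply: ler_prod => i _.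
by rewrite Re_norm_ge0 hy// mem_nth.
Qed.

(* Deflation: a root of the limit is approached by roots of the sequence, which
   are split off, lowering the degree. *)
Lemma roots_weight_cvg (s : nat -> seq R[i]) (t : seq R[i]) :
  (forall n, size (s n) = size t) ->
  (forall k, (fun n => (\prod_(z <- s n) ('X - z%:P))`_k) ~~>
             (\prod_(z <- t) ('X - z%:P))`_k) ->
  (fun n => \sum_(z <- s n) complex.Re `|z|) @ \oo -->
    \sum_(z <- t) complex.Re `|z|.
Proof.
elim: t s => [|x t IH] s sz h.
  under eq_fun do rewrite (size0nil (sz _)) big_nil.
  by rewrite big_nil; exact: cvg_cst.
have /choice[y hy] : forall n, exists y, y \in s n /\
    complex.Re `|x - y| ^+ size (s n) <= \prod_(z <- s n) complex.Re `|x - z|.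
  by move=> n; have [|y] := @closest_root (s n) x; rewrite ?sz//; exists y.
have pn n : perm_eq (s n) (y n :: rem (y n) (s n)).
  exact: perm_to_rem (hy n).1.
have sr n : size (rem (y n) (s n)) = size t by rewrite size_rem ?sz//; case: (hy n).
have yx : y ~~> x.
  have s1 m : (size (\prod_(z <- s m) ('X - z%:P))%R <= (size t).+2)%N.
    by rewrite size_prod_XsubC sz.
  have s2 : (size (\prod_(z <- x :: t) ('X - z%:P))%R <= (size t).+2)%N.
    by rewrite size_prod_XsubC.
  (* The limit polynomial vanishes at [x], so the values at [x] tend to 0 and the closest roots
     [y n] tend to [x]. *)
  have := horner_cvg x s1 s2 h.
  rewrite big_cons !hornerE subrr mul0r => /ccvgP h0.
  apply/ccvgP => e e0.
  have /h0 : 0 < e ^+ (size t).+1 by rewrite exprn_gt0.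
  apply: filterS => n; rewrite sub0r normrN horner_prod Re_norm_prod => hn.
  rewrite -(@ltr_pXn2r _ (size t).+1) ?nnegrE ?Re_norm_ge0 ?(ltW e0)//.
  apply: le_lt_trans hn; have := (hy n).2; rewrite sz => /le_trans; apply.
  by under [leRHS]eq_bigr do rewrite !hornerE.
have ih := IH _ sr; rewrite big_cons.
under eq_fun do rewrite (perm_big _ (pn _)) big_cons.
apply: cvgD; first exact: ccvg_norm.
apply: ih; apply: (@coef_cvg_deflate _ _ y x (size t).+1) => //.
- by move=> n; rewrite size_prod_XsubC sr.
- by rewrite size_prod_XsubC.
move=> k; have := h k; rewrite big_cons.
by under eq_fun do rewrite (perm_big _ (pn _)) big_cons.
Qed.

Variable n : nat.
Implicit Types A P : 'M[R[i]]_(n + n).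

Lemma char_poly_eigenvalues A :
  char_poly A = \prod_(z <- eigenvalues A) ('X - z%:P).
Proof.
rewrite /eigenvalues; case: closed_field_poly_normal => /= r.
by rewrite (eqP (char_poly_monic A)) scale1r.
Qed.

Lemma size_eigenvalues A : size (eigenvalues A) = (n + n)%N.
Proof.
by apply: succn_inj; rewrite -(size_char_poly A) char_poly_eigenvalues size_prod_XsubC.
Qed.

Lemma perm_eigenvalues A (s : seq R[i]) :
  char_poly A = \prod_(z <- s) ('X - z%:P) -> perm_eq (eigenvalues A) s.
Proof. by rewrite char_poly_eigenvalues => /prod_XsubC_eq. Qed.

Lemma spectral_weight_conj P A : P \in unitmx ->
  spectral_weight (P *m A *m invmx P) = spectral_weight A.
Proof.
move=> Pu; rewrite /spectral_weight; apply/perm_big/perm_eigenvalues.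
by rewrite char_poly_conj// char_poly_eigenvalues.
Qed.

Lemma spectral_weight_cvg (A : nat -> 'M[R[i]]_(n + n)) (B : 'M[R[i]]_(n + n)) :
  (forall i j, (fun k => A k i j) ~~> B i j) ->
  (fun k => spectral_weight (A k)) @ \oo --> spectral_weight B.
Proof.
move=> AB.
apply: (@roots_weight_cvg (fun k => eigenvalues (A k)) (eigenvalues B)) => k.
  exact: etrans (size_eigenvalues _) (esym (size_eigenvalues _)).
have := char_poly_cvg AB k; rewrite char_poly_eigenvalues.
by under eq_fun do rewrite char_poly_eigenvalues.
Qed.

Lemma perm_eigenvalues_trig A : is_trig_mx A ->
  perm_eq (eigenvalues A) [seq A i i | i : 'I_(n + n)].
Proof.
move=> tA; apply: perm_eigenvalues; rewrite char_poly_trig//.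
by rewrite big_map big_enum.
Qed.

Lemma spectral_weight_trig A : is_trig_mx A ->
  spectral_weight A = \sum_i complex.Re `|A i i|.
Proof.
move=> tA; rewrite /spectral_weight (perm_big _ (perm_eigenvalues_trig tA)).
by rewrite /= big_map big_enum.
Qed.

Lemma sqr_trig_diag m (T : 'M[R[i]]_m) i :
  is_trig_mx T -> (T *m T) i i = T i i * T i i.
Proof.
move=> /is_trig_mxP tT; rewrite mxE (bigD1 i)//= big1 ?addr0// => j ji.
have [ij|ij|/val_inj ij] := ltngtP i j.
- by rewrite (tT i j ij) mul0r.
- by rewrite (tT j i ij) mulr0.
- by rewrite ij eqxx in ji.
Qed.

Lemma trig_mx_sqr m (T : 'M[R[i]]_m) : is_trig_mx T -> is_trig_mx (T *m T).
Proof.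
move=> /is_trig_mxP tT; apply/is_trig_mxP => i j ij; rewrite mxE big1// => k _.
have [ik|ki] := ltnP i k; first by rewrite tT ?mul0r.
by rewrite (tT k j) ?mulr0// (leq_ltn_trans ki).
Qed.

(** The sum of the squared deviations from the mean [b] is nonnegative. For [m = 0] the convention
    [0^-1 = 0] makes both sides 0. *)
Lemma sum_sqr_ge m (a : 'I_m -> R) :
  m%:R^-1 * (\sum_i a i) ^+ 2 <= \sum_i a i ^+ 2.
Proof.
case: m a => [|m] a; first by rewrite invr0 mul0r sumr_ge0// => i _; exact: sqr_ge0.
pose S := \sum_i a i; pose b := m.+1%:R^-1 * S.
have : 0 <= \sum_i (a i - b) ^+ 2 by apply: sumr_ge0 => i _; exact: sqr_ge0.
have -> : \sum_i (a i - b) ^+ 2 = \sum_i a i ^+ 2 - b * S *+ 2 + b ^+ 2 *+ m.+1.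
  under eq_bigr do rewrite sqrrB; rewrite big_split sumrB /=.
  by rewrite sumr_const card_ord sumrMnl -mulr_suml mulrC.
have bS : b *+ m.+1 = S by rewrite -mulr_natl mulrA divff ?mul1r// pnatr_eq0.
have -> : b ^+ 2 *+ m.+1 = b * S by rewrite expr2 -mulrnAr bS.
have -> : m.+1%:R^-1 * (\sum_i a i) ^+ 2 = b * S by rewrite expr2 mulrA.
by move: (\sum_i _ ^+ 2) => A2; lra.
Qed.

(* Unitary triangularization turns both weights into sums over a diagonal. *)
Lemma lagrangian_mx_ge0 A :
  0 <= spectral_weight (A *m A) - (2 * n)%:R^-1 * spectral_weight A ^+ 2.
Proof.
have [T [tT wA wAA]] : exists T : 'M[R[i]]_(n + n), [/\ is_trig_mx T,
    spectral_weight A = spectral_weight T &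
    spectral_weight (A *m A) = spectral_weight (T *m T)].
  (* The Schur decomposition asks for positive dimension; an empty matrix is triangular already. *)
  have [/eqP n0|n0] := posnP (n + n).
    exists A; split=> //; apply/is_trig_mxP => i.
    by have := ltn_ord i; rewrite [X in (_ < X)%N](eqP n0).
  have [P uP tP] := Schur A n0.
  have Pu := unitarymx_unit uP.
  exists (P *m A *m invmx P); split.
  - by move: tP; rewrite /similar_to /conjmx pinvmxE.
  - by rewrite spectral_weight_conj.
  by rewrite -(spectral_weight_conj (A *m A) Pu) !mulmxA mulmxKV.
rewrite wA wAA (spectral_weight_trig tT) (spectral_weight_trig (trig_mx_sqr tT)).
rewrite subr_ge0 mul2n -addnn; apply: (le_trans (sum_sqr_ge _)).
by apply: ler_sum => i _; rewrite (sqr_trig_diag i tT) Re_normM expr2.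
Qed.

End SpectralWeight.

(** * Hermitian forms and the indefinite product *)

Local Notation "A ^H" := (map_mx Num.conj (A^T)) (at level 8, format "A ^H").

Section HermitianForms.
Variable C : numClosedFieldType.

Definition sesq m (B : 'M[C]_m) (u v : 'cV[C]_m) : C := (u^H *m B *m v) 0 0.

Lemma sesqDl m (B : 'M[C]_m) u u' v : sesq B (u + u') v = sesq B u v + sesq B u' v.
Proof. by rewrite /sesq !linearD /= map_mxD !mulmxDl mxE. Qed.

Lemma sesqDr m (B : 'M[C]_m) u v v' : sesq B u (v + v') = sesq B u v + sesq B u v'.
Proof. by rewrite /sesq mulmxDr mxE. Qed.

Lemma sesqZl m (B : 'M[C]_m) a u v : sesq B (a *: u) v = a^* * sesq B u v.
Proof. by rewrite /sesq linearZ /= map_mxZ -!scalemxAl mxE. Qed.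

Lemma sesqZr m (B : 'M[C]_m) a u v : sesq B u (a *: v) = a * sesq B u v.
Proof. by rewrite /sesq -scalemxAr mxE. Qed.

Lemma sesqE m (B : 'M[C]_m) u v :
  sesq B u v = \sum_i \sum_j (u i 0)^* * B i j * v j 0.
Proof.
rewrite /sesq mxE exchange_big; apply: eq_bigr => j _.
rewrite mxE mulr_suml; apply: eq_bigr => i _.
by rewrite !mxE.
Qed.

Lemma sesq_delta m (B : 'M[C]_m) i j :
  sesq B (delta_mx i 0) (delta_mx j 0) = B i j.
Proof.
rewrite sesqE (bigD1 i)//= [X in _ + X]big1 => [|k /negbTE ki]; last first.
  by rewrite big1// => l _; rewrite !mxE ki /= conjC0 !mul0r.
rewrite (bigD1 j)//= big1 => [|k /negbTE kj]; last by rewrite !mxE kj /= mulr0.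
by rewrite !mxE !eqxx /= conjC1 mul1r mulr1 !addr0.
Qed.

Lemma sesq_mx m p (B : 'M[C]_m) (Q : 'M[C]_(m, p)) u v :
  sesq B (Q *m u) (Q *m v) = sesq (Q^H *m B *m Q) u v.
Proof. by rewrite /sesq trmx_mul map_mxM !mulmxA. Qed.

(** Complex sesquilinear forms are determined by their diagonal values. The difference is written
    [(-1) *: v] to give all four terms one shape, so that the scaling lemmas apply uniformly. *)
Lemma polarization m (B : 'M[C]_m) u v :
  sesq B u v = 4^-1 * (sesq B (u + v) (u + v) - sesq B (u + (-1) *: v) (u + (-1) *: v)
    - 'i * (sesq B (u + 'i *: v) (u + 'i *: v)
            - sesq B (u + (- 'i) *: v) (u + (- 'i) *: v))).
Proof.
rewrite !(sesqDl, sesqDr, sesqZl, sesqZr) !rmorphN /= conjCi conjC1.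
have ii : 'i * 'i = -1 :> C by rewrite -expr2 sqrCi.
move: (sesq B u u) (sesq B u v) (sesq B v u) (sesq B v v) => a b c d.
have -> : a + b + (c + d) -
   (a + -1 * b + (-1 * c + -1 * (-1 * d))) -
   'i * (a + 'i * b + (- 'i * c + - 'i * ('i * d)) - 
   (a + - 'i * b + (- - 'i * c + - - 'i * (- 'i * d)))) =
   2 * b + 2 * c - 2 * ('i * 'i) * b + 2 * ('i * 'i) * c by ring.
by rewrite ii; field.
Qed.

Definition psd m (B : 'M[C]_m) : Prop := forall u, 0 <= sesq B u u.

(** Real diagonal values suffice: exchanging the two arguments in the polarization identity amounts
    to conjugating it. *)
Lemma psd_hermitian m (B : 'M[C]_m) : psd B -> B^H = B.
Proof.
move=> pB; have real u : (sesq B u u)^* = sesq B u u.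
  by apply/CrealP/ger0_real/pB.
apply/matrixP => i j; rewrite !mxE -!sesq_delta.
rewrite [in LHS]polarization [in RHS]polarization.
set u : 'cV_m := delta_mx i 0; set v : 'cV_m := delta_mx j 0.
have e1 : v + u = u + v by rewrite addrC.
have e2 w : w = u + (-1) *: v -> sesq B (v + (-1) *: u) (v + (-1) *: u) = sesq B w w.
  move=> ->; rewrite (_ : v + _ = (-1) *: (u + (-1) *: v)).
    by rewrite sesqZl sesqZr rmorphN /= conjC1 !mulN1r opprK.
  by rewrite scalerDr scalerA mulrNN mulr1 scale1r addrC.
(* Unit scalars do not change diagonal values; with ['i] and [- 'i] this matches the terms for
   [(v, u)] with those for [(u, v)]. *)
have cc (z : C) w : z * z^* = 1 -> sesq B (z *: w) (z *: w) = sesq B w w.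
  by move=> zz; rewrite sesqZl sesqZr mulrA [_^* * _]mulrC zz mul1r.
have ii : 'i * 'i = -1 :> C by rewrite -expr2 sqrCi.
have e3 : sesq B (v + 'i *: u) (v + 'i *: u) =
    sesq B (u + (- 'i) *: v) (u + (- 'i) *: v).
  rewrite -[RHS](@cc 'i) ?conjCi ?mulrN ?ii ?opprK//.
  by rewrite scalerDr scalerA mulrN ii opprK scale1r addrC.
have e4 : sesq B (v + (- 'i) *: u) (v + (- 'i) *: u) =
    sesq B (u + 'i *: v) (u + 'i *: v).
  have c4 : - 'i * (- 'i)^* = 1 :> C by rewrite rmorphN /= conjCi opprK mulNr ii opprK.
  rewrite -[RHS](cc _ _ c4).
  by rewrite scalerDr scalerA mulNr ii opprK scale1r addrC.
rewrite e1 (e2 _ erefl) e3 e4 !(rmorphM, rmorphB) /= !real conjCi fmorphV /= conjC_nat.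
by congr (_ * _); ring.
Qed.

Lemma sesq_diag_mx m (d : 'rV[C]_m) u :
  sesq (diag_mx d) u u = \sum_i d 0 i * `|u i 0| ^+ 2.
Proof.
rewrite sesqE; apply: eq_bigr => i _; rewrite (bigD1 i)//= big1 ?addr0.
  by rewrite mxE eqxx mulr1n mulrAC -normCKC mulrC.
by move=> j /negbTE ij; rewrite mxE eq_sym ij mulr0n mulr0 mul0r.
Qed.

(* A vector supported where the form is positive and annihilated by [F] would
   violate the hypothesis, so [F] is injective on such vectors. *)
Lemma positive_index m k (T : 'M[C]_m) (F : 'M[C]_(k, m)) (Q : 'M[C]_m) e :
  (forall z, F *m z = 0 -> sesq T z z <= 0) ->
  Q^H *m T *m Q = diag_mx e -> (#|[set i | (0 < e 0 i)%R]%SET| <= k)%N.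
Proof.
move=> FT QTQ; set A := [set i | _]%SET; rewrite leqNgt; apply/negP => kA.
pose Y := colsub (fun i : 'I_#|A| => enum_val i) Q.
(* [F *m Y] has rank at most [k] but more than [k] columns, so some nonzero [y] is annihilated by
   it. *)
have : cokermx (F *m Y) != 0.
  rewrite -mxrank_eq0 mxrank_coker subn_eq0 -ltnNge.
  exact: leq_ltn_trans (rank_leq_row _) kA.
move=> /matrix0Pn[i [j ij0]].
pose y := col j (cokermx (F *m Y)).
have FYy : F *m (Y *m y) = 0.
  by rewrite mulmxA /y colE mulmxA mulmx_coker mul0mx.
have := FT _ FYy; rewrite sesq_mx.
have -> : Y^H *m T *m Y = diag_mx (\row_k e 0 (enum_val k)).
  have -> : Y^H *m T *m Y = mxsub (@enum_val _ (mem A)) (@enum_val _ (mem A)) (Q^H *m T *m Q).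
    rewrite /Y; apply/matrixP => a b; rewrite !mxE; apply: eq_bigr => c _.
    by rewrite !mxE; congr (_ * _); apply: eq_bigr => l _; rewrite !mxE.
  rewrite QTQ; apply/matrixP => a b; rewrite !mxE.
  by rewrite (inj_eq enum_val_inj).
rewrite sesq_diag_mx => /le_gtF/negP; apply.
have pe (l : 'I_#|A|) : 0 < e 0 (enum_val l) by have := enum_valP l; rewrite finset.in_set.
rewrite (bigD1 i)//= ltr_pwDl//.
  by rewrite mxE mulr_gt0// exprn_gt0// normr_gt0 mxE.
by apply: sumr_ge0 => l _; rewrite mxE mulr_ge0// ?(ltW (pe _))// exprn_ge0.
Qed.

End HermitianForms.

(** * Pseudo-unitary diagonalization of definite forms *)

Section PseudoDiagonalization.
Variable C : numClosedFieldType.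

Lemma adjmxM m k l (A : 'M[C]_(m, k)) (B : 'M[C]_(k, l)) :
  (A *m B)^H = B^H *m A^H.
Proof. by rewrite trmx_mul map_mxM. Qed.

Lemma adjmxK m k (A : 'M[C]_(m, k)) : A^H^H = A.
Proof. by apply/matrixP => i j; rewrite !mxE conjCK. Qed.

Lemma adjmx_unit m (A : 'M[C]_m) : (A^H \in unitmx) = (A \in unitmx).
Proof. by rewrite map_unitmx unitmx_tr. Qed.

Lemma hermitian_diagonalization m (A : 'M[C]_m) : A^H = A ->
  exists (V : 'M[C]_m) (e : 'rV[C]_m), [/\ V *m V^H = 1%:M, forall i, e 0 i \is Num.real &
    V *m A *m V^H = diag_mx e].
Proof.
move=> AH; have Ah : A \is hermsymmx by apply/is_hermitianmxP; rewrite expr0 scale1r AH.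
have VU := spectral_unitarymx A; have /unitarymxP VV := VU.
exists (spectralmx A), (spectral_diag A); split=> //.
  by move=> i; have /mxOverP := hermitian_spectral_diag_real Ah; exact.
have /orthomx_spectralP {2}-> := hermitian_normalmx Ah.
by rewrite !mulmxA mulmxV ?unitarymx_unit// mul1mx -mulmxA VV mulmx1.
Qed.

(** A unitary diagonalization followed by rescaling with the inverse square roots of the
    eigenvalues. *)
Lemma posdef_congruent_one m (B : 'M[C]_m) :
  (forall u, u != 0 -> 0 < sesq B u u) ->
  exists2 P : 'M[C]_m, P \in unitmx & P^H *m B *m P = 1%:M.
Proof.
move=> pB; have BH : B^H = B.
  apply: psd_hermitian => u; have [->|/pB/ltW//] := eqVneq u 0.
  by rewrite /sesq mulmx0 mxE.
have [V [d [VV _ Vd]]] := hermitian_diagonalization BH.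
have Vu : V \in unitmx by case/mulmx1_unit: VV.
have d0 i : 0 < d 0 i.
  have <- : sesq B (V^H *m delta_mx i 0) (V^H *m delta_mx i 0) = d 0 i.
    by rewrite sesq_mx adjmxK Vd sesq_delta mxE eqxx mulr1n.
  apply: pB; apply/eqP => /(congr1 (mulmx V)); rewrite mulmxA VV mul1mx mulmx0.
  by move/matrixP/(_ i 0); rewrite !mxE !eqxx /= => /eqP; rewrite oner_eq0.
pose r : 'rV[C]_m := \row_i (sqrtC (d 0 i))^-1.
have rr : (diag_mx r)^H = diag_mx r.
  apply/matrixP => i j; rewrite !mxE eq_sym.
  have [->|_] := eqVneq i j; last by rewrite !mulr0n conjC0.
  by rewrite !mulr1n; apply/CrealP; rewrite realV ger0_real// sqrtC_ge0 ltW.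
exists (V^H *m diag_mx r).
  rewrite unitmx_mul adjmx_unit Vu /= unitmxE det_diag unitfE.
  by apply/prodf_neq0 => i _; rewrite mxE invr_eq0 sqrtC_eq0 gt_eqF.
rewrite adjmxM adjmxK rr !mulmxA -(mulmxA _ V) -(mulmxA _ _ V^H) Vd.
apply/matrixP => i j; rewrite mul_mx_diag mul_diag_mx !mxE.
have [->|_] := eqVneq i j; last by rewrite !mulr0n mulr0 mul0r.
rewrite !mulr1n -[X in _ * X * _]sqrtCK expr2 mulrA mulVf ?mul1r ?divff//.
  by rewrite sqrtC_eq0 gt_eqF.
by rewrite sqrtC_eq0 gt_eqF.
Qed.

Variable n : nat.

Definition sign_row : 'rV[C]_(n + n) := \row_i (if (i < n)%N then 1 else -1).

Lemma sign_row_lshift i : sign_row 0 (lshift n i) = 1.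
Proof. by rewrite mxE /= ltn_ord. Qed.

Lemma sign_row_rshift i : sign_row 0 (rshift n i) = - 1.
Proof. by rewrite mxE /= ltnNge leq_addr. Qed.

Lemma sign_rowK i : sign_row 0 i * sign_row 0 i = 1.
Proof. by rewrite mxE; case: ifP; rewrite ?mulrNN mulr1. Qed.

Lemma sesq_sign (z : 'cV[C]_(n + n)) : sesq (diag_mx sign_row) z z =
  \sum_i `|usubmx z i 0| ^+ 2 - \sum_i `|dsubmx z i 0| ^+ 2.
Proof.
rewrite sesq_diag_mx big_split_ord /= -sumrN; congr (_ + _);
  apply: eq_bigr => i _; rewrite ?sign_row_lshift ?sign_row_rshift !mxE.
  by rewrite mul1r.
by rewrite mulN1r.
Qed.

Lemma sum_normX2_ge0 m (z : 'cV[C]_m) : 0 <= \sum_i `|z i 0| ^+ 2.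
Proof. by apply: sumr_ge0 => i _; rewrite exprn_ge0. Qed.

(** Sylvester's law of inertia. The form is nonpositive on vectors with vanishing upper half, so at
    most [n] entries are positive; the same argument for the negated form bounds the number of
    negative entries by [n], and there are [n + n] nonzero entries. *)
Lemma diag_sign_inertia (Q : 'M[C]_(n + n)) (e : 'rV[C]_(n + n)) :
  Q \in unitmx -> (forall i, e 0 i \is Num.real) ->
  Q^H *m diag_mx sign_row *m Q = diag_mx e ->
  (forall i, e 0 i != 0) /\ #|[set i | (0 < e 0 i)%R]%SET| = n.
Proof.
move=> Qu re Qe.
have e0 i : e 0 i != 0.
  have : diag_mx e \in unitmx.
    rewrite -Qe !unitmx_mul adjmx_unit Qu andbT /= unitmxE det_diag unitfE.
    by apply/prodf_neq0 => j _; rewrite mxE; case: ifP; rewrite ?oppr_eq0 oner_eq0.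
  by rewrite unitmxE det_diag unitfE => /prodf_neq0; exact.
split=> //; set A := [set _ | _]%SET.
have A1 : (#|A| <= n)%N.
  apply: (positive_index (T := diag_mx sign_row) (F := usubmx 1%:M) (Q := Q)) => // z.
  rewrite mul_usub_mx mul1mx sesq_sign => ->.
  rewrite big1 => [|i _]; last by rewrite mxE normr0 expr0n.
  by rewrite sub0r oppr_le0 sum_normX2_ge0.
have A2 : (#|~: A| <= n)%N.
  have -> : (~: A = [set i | (0 < (- e) 0 i)%R])%SET.
    apply/setP => i; rewrite !finset.in_set mxE oppr_gt0.
    by rewrite -real_leNgt ?real0// le_eqVlt (negbTE (e0 i)).
  apply: (positive_index (T := - diag_mx sign_row) (F := dsubmx 1%:M) (Q := Q)) => // [z|].
    rewrite mul_dsub_mx mul1mx => dz.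
    have -> : sesq (- diag_mx sign_row) z z = - sesq (diag_mx sign_row) z z.
      by rewrite /sesq mulmxN mulNmx mxE.
    rewrite sesq_sign dz [X in _ - X]big1 => [|i _]; last by rewrite mxE normr0 expr0n.
    by rewrite subr0 oppr_le0 sum_normX2_ge0.
  by rewrite mulmxN mulNmx Qe linearN.
have := cardsC A; rewrite card_ord => AC.
apply/eqP; rewrite eqn_leq A1 /= -(leq_add2r n).
by rewrite -[X in (X <= _)%N]AC leq_add2l.
Qed.

(* Two successive spectral decompositions reduce [B] to the identity and the
   signature to a diagonal matrix, which has the right signs up to order. *)
Lemma pseudo_unitary_diagonalization (B : 'M[C]_(n + n)) :
  (forall u, u != 0 -> 0 < sesq B u u) ->
  exists (Q : 'M[C]_(n + n)) (a : 'rV[C]_(n + n)), [/\ forall i, 0 < a 0 i,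
    Q^H *m diag_mx sign_row *m Q = diag_mx sign_row &
    Q^H *m B *m Q = diag_mx a].
Proof.
move=> pB; have [P Pu PB] := posdef_congruent_one pB.
pose S := diag_mx sign_row.
have SH : S^H = S.
  apply/matrixP => i j; rewrite !mxE eq_sym.
  have [->|_] := eqVneq i j; last by rewrite !mulr0n conjC0.
  by rewrite !mulr1n; case: ifP => _; rewrite ?rmorphN /= conjC1.
have HH : (P^H *m S *m P)^H = P^H *m S *m P.
  by rewrite !adjmxM adjmxK SH mulmxA.
have [V [e [VV re Ve]]] := hermitian_diagonalization HH.
have Vu : V \in unitmx by case/mulmx1_unit: VV.
pose Q := P *m V^H.
have Qu : Q \in unitmx by rewrite unitmx_mul Pu adjmx_unit.
have QS : Q^H *m S *m Q = diag_mx e by rewrite -Ve adjmxM adjmxK !mulmxA.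
have QB : Q^H *m B *m Q = 1%:M.
  have -> : Q^H *m B *m Q = V *m (P^H *m B *m P) *m V^H.
    by rewrite adjmxM adjmxK !mulmxA.
  by rewrite PB mulmx1.
have [e0 cA] := diag_sign_inertia Qu re QS.
set A := [set _ | _]%SET in cA.
(* The positive entries are listed before the negative ones, as in the signature; [f] is the
   resulting permutation. *)
pose s := enum A ++ enum (~: A)%SET.
have us : uniq s.
  rewrite cat_uniq !enum_uniq andbT /=; apply/hasPn => i.
  by rewrite !mem_enum finset.in_setC.
have ss : size s = (n + n)%N.
  by rewrite size_cat -!cardE cardsC card_ord.
pose f (i : 'I_(n + n)) := nth i s i.
have f_inj : injective f.
  move=> i j; rewrite /f (set_nth_default j) ?ss// => /eqP.
  by rewrite nth_uniq ?ss// => /eqP/val_inj.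
have fA i : (0 < e 0 (f i)) = (i < n)%N.
  have -> : (0 < e 0 (f i)) = (f i \in A) by rewrite finset.in_set.
  rewrite /f nth_cat -cardE cA; case: ltnP => ni.
    by rewrite -mem_enum mem_nth// -cardE cA.
  apply/negbTE; rewrite -finset.in_setC -mem_enum mem_nth// -cardE.
  have := cardsC A; rewrite card_ord cA => /eqP; rewrite eqn_add2l => /eqP ->.
  by rewrite ltn_subLR.
(* Rescaling by [a] normalizes each entry of [e] to its sign. The same rescaling turns the identity,
   to which [B] has been reduced, into the diagonal matrix of the squares of [a]. *)
pose a : 'rV[C]_(n + n) := \row_i (sqrtC `|e 0 (f i)|)^-1.
have a0 i : 0 < a 0 i by rewrite mxE invr_gt0 sqrtC_gt0 normr_gt0.
pose G := colsub f Q *m diag_mx a.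
have GE T d : Q^H *m T *m Q = diag_mx d ->
    G^H *m T *m G = diag_mx (\row_i (a 0 i * a 0 i * d 0 (f i))).
  move=> Td; have aH : (diag_mx a)^H = diag_mx a.
    apply/matrixP => i j; rewrite mxE [in RHS]mxE mxE mxE eq_sym.
    have [->|_] := eqVneq i j; last by rewrite !mulr0n conjC0.
    by rewrite !mulr1n; apply/CrealP; rewrite gtr0_real.
  have cE : (colsub f Q)^H *m T *m colsub f Q = mxsub f f (Q^H *m T *m Q).
    apply/matrixP => i j; rewrite !mxE; apply: eq_bigr => k _.
    by rewrite !mxE; congr (_ * _); apply: eq_bigr => l _; rewrite !mxE.
  rewrite /G adjmxM aH !mulmxA -(mulmxA _ _ T) -(mulmxA _ _ (colsub f Q)).
  rewrite cE Td; apply/matrixP => i j; rewrite mul_mx_diag mul_diag_mx.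
  rewrite [LHS]mxE [X in X * _ = _]mxE [X in _ * X * _ = _]mxE.
  rewrite [X in _ * X * _ = _]mxE (inj_eq f_inj) [RHS]mxE [X in _ = X *+ _]mxE.
  have [->|_] := eqVneq i j; last by rewrite !mulr0n mulr0 mul0r.
  by rewrite !mulr1n mulrAC.
exists G, (\row_i (a 0 i * a 0 i)); split.
- by move=> i; rewrite mxE mulr_gt0.
- rewrite (GE _ _ QS); congr diag_mx; apply/rowP => i; rewrite !mxE.
  have aa : (sqrtC `|e 0 (f i)|)^-1 * (sqrtC `|e 0 (f i)|)^-1 = `|e 0 (f i)|^-1.
    by rewrite -invfM -expr2 sqrtCK.
  rewrite aa -fA; case: ifP => h; first by rewrite gtr0_norm ?mulVf.
  rewrite ltr0_norm ?invrN ?mulNr ?mulVf//.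
  by rewrite real_ltNge ?real0// le_eqVlt eq_sym (negbTE (e0 _)) h.
- have QB1 : Q^H *m B *m Q = diag_mx (const_mx 1) by rewrite QB diag_const_mx.
  by rewrite (GE _ _ QB1); congr diag_mx; apply/rowP => i; rewrite !mxE mulr1.
Qed.

End PseudoDiagonalization.

(** * The indefinite inner product and the spectral weight of definite operators *)

Section Krein.
Variables (R : realType) (n : nat).
Implicit Types (u v : 'cV[R[i]]_(n + n)) (A B M U Q : 'M[R[i]]_(n + n)).
Local Notation S := (signature R n).

Lemma signature_diag : S = diag_mx (sign_row _ n).
Proof.
apply/matrixP => i j; rewrite [RHS]mxE /signature -(splitK i) -(splitK j).
case: (fintype.split i) => k; case: (fintype.split j) => l /=.
- by rewrite block_mxEul mxE eq_lshift sign_row_lshift.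
- by rewrite block_mxEur mxE eq_lrshift.
- by rewrite block_mxEdl mxE eq_rlshift.
- by rewrite block_mxEdr !mxE eq_rshift /= ltnNge leq_addr mulNrn.
Qed.

Lemma signatureK : S *m S = 1%:M.
Proof.
rewrite signature_diag mulmx_diag; apply/matrixP => i j.
by rewrite [LHS]mxE [X in X *+ _]mxE sign_rowK mxE.
Qed.

Lemma krein_sesq u v : krein_product u v = sesq S u v.
Proof.
rewrite /krein_product /euclidean_product /sesq -mulmxA mxE.
by apply: eq_bigr => i _; rewrite !mxE.
Qed.

Lemma krein_sesqM u A v : krein_product u (A *m v) = sesq (S *m A) u v.
Proof. by rewrite krein_sesq /sesq !mulmxA. Qed.

Lemma krein_inj A B :
  (forall u v, krein_product u (A *m v) = krein_product u (B *m v)) -> A = B.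
Proof.
move=> AB; rewrite -[A]mul1mx -[B]mul1mx -signatureK -!mulmxA; congr (_ *m _).
by apply/matrixP => i j; rewrite -!sesq_delta -!krein_sesqM.
Qed.

Lemma krein_unitary_product U u v :
  krein_unitary U -> krein_product (U *m u) (U *m v) = krein_product u v.
Proof. by move=> [Uu Ua]; rewrite -Ua mulmxA mulVmx// mul1mx. Qed.

Lemma krein_unitary1 : krein_unitary (1%:M : 'M[R[i]]_(n + n)).
Proof.
split=> [|u v]; first exact: unitmx1.
by rewrite invmx1 !mul1mx.
Qed.

Lemma sesq1_gt0 u : u != 0 -> 0 < sesq 1%:M u u.
Proof.
move=> /matrix0Pn[i [j]]; rewrite (ord1 j) => ui.
rewrite -diag_const_mx sesq_diag_mx (bigD1 i)//= ltr_pwDl//.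
  by rewrite mxE mul1r exprn_gt0// normr_gt0.
by apply: sumr_ge0 => k _; rewrite mxE mul1r exprn_ge0.
Qed.

Lemma tr_adjmx_mul_ge0 Q : 0 <= \tr (Q^H *m Q).
Proof.
apply: sumr_ge0 => i _; rewrite mxE; apply: sumr_ge0 => j _.
by rewrite !mxE -normCKC exprn_ge0.
Qed.

(* A form that is positive definite can be diagonalized by a pseudo-unitary
   matrix, and its trace then equals the spectral weight. *)
Lemma posdef_pseudo_unitary M :
  (forall u, u != 0 -> 0 < krein_product u (- M *m u)) ->
  exists Q, [/\ Q \in unitmx, Q^H *m S *m Q = S &
    complex.Re (\tr (Q^H *m (- S *m M) *m Q)) = spectral_weight M].
Proof.
move=> pM; have pB u : u != 0 -> 0 < sesq (- S *m M) u u.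
  by move/pM; rewrite krein_sesqM mulmxN mulNmx.
have [Q [a [a0 QS Qa]]] := pseudo_unitary_diagonalization pB.
rewrite -signature_diag in QS.
have Qu : Q \in unitmx.
  have : Q^H *m S *m Q \in unitmx by rewrite QS; case/mulmx1_unit: signatureK.
  by rewrite unitmx_mul => /andP[].
exists Q; split=> //.
rewrite Qa -(spectral_weight_conj M (P := invmx Q)) ?unitmx_inv// invmxK.
have SQ : S *m invmx Q = Q^H *m S by rewrite -{1}QS mulmxK.
(* [Q] preserves the signature, so [M] is similar to minus the signature times [diag_mx a]: its
   eigenvalues are the [a i] up to sign, and their absolute values add up to the trace of
   [diag_mx a]. *)
have -> : invmx Q *m M *m Q = diag_mx (\row_i (- (sign_row _ n 0 i * a 0 i))).
  rewrite -[LHS]mul1mx -signatureK -!mulmxA (mulmxA _ (invmx Q)) SQ.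
  have -> : Q^H *m S *m (M *m Q) = - diag_mx a.
    by rewrite -Qa mulNmx mulmxN mulNmx opprK !mulmxA.
  rewrite signature_diag mulmxN mulmx_diag -linearN; congr diag_mx.
  by apply/rowP => i; rewrite !mxE.
rewrite spectral_weight_trig; last exact/diag_mx_is_trig.
rewrite mxtrace_diag raddf_sum; apply: eq_bigr => i _.
rewrite !mxE eqxx mulr1n normrN normrM.
have -> : `|if (i < n)%N then 1 else -1 : R[i]| = 1.
  by case: ifP; rewrite ?normrN normr1.
by rewrite mul1r gtr0_norm.
Qed.

Lemma krein_unitary_invmx Q :
  Q \in unitmx -> Q^H *m S *m Q = S -> krein_unitary (invmx Q).
Proof.
move=> Qu QS; split=> [|u v]; first by rewrite unitmx_inv.
have SQ : S *m invmx Q = Q^H *m S by rewrite -{1}QS mulmxK.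
by rewrite invmxK krein_sesqM SQ krein_sesq /sesq adjmxM !mulmxA.
Qed.

(* [M] is perturbed to be strictly definite; the spectral weight is continuous. *)
Lemma trace_bounded_by_spectral_weight M :
  (forall u, 0 <= krein_product u (- M *m u)) ->
  exists2 U, krein_unitary U &
    complex.Re (\tr (- S *m (U *m M *m invmx U))) <= spectral_weight M + 1.
Proof.
move=> pM; pose eps (k : nat) : R[i] := (k.+1%:R^-1)%:C.
have eps_gt0 k : 0 < eps k by rewrite ltcR invr_gt0.
(* Since [S *m S] is the identity, this adds [eps k] times the identity to [- S *m M] and makes the
   form strictly definite. *)
pose M' k := M - eps k *: S.
have cM : (fun k => spectral_weight (M' k)) @ \oo --> spectral_weight M.
  apply: spectral_weight_cvg => i j.
  have -> : M i j = M i j - 0 * S i j by rewrite mul0r subr0.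
  have -> : (fun k => M' k i j) = (fun k => M i j - eps k * S i j).
    by apply/funext => k; rewrite !mxE.
  apply: ccvgD; first exact: ccvg_cst.
  apply/ccvgN/ccvgM; last exact: ccvg_cst.
  exact: (ccvg_real (@cvg_harmonic R)).
(* A single perturbation whose weight exceeds that of [M] by less than 1 is enough; this is the
   [+ 1] of the statement. *)
have /cvgrPdist_lt/(_ 1 ltr01) [k _ /(_ k (leqnn k))] := cM.
rewrite ltr_norml => /andP[wk _].
have MB : - S *m M' k = - S *m M + eps k *: 1%:M.
  by rewrite mulmxBr -scalemxAr mulNmx mulNmx signatureK scalerN opprK.
have [u u0|Q [Qu QS Qt]] := @posdef_pseudo_unitary (M' k).
  rewrite krein_sesqM mulmxN -mulNmx MB /sesq mulmxDr mulmxDl mxE.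
  rewrite -scalemxAr -scalemxAl [X in _ + X]mxE ltr_wpDl//.
    by have := pM u; rewrite krein_sesqM mulmxN -mulNmx.
  by rewrite mulr_gt0 ?sesq1_gt0.
exists (invmx Q); first exact: krein_unitary_invmx.
rewrite invmxK; have -> : - S *m (invmx Q *m M *m Q) = Q^H *m (- S *m M) *m Q.
  have SQ : S *m invmx Q = Q^H *m S by rewrite -{1}QS mulmxK.
  by rewrite !mulNmx mulmxN mulNmx !mulmxA SQ.
move: Qt; rewrite MB mulmxDr mulmxDl -scalemxAr -scalemxAl mulmx1 linearD linearZ /=.
rewrite ReD => Qt.
(* Replacing the perturbed matrix by [M] itself can only lower the trace. *)
have : 0 <= eps k * \tr (Q^H *m Q) by rewrite mulr_ge0 ?tr_adjmx_mul_ge0// ltW.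
rewrite lecE /= => /andP[_]; move: wk; rewrite -Qt.
move: (complex.Re (eps k * _)) (complex.Re _) (spectral_weight M) => x y w.
by lra.
Qed.

End Krein.

(** * A curve through a compact set *)

Section SpaceFillingCurve.
Variable R : realType.
Implicit Types (a b s t : R).

(** A continuous function, even and of period 2, that vanishes near 0 and equals 1 near 1: a
    trigonometric version of the piecewise linear function in Schoenberg's curve. The classical base
    9 is replaced by 25, since plateaus of length [1/5] already follow from the elementary bound on
    the cosine up to [pi / 4]. *)
Definition plateau t : R := Num.max 0 (Num.min 1 (2^-1 - cos (pi * t))).

Lemma plateau_ge0 t : 0 <= plateau t.
Proof. by rewrite /plateau le_max lexx. Qed.

Lemma plateau_le1 t : plateau t <= 1.
Proof. by rewrite /plateau ge_max ler01 /= ge_min lexx. Qed.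

Lemma plateau_periodic t n : plateau (t + (2 * n)%:R) = plateau t.
Proof.
rewrite /plateau; congr (Num.max _ (Num.min _ (_ - _))); rewrite natrM mulrDr.
by rewrite mulrA mulr_natr mulr_natr (periodicn (@cosD2pi R)).
Qed.

(** A nonnegative [cos (2 t)] gives [cos t ^ 2 >= 1/2], and [cos t] is at least its square because
    it lies in [[0, 1]]. *)
Lemma cos_ge_half t : 0 <= t -> t <= pi / 4 -> 2^-1 <= cos t.
Proof.
move=> t0 t1; have c2 : 0 <= cos (t *+ 2) by apply: cos_ge0_pihalf; have := pi_gt0 R; lra.
have c1 : 0 <= cos t by apply: cos_ge0_pihalf; have := pi_gt0 R; lra.
have := cos_le1 t; move: c2; rewrite cos_mulr2n expr2; nra.
Qed.

Lemma plateau0 t : 0 <= t -> t <= 5^-1 -> plateau t = 0.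
Proof.
move=> t0 t1; have p0 := pi_gt0 R; rewrite /plateau; apply/max_idPl.
have : 2^-1 <= cos (pi * t) by apply: cos_ge_half; nra.
by rewrite ge_min; move=> ?; apply/orP; right; lra.
Qed.

Lemma plateau1 t : 4 / 5 <= t -> t <= 1 -> plateau t = 1.
Proof.
move=> t0 t1; have p0 := pi_gt0 R; rewrite /plateau.
have h : 2^-1 <= cos (pi * (1 - t)) by apply: cos_ge_half; nra.
have -> : cos (pi * t) = - cos (pi * (1 - t)).
  by rewrite -cosDpi -(cosN (pi * t)) -cosD2pi; congr cos; ring.
by rewrite (min_idPl _) ?(max_idPr _)//; lra.
Qed.

Lemma plateau_continuous : continuous plateau.
Proof.
move=> t.
have h1 : {for t, continuous (fun s => 2^-1 - cos (pi * s))}.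
  apply: cvgB; first exact: cvg_cst.
  apply: (@continuous_comp _ _ _ (fun s => pi * s) cos); last exact: continuous_cos.
  by apply: cvgM; [exact: cvg_cst|exact: cvg_id].
have c0 (c : R) : {for t, continuous (fun=> c)} by exact: cvg_cst.
exact: (continuous_max (c0 0) (continuous_min (c0 1) h1)).
Qed.

Definition schoenberg_partial n t : R :=
  \sum_(m < n) 2^-1 ^+ m.+1 * plateau (25 ^+ m * t).

Lemma schoenberg_partialS n t : schoenberg_partial n.+1 t =
  plateau t / 2 + schoenberg_partial n (25 * t) / 2.
Proof.
rewrite /schoenberg_partial big_ord_recl /= expr1 expr0 mul1r mulrC; congr (_ + _).
rewrite mulr_suml; apply: eq_bigr => i _; rewrite /bump /= !add1n.
by rewrite [2^-1 ^+ i.+2]exprSr mulrAC [25 ^+ i.+1]exprSr -!mulrA.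
Qed.

Lemma schoenberg_partial_le1 n t : schoenberg_partial n t <= 1.
Proof.
elim: n t => [|n IH] t; first by rewrite /schoenberg_partial big_ord0.
rewrite schoenberg_partialS; have := IH (25 * t); have := plateau_le1 t; lra.
Qed.

Definition schoenberg t : R := limn (schoenberg_partial ^~ t).

Lemma schoenberg_cvg t : schoenberg_partial ^~ t @ \oo --> schoenberg t.
Proof.
apply/cvg_ex; eexists; apply: (@nondecreasing_cvgn R).
  apply/nondecreasing_seqP => n; rewrite /schoenberg_partial big_ord_recr /= lerDl.
  by rewrite mulr_ge0 ?plateau_ge0// exprn_ge0// invr_ge0.
by exists 1 => _ [n _ <-]; exact: schoenberg_partial_le1.
Qed.

Lemma schoenbergE t : schoenberg t = plateau t / 2 + schoenberg (25 * t) / 2.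
Proof.
have h : (fun n => schoenberg_partial n.+1 t) @ \oo -->
    plateau t / 2 + schoenberg (25 * t) / 2.
  under eq_fun do rewrite schoenberg_partialS.
  apply: cvgD; first exact: cvg_cst.
  by apply: cvgM; [exact: schoenberg_cvg|exact: cvg_cst].
move: h; rewrite (cvg_shiftS (schoenberg_partial ^~ t)).
by apply: cvg_unique; [exact: norm_hausdorff|exact: schoenberg_cvg].
Qed.

Lemma schoenberg_ge0 t : 0 <= schoenberg t.
Proof.
apply: limr_ge; first exact/cvgP/schoenberg_cvg.
apply: nearW => n; apply: sumr_ge0 => i _.
by rewrite mulr_ge0 ?plateau_ge0// exprn_ge0// invr_ge0.
Qed.

Lemma schoenberg_le1 t : schoenberg t <= 1.
Proof.
apply: limr_le; first exact/cvgP/schoenberg_cvg.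
by apply: nearW => n; exact: schoenberg_partial_le1.
Qed.

Lemma schoenberg_periodic t n : schoenberg (t + (2 * n)%:R) = schoenberg t.
Proof.
rewrite /schoenberg; congr (limn _); apply/funext => N.
apply: eq_bigr => i _; congr (_ * _).
have -> : 25 ^+ i * (t + (2 * n)%:R) = 25 ^+ i * t + (2 * (25 ^ i * n))%:R.
  by rewrite mulrDr mulnCA [in RHS]natrM natrX.
by rewrite plateau_periodic.
Qed.

Lemma schoenberg_tail N t : schoenberg t =
  schoenberg_partial N t + 2^-1 ^+ N * schoenberg (25 ^+ N * t).
Proof.
elim: N t => [|N IH] t.
  by rewrite /schoenberg_partial big_ord0 add0r expr0 mul1r expr0 mul1r.
rewrite schoenbergE IH schoenberg_partialS mulrDl addrA; congr (_ + _).
by rewrite mulrA -exprSr mulrAC -exprSr.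
Qed.

(** The tail after [N] terms lies between 0 and [2^-N] uniformly in the parameter, and the partial
    sums are continuous. *)
Lemma schoenberg_continuous : continuous schoenberg.
Proof.
move=> t; apply/cvgrPdist_lt => e e0.
have [N hN] : exists N, 2^-1 ^+ N < e / 2 :> R.
  have : (fun N => 2^-1 ^+ N : R) @ \oo --> (0 : R).
    by apply: cvg_expr; rewrite ger0_norm// invf_lt1 ?ltr1n.
  move=> /cvgrPdist_lt/(_ _ (divr_gt0 e0 (ltr0n R 2)))[N _ /(_ N (leqnn N))].
  by rewrite /= sub0r normrN ger0_norm ?exprn_ge0// => h; exists N.
have cN : schoenberg_partial N s @[s --> t] --> schoenberg_partial N t.
  suff c : continuous (schoenberg_partial N) by exact: c.
  apply: continuous_big => [|i _]; first exact: add_continuous.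
  move=> s; apply: cvgM; first exact: cvg_cst.
  apply: (@continuous_comp _ _ _ (fun s => 25 ^+ i * s) plateau).
    by apply: cvgM; [exact: cvg_cst|exact: cvg_id].
  exact: plateau_continuous.
have e2 : 0 < e / 2 by rewrite divr_gt0.
move/cvgrPdist_lt/(_ _ e2) : cN; apply: filterS => s.
rewrite (schoenberg_tail N t) (schoenberg_tail N s) !ltr_norml.
set p := schoenberg_partial N t; set q := schoenberg_partial N s.
set x := 2^-1 ^+ N in hN *.
have x0 : 0 <= x by rewrite exprn_ge0.
have := schoenberg_ge0 (25 ^+ N * t); have := schoenberg_le1 (25 ^+ N * t).
have := schoenberg_ge0 (25 ^+ N * s); have := schoenberg_le1 (25 ^+ N * s).
move: (schoenberg _) (schoenberg _) => z w z1 z0 w1 w0 /andP[h1 h2].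
have zx1 : 0 <= x * z <= x by apply/andP; split; nra.
have zx2 : 0 <= x * w <= x by apply/andP; split; nra.
by move: zx1 zx2 => /andP[? ?] /andP[? ?]; apply/andP; split; lra.
Qed.

(* Prepending the base-25 digit 20 i + 4 j to t prepends the binary digits
   i and j to the two coordinates. *)
Lemma schoenberg_digit (i j : bool) t : 0 <= t <= 1 ->
  let t' := 4 / 5 * i%:R + 4 / 25 * j%:R + t / 25 in
  [/\ 0 <= t' <= 1, schoenberg t' = (i%:R + schoenberg t) / 2 &
   schoenberg (5 * t') = (j%:R + schoenberg (5 * t)) / 2].
Proof.
move=> /andP[t0 t1] t'; split.
- by rewrite /t'; case: i {t'}; case: j => /=; lra.
- rewrite schoenbergE [RHS]mulrDl; congr (_ / 2 + _ / 2).
    rewrite /t'; case: i {t'}; case: j => /=; first [apply: plateau1; lra|apply: plateau0; lra].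
  (* The leading base-25 digit becomes an even integer and disappears by periodicity. *)
  have -> : 25 * t' = t + (2 * (10 * i + 2 * j))%:R.
    by rewrite /t' !(natrM, natrD); field.
  by rewrite schoenberg_periodic.
- rewrite schoenbergE [RHS]mulrDl; congr (_ / 2 + _ / 2).
    (* After multiplication by 5 the contribution of [i] is an even integer, and [j] selects the
       plateau. *)
    have -> : 5 * t' = (4 / 5 * j%:R + t / 5) + (2 * (2 * i))%:R.
      by rewrite /t' !(natrM, natrD); field.
    rewrite plateau_periodic; case: j {t'} => /=; first [apply: plateau1; lra|apply: plateau0; lra].
  have -> : 25 * (5 * t') = 5 * t + (2 * (5 * (10 * i + 2 * j)))%:R.
    by rewrite /t' !(natrM, natrD); field.
  by rewrite schoenberg_periodic.
Qed.

(** Induction on the number of binary digits: the targets [2 a - i] and [2 b - j] are approximated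
    first, and prepending the digits [i] and [j] halves both errors. *)
Lemma schoenberg_approx n a b : 0 <= a <= 1 -> 0 <= b <= 1 ->
  exists t, [/\ 0 <= t <= 1, `|schoenberg t - a| <= 2^-1 ^+ n &
    `|schoenberg (5 * t) - b| <= 2^-1 ^+ n].
Proof.
elim: n a b => [|n IH] a b /andP[a0 a1] /andP[b0 b1].
  exists 0; rewrite lexx ler01 mulr0 expr0 !ler_norml.
  by have := schoenberg_ge0 0; have := schoenberg_le1 0; split=> //; apply/andP; split; lra.
have digit (c : R) : 0 <= c -> c <= 1 -> exists i : bool, 0 <= 2 * c - i%:R <= 1.
  by move=> c0 c1; have [h|h] := leP 2^-1 c; [exists true|exists false]; rewrite /=; lra.
have [i ia] := digit _ a0 a1; have [j jb] := digit _ b0 b1.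
have [t [t01 ta tb]] := IH _ _ ia jb.
have [t'01 fi fj] := schoenberg_digit i j t01.
eexists; split; first exact: t'01.
  rewrite fi exprSr; move: ta; rewrite !ler_norml => /andP[? ?]; apply/andP; split; lra.
rewrite fj exprSr; move: tb; rewrite !ler_norml => /andP[? ?]; apply/andP; split; lra.
Qed.

Lemma schoenberg5_continuous : continuous (fun t => schoenberg (5 * t)).
Proof.
move=> t; apply: (@continuous_comp _ _ _ (fun s => 5 * s) schoenberg).
  by apply: cvgM; [exact: cvg_cst|exact: cvg_id].
exact: schoenberg_continuous.
Qed.

(** The continuous error [d] attains its minimum on [[0, 1]], and this minimum is at most [2 * 2^-n]
    for every [n]. *)
Lemma schoenberg_surjective a b : 0 <= a <= 1 -> 0 <= b <= 1 ->
  exists t, [/\ 0 <= t <= 1, schoenberg t = a & schoenberg (5 * t) = b].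
Proof.
move=> a01 b01.
pose d t := `|schoenberg t - a| + `|schoenberg (5 * t) - b|.
have cd : continuous d.
  move=> t; apply: cvgD; apply: cvg_norm; apply: cvgB; try exact: cvg_cst.
    exact: schoenberg_continuous.
  exact: schoenberg5_continuous.
have [|t t01 tmin] := @EVT_min R d 0 1 ler01.
  exact: continuous_subspaceT.
suff : d t <= 0.
  rewrite /d; have := normr_ge0 (schoenberg t - a).
  have := normr_ge0 (schoenberg (5 * t) - b) => h1 h2 h.
  move: t01; rewrite in_itv /= => t01.
  exists t; split=> //; apply/eqP; rewrite -subr_eq0 -normr_le0; lra.
have lim0 : (fun n => 2 * 2^-1 ^+ n : R) @ \oo --> (2 * 0 : R).
  apply: cvgM; first exact: cvg_cst.
  by apply: cvg_expr; rewrite ger0_norm// invf_lt1 ?ltr1n.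
rewrite mulr0 in lim0; rewrite -(cvg_lim _ lim0)//.
apply: limr_ge; first exact: cvgP lim0.
apply: nearW => n; have [s [s01 sa sb]] := schoenberg_approx n a01 b01.
apply: (le_trans (tmin s _)); first by rewrite in_itv.
by rewrite /d; lra.
Qed.

End SpaceFillingCurve.

Section Curve.
Variable R : realType.

Lemma norm_four_vector (x : four_vector R) :
  [/\ `|x.1.1.1| <= `|x|, `|x.1.1.2| <= `|x|, `|x.1.2| <= `|x| & `|x.2| <= `|x|].
Proof.
have h (U V : normedModType R) (y : U * V) : `|y.1| <= `|y| /\ `|y.2| <= `|y|.
  by rewrite prod_normE; split; rewrite le_max lexx ?orbT.
have [h1 h2] := h _ _ x; have [h3 h4] := h _ _ x.1; have [h5 h6] := h _ _ x.1.1.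
split=> //; first exact: le_trans h5 (le_trans h3 h1).
  exact: le_trans h6 (le_trans h3 h1).
exact: le_trans h4 h1.
Qed.

(* The plane curve t |-> (f t, g t) is applied twice to reach four dimensions. *)
Lemma compact_curve (K : set (four_vector R)) : compact K ->
  exists2 p : R -> four_vector R, continuous p & K `<=` p @` `[0, 1].
Proof.
move=> cK; have [M Mpos KM] : exists2 M : R, 0 < M & forall x, K x -> `|x| <= M.
  have /ex_strict_bound_gt0[M M0 h] := compact_bounded cK.
  by exists M => // x /h/ltW.
pose f := @schoenberg R; pose g t := f (5 * t).
have cf : continuous f by exact: schoenberg_continuous.
have cg : continuous g by exact: schoenberg5_continuous.
(* Rescales [[0, 1]] to [[-M, M]]; the resulting cube contains [K]. *)
pose sc (h : R -> R) t := M * (2 * h t - 1).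
have csc h : continuous h -> continuous (sc h).
  move=> ch t; apply: cvgM; first exact: cvg_cst.
  apply: cvgB; last exact: cvg_cst.
  by apply: cvgM; [exact: cvg_cst|exact: ch].
have cc (h k : R -> R) : continuous h -> continuous k -> continuous (h \o k).
  by move=> ch ck t; apply: continuous_comp; [exact: ck|exact: ch].
exists (fun t => (sc (f \o f) t, sc (g \o f) t, sc (f \o g) t, sc (g \o g) t)).
  have pc (U V : topologicalType) (h : R -> U) (k : R -> V) :
      continuous h -> continuous k -> continuous (fun t => (h t, k t)).
    by move=> ch ck t; exact: (cvg_pair (ch t) (ck t)).
  by do 3 (apply: (pc); last exact/csc/cc); exact/csc/cc.
move=> [[[a b] c] d] /KM xM.
have [/= na nb nc nd] := norm_four_vector (a, b, c, d).
have bnd z : `|z| <= `|(a, b, c, d)| -> exists2 y, 0 <= y <= 1 & M * (2 * y - 1) = z.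
  move=> /le_trans/(_ xM); rewrite ler_norml => /andP[z1 z2].
  exists ((z / M + 1) / 2); last by field; rewrite gt_eqF.
  have h1 : -1 <= z / M by rewrite ler_pdivlMr// mulN1r.
  have h2 : z / M <= 1 by rewrite ler_pdivrMr// mul1r.
  by apply/andP; split; lra.
have [a' a01 <-] := bnd _ na; have [b' b01 <-] := bnd _ nb.
have [c' c01 <-] := bnd _ nc; have [d' d01 <-] := bnd _ nd.
have [s [s01 sa sb]] := schoenberg_surjective a01 b01.
have [r [r01 rc rd]] := schoenberg_surjective c01 d01.
have [t [t01 ts tr]] := schoenberg_surjective s01 r01.
exists t; first by rewrite /= in_itv.
by rewrite /sc /= /g /f ts tr sa sb rc rd.
Qed.

End Curve.

(** * Integrals with respect to vector-valued measures *)

Section StepApproximation.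
Context d (T : measurableType d) (R : realType).
Implicit Types (m : {finite_measure set T -> \bar R}) (g : T -> R).

Lemma bounded_integrable m (D : set T) g (M : R) : measurable D ->
  measurable_fun D g -> (forall x, D x -> `|g x| <= M) ->
  m.-integrable D (EFin \o g).
Proof.
move=> mD mg gM; apply: measurable_bounded_integrable => //.
  by rewrite ltey_eq fin_num_measure.
by exists M; split=> [|M' /ltW MM' x /gM/le_trans]; [exact: num_real|exact].
Qed.

Lemma fine_measure_ge0 m (A : set T) : 0 <= fine (m A).
Proof. exact: fine_ge0. Qed.

Lemma fine_measureU m (A B : set T) : measurable A -> measurable B ->
  A `&` B = set0 -> fine (m (A `|` B)) = fine (m A) + fine (m B).
Proof.
by move=> mA mB AB; rewrite measureU// fineD// fin_num_measure.
Qed.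

Lemma cell_integral m (A : set T) g (c e M : R) : measurable A ->
  measurable_fun A g -> (forall x, A x -> `|g x| <= M) ->
  (forall x, A x -> `|g x - c| <= e) ->
  `|\int[m]_(x in A) g x - c * fine (m A)| <= e * fine (m A).
Proof.
move=> mA mg gM gc.
have ig := bounded_integrable m mA mg gM.
have ic (r : R) : m.-integrable A (EFin \o (fun=> r)).
  by apply: (@bounded_integrable _ _ _ `|r|) => //; exact: measurable_cst.
have igc : m.-integrable A (EFin \o (fun x => g x - c)).
  by apply: (@bounded_integrable _ _ _ e) => //; apply: measurable_funB.
rewrite -Rintegral_cst// -RintegralB//.
apply: (le_trans (le_normr_Rintegral mA igc)).
rewrite -Rintegral_cst//; apply: le_Rintegral => //.
by move/integrable_abse : igc.
Qed.

(** A Lebesgue sum over the layers of an increasing chain. The measure enters the sum only through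
    the masses of the sets [E k], which is the information available about the limits; the chains
    used are level sets, initial parts of a curve, and half-lines. *)
Lemma step_integral m (E : nat -> set T) g (c : nat -> R) (e M : R) N :
  (forall k, measurable (E k)) -> E 0%N = set0 -> (forall k, E k `<=` E k.+1) ->
  measurable_fun (E N) g -> (forall x, E N x -> `|g x| <= M) ->
  (forall k x, (k < N)%N -> E k.+1 x -> ~ E k x -> `|g x - c k| <= e) ->
  `|\int[m]_(x in E N) g x -
    \sum_(k < N) c k * (fine (m (E k.+1)) - fine (m (E k)))| <= e * fine (m (E N)).
Proof.
move=> mE E0 EE; elim: N => [|N IH] mg gM gc.
  by rewrite E0 Rintegral_set0 big_ord0 subr0 normr0 measure0 mulr0.
have EN : E N.+1 = E N `|` (E N.+1 `\` E N) by rewrite setDUK.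
have mD : measurable (E N.+1 `\` E N) by exact: measurableD.
have dis : E N `&` (E N.+1 `\` E N) = set0 by apply/seteqP; split=> x // [h1 [_ /(_ h1)]].
have ig := bounded_integrable m (mE N.+1) mg gM.
have mEN : fine (m (E N.+1)) = fine (m (E N)) + fine (m (E N.+1 `\` E N)).
  by rewrite {1}EN fine_measureU.
have IN : \int[m]_(x in E N.+1) g x =
    \int[m]_(x in E N) g x + \int[m]_(x in E N.+1 `\` E N) g x.
  by rewrite {1}EN Rintegral_setU// -?EN// disj_set2E dis.
have h1 := IH (measurable_funS (mE N.+1) (EE N) mg) (fun x h => gM x (EE N x h))
  (fun k x kN => gc k x (ltnW kN)).
have h2 : `|\int[m]_(x in E N.+1 `\` E N) g x - c N * fine (m (E N.+1 `\` E N))|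
    <= e * fine (m (E N.+1 `\` E N)).
  apply: (@cell_integral _ _ _ _ _ M) => //.
  - by apply: measurable_funS mg => //; exact: subDsetl.
  - by move=> x [/gM].
  - by move=> x [h3 h4]; exact: gc.
have hN : fine (m (E N.+1)) - fine (m (E N)) = fine (m (E N.+1 `\` E N)).
  by rewrite mEN addrAC subrr add0r.
rewrite big_ord_recr /= hN IN mEN mulrDr.
rewrite [leLHS](_ : _ = `|(\int[m]_(x in E N) g x -
    \sum_(k < N) c k * (fine (m (E k.+1)) - fine (m (E k)))) +
    (\int[m]_(x in E N.+1 `\` E N) g x - c N * fine (m (E N.+1 `\` E N)))|).
  by rewrite addrC (le_trans (ler_normD _ _))// addrC lerD.
by congr `| _ |; ring.
Qed.

(* A measurable bounded function is a uniform limit of step functions. *)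
Lemma linear_relation_integral
    (s : seq (R * {finite_measure set T -> \bar R})) (D : set T) g (M : R) :
  measurable D -> measurable_fun D g -> (forall x, D x -> `|g x| <= M) ->
  (forall A, measurable A -> A `<=` D ->
    \sum_(p <- s) p.1 * fine (p.2 A) = 0) ->
  \sum_(p <- s) p.1 * \int[p.2]_(x in D) g x = 0.
Proof.
move=> mD mg gM s0; apply/eqP; rewrite -normr_le0.
pose C := \sum_(p <- s) `|p.1| * fine (p.2 D).
have C0 : 0 <= C by apply: sumr_ge0 => p _; rewrite mulr_ge0// fine_measure_ge0.
suff h e : 0 < e -> `|\sum_(p <- s) p.1 * \int[p.2]_(x in D) g x| <= e * C.
  rewrite leNgt; apply/negP; set X := `|_| => X0.
  have := h (X / (2 * (C + 1))).
  rewrite divr_gt0// ?mulr_gt0// ?ltr_wpDl// => /(_ isT).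
  rewrite -/X mulrAC ler_pdivlMr ?mulr_gt0// ?ltr_wpDl//; nra.
move=> e0.
(* Level sets of step [e] starting at [- M] exhaust [D] after [N] steps; strictness is needed
   because the level sets are defined by a strict inequality. *)
have [N hN] : exists N : nat, 2 * M < N%:R * e.
  exists (Num.truncn (2 * M / e)).+1.
  by rewrite -ltr_pdivrMr// truncnS_gt.
pose E k := D `&` [set x | g x < - M + k%:R * e].
have mE k : measurable (E k).
  have -> : E k = D `&` (g @^-1` `]-oo, (- M + k%:R * e)[).
    by apply/seteqP; split=> x [Dx /= h]; split=> //=; move: h; rewrite in_itv.
  by apply: mg => //; exact: measurable_itv.
have EE k : E k `<=` E k.+1.
  move=> x [Dx gx]; split=> //=; apply: (lt_le_trans gx).
  by rewrite lerD2l ler_wpM2r ?ltW// ltr_nat.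
have E0 : E 0%N = set0.
  rewrite -subset0 => x [/gM]; rewrite ler_norml => /andP[h _] /=.
  by rewrite mul0r addr0 ltNge h.
have EN : E N = D.
  rewrite /E; apply/setIidPl => x /gM; rewrite ler_norml => /andP[_ h] /=.
  by lra.
have step (p : {finite_measure set T -> \bar R}) :
    `|\int[p]_(x in D) g x - \sum_(k < N) (- M + k%:R * e) *
    (fine (p (E k.+1)) - fine (p (E k)))| <= e * fine (p D).
  rewrite -{1 2}EN.
  apply: (@step_integral _ E _ (fun k => - M + k%:R * e) _ M) => //.
  - by rewrite EN.
  - by rewrite EN.
  move=> k x _ [Dx h1] h2; have h3 : - M + k%:R * e <= g x.
    by rewrite leNgt; apply/negP => h; apply: h2.
  move: h1 => /=; rewrite -natr1 ler_norml => h1; apply/andP; split; lra.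
(* The relation on sets cancels the step sums, so only their approximation errors remain. *)
have Z : \sum_(k < N) (- M + k%:R * e) *
    (\sum_(p <- s) p.1 * (fine (p.2 (E k.+1)) - fine (p.2 (E k)))) = 0.
  apply: big1 => k _; under eq_bigr do rewrite mulrBr.
  by rewrite sumrB !s0 ?subrr ?mulr0// => x [].
have -> : \sum_(p <- s) p.1 * \int[p.2]_(x in D) g x =
  \sum_(p <- s) p.1 * (\int[p.2]_(x in D) g x - \sum_(k < N) (- M + k%:R * e) *
    (fine (p.2 (E k.+1)) - fine (p.2 (E k)))).
  rewrite -[LHS]subr0 -[X in _ - X]Z; under [X in _ - X]eq_bigr do rewrite mulr_sumr.
  rewrite exchange_big -sumrB; apply: eq_bigr => p _.
  rewrite mulrBr; congr (_ - _); rewrite mulr_sumr; apply: eq_bigr => k _.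
  by rewrite mulrCA.
rewrite mulr_sumr; apply: (le_trans (ler_norm_sum _ _ _)); apply: ler_sum => p _.
by rewrite normrM mulrCA ler_wpM2l.
Qed.

End StepApproximation.

(** * Integrals against charges and complex measures *)

Section ComplexIntegral.
Variables (R : realType) (K : set (four_vector R)) (cK : compact K).
Local Notation scharge := ({charge set (momentum R) -> \bar R})%type.
Local Notation fmeasure := ({finite_measure set (momentum R) -> \bar R})%type.

Local Notation mfunK g := (@measurable_fun _ _ (momentum R) R K g).

Lemma charge_integral_difference (c : scharge) :
  exists m : fmeasure * fmeasure,
    (forall A, measurable A -> fine (c A) = fine (m.1 A) - fine (m.2 A)) /\
    (forall g, charge_integral K c g =
      \int[m.1]_(k in K) g k - \int[m.2]_(k in K) g k).
Proof.
rewrite /charge_integral; case: (cid _) => P [N PN] /=.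
case: (cid _) => N' PN' /=.
exists ((jordan_pos PN' : fmeasure), (jordan_neg PN' : fmeasure)); split=> // A mA /=.
rewrite (jordan_decomp PN' mA) /cadd /= cscaleN1 fineD ?fin_num_measure ?fin_numN//.
  by rewrite fineN.
exact: fin_num_measure.
Qed.

(** The Jordan parts come from a chosen Hahn decomposition and do not add up when charges do. Moving
    them to one side as a signed combination of finite measures makes linearity of the integral in
    the charge independent of that choice. *)
Lemma charge_integral_relation (s : seq (R * scharge)) (t : seq (R * fmeasure))
    (g : four_vector R -> R) (M : R) :
  mfunK g -> (forall k, K k -> `|g k| <= M) ->
  (forall A, @measurable _ (momentum R) A -> A `<=` K ->
    \sum_(p <- s) p.1 * fine (p.2 A) + \sum_(p <- t) p.1 * fine (p.2 A) = 0) ->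
  \sum_(p <- s) p.1 * charge_integral K p.2 g +
    \sum_(p <- t) p.1 * \int[p.2]_(k in K) g k = 0.
Proof.
move=> mg gM st; have mK := measurable_compact cK.
have [m hm] := choice charge_integral_difference.
pose r := [seq (p.1, (m p.2).1) | p <- s] ++ ([seq (- p.1, (m p.2).2) | p <- s] ++ t).
have := @linear_relation_integral _ (momentum R) R r K g M mK mg gM.
rewrite /r !big_cat !big_map /= => h.
apply: (etrans _ (h _)).
  rewrite addrA -big_split /=; congr (_ + _); apply: eq_bigr => p _.
  by rewrite (hm p.2).2 mulrBr mulNr.
move=> A mA AK; apply: (etrans _ (st A mA AK)).
rewrite !big_cat !big_map /= addrA -big_split /=; congr (_ + _); apply: eq_bigr => p _.
by rewrite ((hm p.2).1 A mA) mulrBr mulNr.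
Qed.

Definition bounded_borel (g : four_vector R -> R[i]) : Prop :=
  [/\ mfunK (fun k => complex.Re (g k)),
      mfunK (fun k => complex.Im (g k)) &
      exists M, forall k, K k -> complex.Re `|g k| <= M].

Local Notation cmeasure := (vmeasure K R[i]^o).

Lemma Re_sum (I : Type) (s : seq I) (P : pred I) (F : I -> R[i]) :
  complex.Re (\sum_(i <- s | P i) F i) = \sum_(i <- s | P i) complex.Re (F i).
Proof. by apply: (big_morph (@complex.Re R)) => // a b; exact: ReD. Qed.

Lemma Im_sum (I : Type) (s : seq I) (P : pred I) (F : I -> R[i]) :
  complex.Im (\sum_(i <- s | P i) F i) = \sum_(i <- s | P i) complex.Im (F i).
Proof. by apply: (big_morph (@complex.Im R)) => // a b; exact: ImD. Qed.

Lemma ReM (a b : R[i]) : complex.Re (a * b) =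
  complex.Re a * complex.Re b - complex.Im a * complex.Im b.
Proof. by case: a b => ? ? []. Qed.

Lemma ImM (a b : R[i]) : complex.Im (a * b) =
  complex.Re a * complex.Im b + complex.Im a * complex.Re b.
Proof. by case: a b => ? ? []. Qed.

Lemma complex_integral_sum (m : cmeasure) (s : seq (R[i] * cmeasure)) g :
  bounded_borel g ->
  (forall A, borel_subsets K A -> (m A : R[i]) = \sum_(p <- s) p.1 * (p.2 A : R[i])) ->
  complex_integral cK m g = \sum_(p <- s) p.1 * complex_integral cK p.2 g.
Proof.
move=> [mr mi [M gM]] ms.
have hRe h : mfunK h -> (forall k, K k -> `|h k| <= M) ->
    charge_integral K (Re_charge cK m) h =
      \sum_(p <- s) (complex.Re p.1 * charge_integral K (Re_charge cK p.2) h -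
                     complex.Im p.1 * charge_integral K (Im_charge cK p.2) h).
  move=> mh hM; pose r := (1, Re_charge cK m) ::
    ([seq (- complex.Re p.1, Re_charge cK p.2) | p <- s] ++
    [seq (complex.Im p.1, Im_charge cK p.2) | p <- s]).
  have := @charge_integral_relation r [::] h M mh hM.
  rewrite big_nil addr0 /r big_cons big_cat !big_map /= mul1r -big_split /= => H.
  apply/eqP; rewrite -subr_eq0; apply/eqP/(etrans _ (H _)).
    by rewrite -sumrN; congr (_ + _); apply: eq_bigr => p _; ring.
  move=> A mA AK; rewrite big_nil addr0 big_cons big_cat !big_map /=.
  rewrite mul1r -big_split /= !(setIidl AK) ms// Re_sum -big_split /= big1// => p _.
  by rewrite ReM; ring.
have hIm h : mfunK h -> (forall k, K k -> `|h k| <= M) ->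
    charge_integral K (Im_charge cK m) h =
      \sum_(p <- s) (complex.Re p.1 * charge_integral K (Im_charge cK p.2) h +
                     complex.Im p.1 * charge_integral K (Re_charge cK p.2) h).
  move=> mh hM; pose r := (1, Im_charge cK m) ::
    ([seq (- complex.Re p.1, Im_charge cK p.2) | p <- s] ++
    [seq (- complex.Im p.1, Re_charge cK p.2) | p <- s]).
  have := @charge_integral_relation r [::] h M mh hM.
  rewrite big_nil addr0 /r big_cons big_cat !big_map /= mul1r -big_split /= => H.
  apply/eqP; rewrite -subr_eq0; apply/eqP/(etrans _ (H _)).
    by rewrite -sumrN; congr (_ + _); apply: eq_bigr => p _; ring.
  move=> A mA AK; rewrite big_nil addr0 big_cons big_cat !big_map /=.
  rewrite mul1r -big_split /= !(setIidl AK) ms// Im_sum -big_split /= big1// => p _.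
  by rewrite ImM; ring.
have bRe k : K k -> `|complex.Re (g k)| <= M.
  by move=> /gM; apply: le_trans; exact: ler_norm_Re.
have bIm k : K k -> `|complex.Im (g k)| <= M.
  by move=> /gM; apply: le_trans; exact: ler_norm_Im.
rewrite /complex_integral; apply/eqP; rewrite eq_complex Re_sum Im_sum /=.
rewrite (hRe _ mr bRe) (hRe _ mi bIm) (hIm _ mr bRe) (hIm _ mi bIm).
rewrite -sumrB -big_split /=; apply/andP; split; apply/eqP;
  by apply: eq_bigr => p _; rewrite ?ReM ?ImM /=; ring.
Qed.

Lemma complex_integral_opp_measure (m : cmeasure) (mu : fmeasure) g :
  bounded_borel g ->
  (forall A, borel_subsets K A -> (m A : R[i]) = - (fine (mu A))%:C) ->
  complex_integral cK m g =
    - ((\int[mu]_(k in K) complex.Re (g k)) +i* (\int[mu]_(k in K) complex.Im (g k))).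
Proof.
move=> [mr mi [M gM]] mmu.
have hRe h : mfunK h -> (forall k, K k -> `|h k| <= M) ->
    charge_integral K (Re_charge cK m) h = - \int[mu]_(k in K) h k.
  move=> mh hM.
  have := @charge_integral_relation [:: (1, Re_charge cK m)] [:: (1, mu)] h M mh hM.
  rewrite !big_seq1 /= !mul1r => H; apply/eqP; rewrite -addr_eq0 H// => A mA AK.
  by rewrite !big_seq1 /= !mul1r (setIidl AK) mmu// addNr.
have hIm h : mfunK h -> (forall k, K k -> `|h k| <= M) ->
    charge_integral K (Im_charge cK m) h = 0.
  move=> mh hM.
  have := @charge_integral_relation [:: (1, Im_charge cK m)] [::] h M mh hM.
  rewrite big_nil big_seq1 /= addr0 mul1r => H; rewrite H// => A mA AK.
  by rewrite big_nil big_seq1 /= addr0 mul1r (setIidl AK) mmu//= oppr0.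
have bRe k : K k -> `|complex.Re (g k)| <= M.
  by move=> /gM; apply: le_trans; exact: ler_norm_Re.
have bIm k : K k -> `|complex.Im (g k)| <= M.
  by move=> /gM; apply: le_trans; exact: ler_norm_Im.
by rewrite /complex_integral !hRe// !hIm// subr0 addr0.
Qed.

End ComplexIntegral.

(** * Integrals against operator-valued measures *)

Section OperatorIntegral.
Variables (R : realType) (n : nat) (K : set (four_vector R)) (cK : compact K).
Implicit Types (nu : operator_measure K n) (u v : 'cV[R[i]]_(n + n)).
Local Notation S := (signature R n).
Local Notation fmeasure := ({finite_measure set (momentum R) -> \bar R})%type.
Local Notation mfunK g := (@measurable_fun _ _ (momentum R) R K g).

Lemma ccvg_ext (z w : nat -> R[i]) (a b : R[i]) :
  (forall k, z k = w k) -> a = b -> w ~~> b -> z ~~> a.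
Proof. by move=> /funext-> ->. Qed.

Lemma krein_opp u (A : 'M[R[i]]_(n + n)) v :
  krein_product u (- A *m v) = - krein_product u (A *m v).
Proof. by rewrite !krein_sesqM mulmxN /sesq mulmxN mulNmx mxE. Qed.

Lemma operator_integralP nu g u v : bounded_borel K g ->
  krein_product u (operator_integral cK nu g *m v) =
  complex_integral cK (matrix_element nu u v) g.
Proof.
move=> bg; rewrite /operator_integral.
set P := [set B | _]; suff [B PB] : P !=set0 by exact: (@xgetPex _ 0 P (ex_intro _ B PB)).
pose e (i : 'I_(n + n)) : 'cV[R[i]]_(n + n) := delta_mx i 0.
(* The values at basis vectors determine the operator; the factor [S] cancels the one inside the
   indefinite product. *)
exists (S *m \matrix_(i, j) complex_integral cK (matrix_element nu (e i) (e j)) g).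
move=> {}u {}v; rewrite krein_sesqM mulmxA signatureK mul1mx sesqE.
pose s := [seq ((u p.1 0)^* * v p.2 0, matrix_element nu (e p.1) (e p.2)) |
  p <- [seq (i, j) | i <- enum 'I_(n + n), j <- enum 'I_(n + n)]].
have := @complex_integral_sum R K cK (matrix_element nu u v) s g bg.
rewrite /s big_map big_allpairs_dep /= big_enum /= => ->.
  apply: eq_bigr => i _; rewrite big_enum /=; apply: eq_bigr => j _.
  by rewrite mxE mulrAC.
move=> A _ /=; rewrite krein_sesqM sesqE big_map big_allpairs_dep /= big_enum /=.
apply: eq_bigr => i _; rewrite big_enum /=; apply: eq_bigr => j _.
by rewrite krein_sesqM sesq_delta mulrAC.
Qed.

(** Negative definiteness only provides a measure for each vector; fixing the whole family [mu] lets
    integrals be computed and limits be taken with positive scalar measures. *)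
Definition represents nu (mu : 'cV[R[i]]_(n + n) -> fmeasure) : Prop :=
  forall u A, borel_subsets K A ->
    krein_product u (- nu A *m u) = (fine (mu u A))%:C.

Lemma negative_definiteP nu : negative_definite nu <-> exists mu, represents nu mu.
Proof.
split=> [/choice[mu hmu]|[mu hmu] u]; first by exists mu.
by exists (mu u); exact: hmu.
Qed.

Lemma operator_integral_represents nu mu g u : represents nu mu -> bounded_borel K g ->
  krein_product u (operator_integral cK nu g *m u) =
  - ((\int[mu u]_(k in K) complex.Re (g k)) +i* (\int[mu u]_(k in K) complex.Im (g k))).
Proof.
move=> hmu bg; rewrite operator_integralP//.
apply: complex_integral_opp_measure => // A bA.
by rewrite -(hmu u A bA) /= krein_opp opprK.
Qed.

Lemma krein_conjugate U A u v : krein_unitary U ->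
  krein_product u ((U *m A *m invmx U) *m v) =
  krein_product (invmx U *m u) (A *m (invmx U *m v)).
Proof.
move=> uU; rewrite -[RHS](krein_unitary_product (U := U) _ _ uU).
by rewrite !mulmxA mulmxV ?mul1mx//; case: uU.
Qed.

Lemma operator_integral_conjugate U nu g : krein_unitary U -> bounded_borel K g ->
  operator_integral cK (conjugate_measure U nu) g =
  U *m operator_integral cK nu g *m invmx U.
Proof.
move=> uU bg; apply: krein_inj => u v.
rewrite (krein_conjugate _ _ _ uU) !(operator_integralP _ _ _ bg).
have := @complex_integral_sum R K cK (matrix_element (conjugate_measure U nu) u v)
  [:: (1, matrix_element nu (invmx U *m u) (invmx U *m v))] g bg.
rewrite big_seq1 mul1r; apply=> A _ /=.
by rewrite big_seq1 mul1r (krein_conjugate _ _ _ uU).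
Qed.

Lemma represents_conjugate U nu mu : krein_unitary U -> represents nu mu ->
  represents (conjugate_measure U nu) (fun u => mu (invmx U *m u)).
Proof.
move=> uU hmu u A bA; rewrite -(hmu _ A bA) krein_opp [RHS]krein_opp.
by rewrite -(krein_conjugate _ _ _ uU).
Qed.

(* By polarization. *)
Lemma sesq_diag_cvg m (B : nat -> 'M[R[i]]_m) (C : 'M[R[i]]_m) :
  (forall w, (fun k => sesq (B k) w w) ~~> sesq C w w) ->
  forall i j, (fun k => B k i j) ~~> C i j.
Proof.
move=> h i j; rewrite -(sesq_delta C) polarization.
have -> : (fun k => B k i j) = (fun k => sesq (B k) (delta_mx i 0) (delta_mx j 0)).
  by apply/funext => k; rewrite sesq_delta.
under eq_fun do rewrite polarization.
apply: ccvgM; first exact: ccvg_cst.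
apply: ccvgD; first by apply: ccvgD; [exact: h|apply: ccvgN; exact: h].
apply: ccvgN; apply: ccvgM; first exact: ccvg_cst.
by apply: ccvgD; [exact: h|apply: ccvgN; exact: h].
Qed.

Lemma mulmx_cvg m p q (A : nat -> 'M[R[i]]_(m, p)) (a : 'M[R[i]]_(m, p))
    (B : nat -> 'M[R[i]]_(p, q)) (b : 'M[R[i]]_(p, q)) :
  (forall i j, (fun k => A k i j) ~~> a i j) ->
  (forall i j, (fun k => B k i j) ~~> b i j) ->
  forall i j, (fun k => (A k *m B k) i j) ~~> (a *m b) i j.
Proof.
move=> hA hB i j; rewrite mxE; under eq_fun do rewrite mxE.
by apply: ccvg_sum => l _; exact: ccvgM.
Qed.

Lemma krein_diag_cvg (B : nat -> 'M[R[i]]_(n + n)) (C : 'M[R[i]]_(n + n)) :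
  (forall u, (fun k => krein_product u (B k *m u)) ~~> krein_product u (C *m u)) ->
  forall i j, (fun k => B k i j) ~~> C i j.
Proof.
move=> h; have SC := sesq_diag_cvg (B := fun k => S *m B k) (C := S *m C).
have {}SC : forall i j, (fun k => (S *m B k) i j) ~~> (S *m C) i j.
  apply: SC => u; rewrite -krein_sesqM; under eq_fun do rewrite -krein_sesqM.
  exact: h.
move=> i j; rewrite -[C]mul1mx -signatureK -mulmxA.
have -> : (fun k => B k i j) = (fun k => (S *m (S *m B k)) i j).
  by apply/funext => k; rewrite mulmxA signatureK mul1mx.
by apply: mulmx_cvg; [move=> i' j'; exact: ccvg_cst|exact: SC].
Qed.

Lemma krein_product_cvg (B : nat -> 'M[R[i]]_(n + n)) (C : 'M[R[i]]_(n + n)) u v :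
  (forall i j, (fun k => B k i j) ~~> C i j) ->
  (fun k => krein_product u (B k *m v)) ~~> krein_product u (C *m v).
Proof.
move=> h; rewrite krein_sesqM sesqE; under eq_fun do rewrite krein_sesqM sesqE.
apply: ccvg_sum => i _; apply: ccvg_sum => j _.
apply: ccvgM; last exact: ccvg_cst.
apply: ccvgM; first exact: ccvg_cst.
by apply: mulmx_cvg; [move=> i' j'; exact: ccvg_cst|exact: h].
Qed.

Lemma operator_integral_cvg (nus : nat -> operator_measure K n) nu mus mu g :
  (forall k, represents (nus k) (mus k)) -> represents nu mu -> bounded_borel K g ->
  (forall u, (fun k => \int[mus k u]_(x in K) complex.Re (g x)) @ \oo -->
    \int[mu u]_(x in K) complex.Re (g x)) ->
  (forall u, (fun k => \int[mus k u]_(x in K) complex.Im (g x)) @ \oo -->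
    \int[mu u]_(x in K) complex.Im (g x)) ->
  forall i j, (fun k => operator_integral cK (nus k) g i j) ~~>
    operator_integral cK nu g i j.
Proof.
move=> hmus hmu bg hr hi.
apply: (@krein_diag_cvg (fun k => operator_integral cK (nus k) g)) => u.
apply: ccvg_ext (fun k => operator_integral_represents u (hmus k) bg)
  (operator_integral_represents u hmu bg) _.
by apply/ccvgN/ccvg_ReIm; split; [exact: hr|exact: hi].
Qed.

Lemma bounded_borel1 : bounded_borel K (fun=> 1).
Proof.
split; [exact: measurable_cst|exact: measurable_cst|exists 1 => k _].
by rewrite normr1.
Qed.

Lemma operator_integral1 nu mu : represents nu mu ->
  operator_integral cK nu (fun=> 1) = nu K.
Proof.
(* For constant sequences [krein_diag_cvg] reduces equality of matrices to equality of their
   diagonal values. *)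
move=> hmu; apply/matrixP => i j; apply: (@ccvg_unique _ (fun=> nu K i j)).
  apply: (@krein_diag_cvg (fun=> nu K)) => u.
  apply: (ccvg_ext _ (operator_integral_represents u hmu bounded_borel1)).
    by move=> k; reflexivity.
  have mK := measurable_compact cK.
  rewrite /= !(Rintegral_cst _ mK) mul1r mul0r.
  suff -> : krein_product u (nu K *m u) = - (fine (mu u K) +i* 0) by exact: ccvg_cst.
  rewrite -[X in - X]/((fine (mu u K))%:C) -(hmu u K (conj mK (@subset_refl _ K))).
  by rewrite krein_opp opprK.
exact: ccvg_cst.
Qed.

End OperatorIntegral.

(** * Weak compactness *)

Section Subsequences.
Variable R : realType.

(* A cluster point in the compact product space gives all the limits at once, so
   no nested subsequences are needed. *)
Lemma diagonal_subsequence (I : countType) (a : nat -> I -> R) (M : I -> R) :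
  (forall j i, `|a j i| <= M i) ->
  exists phi : nat -> nat, exists L : I -> R,
    {homo phi : i j / (i < j)%N} /\ forall i, (fun k => a (phi k) i) @ \oo --> L i.
Proof.
move=> aM; pose T (_ : I) : topologicalType := R : topologicalType.
have cM i : compact (`[- M i, M i]%classic : set (T i)) by exact: segment_compact.
have [|L [_ clL]] := @tychonoff I T _ cM (a @ \oo) _.
  by exists 0%N => // j _ i /=; rewrite in_itv /= -ler_norml.
(* Only the finitely many coordinates with code at most [k] are constrained, so this is a
   neighbourhood in the product topology. *)
pose near_L k := [set f : forall i, T i |
  forall i, (pickle i <= k)%N -> `|f i - L i| < k.+1%:R^-1].
have nL k : nbhs (L : prod_topology T) (near_L k).
  pose s := pmap (fun m => unpickle m : option I) (iota 0 k.+1).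
  have sP i : (pickle i <= k)%N -> i \in s.
    move=> ik; rewrite mem_pmap; apply/mapP; exists (pickle i).
      by rewrite mem_iota.
    by rewrite pickleK.
  have : nbhs (L : prod_topology T) [set f | forall i, i \in s -> `|f i - L i| < k.+1%:R^-1].
    elim: s {sP} => [|i s IH]; first by apply: filterS filterT.
    have hi : nbhs (L : prod_topology T) [set f | `|f i - L i| < k.+1%:R^-1].
      have nb : nbhs (L i : R) [set y : R | `|y - L i| < k.+1%:R^-1].
        apply/nbhs_ballP; exists k.+1%:R^-1; first by rewrite /= invr_gt0 ltr0n.
        by move=> y /=; rewrite /ball /= distrC.
      exact: (@proj_continuous I T i L _ nb).
    near=> f; move=> j; rewrite inE => /predU1P[->|].
      by near: f.
    by move: j; near: f.
  by apply: filterS => f h i /sP; exact: h.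
have step N k : exists j, (N <= j)%N /\ near_L k (a j).
  have FA : (a @ \oo) [set a j | j in [set j | (N <= j)%N]].
    by exists N => // j Nj; exists j.
  by have [f [[j Nj <-] h]] := clL _ _ FA (nL k); exists j.
have [next hnext] := choice (fun p : nat * nat => step p.1 p.2).
pose phi := fix phi k := if k is l.+1 then next ((phi l).+1, k) else next (0%N, 0%N).
have hphi k : near_L k (a (phi k)) 
  by case: k => [|k]; [exact: (hnext (0%N, 0%N)).2|exact: (hnext ((phi k).+1, k.+1)).2].
exists phi, L; split.
  apply: homo_ltn => [x y z|k]; first exact: ltn_trans.
  exact: (hnext ((phi k).+1, k.+1)).1.
move=> i; apply/cvgrPdist_lt => e e0.
near=> k; rewrite distrC; apply: (@lt_trans _ _ k.+1%:R^-1).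
  by apply: hphi; near: k; exact: nbhs_infty_ge.
by near: k; exact: near_infty_natSinv_lt (PosNum e0).
Unshelve. all: by end_near. Qed.

End Subsequences.

(** * Distribution functions from values at rational points *)

Section RationalCdf.
Variables (R : realType) (G : rat -> R) (c : R).
Hypothesis G_nd : forall p q : rat, p <= q -> G p <= G q.
Hypothesis G_neg : forall q : rat, q < 0 -> G q = 0.
Hypothesis G_ge1 : forall q : rat, 1 <= q -> G q = c.

Definition right_values (t : R) := [set G q | q in [set q : rat | t < ratr q]].
(** The right-continuous regularization of [G]; its value at a rational point may exceed that of
    [G]. *)
Definition right_cdf (t : R) : R := inf (right_values t).

Let G_ge0 q : 0 <= G q.
Proof.
rewrite -(G_neg (q := Num.min q (-1))); last by rewrite gt_min ltrN10 orbT.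
by apply: G_nd; rewrite ge_min lexx.
Qed.

Lemma right_values_has_inf t : has_inf (right_values t).
Proof.
split; last by exists 0 => _ [q _ <-]; exact: G_ge0.
have [q /itvP tq] : exists q, ratr q \in `]t, t + 1[.
      by apply: rat_in_itvoo; rewrite ltrDl.
by exists (G q), q => //=; rewrite tq.
Qed.

Lemma right_cdf_le t q : t < ratr q -> right_cdf t <= G q.
Proof.
by move=> tq; apply: inf_lbound; [exact: (right_values_has_inf t).2|exists q].
Qed.

Lemma right_cdf_ge q : G q <= right_cdf (ratr q).
Proof.
apply: lb_le_inf; first exact: (right_values_has_inf _).1.
by move=> _ [p /= qp <-]; apply: G_nd; rewrite ltW// -(@ltr_rat R).
Qed.

Lemma right_cdf_nondecreasing : nondecreasing right_cdf.
Proof.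
move=> s t st; apply: lb_le_inf; first exact: (right_values_has_inf _).1.
by move=> _ [p /= tp <-]; apply: right_cdf_le; exact: le_lt_trans tp.
Qed.

Lemma right_cdf_approx t e : 0 < e ->
  exists2 q, t < ratr q & G q < right_cdf t + e.
Proof.
move=> e0; have [_ [q tq <-] h] := inf_adherent e0 (right_values_has_inf t).
by exists q.
Qed.

Lemma right_cdf_right_continuous : right_continuous right_cdf.
Proof.
move=> t; apply/cvgrPdist_lt => e e0; have [q tq Gq] := right_cdf_approx t e0.
near=> s.
have ts : right_cdf t <= right_cdf s by apply: right_cdf_nondecreasing; near: s; exact: nbhs_right_ge.
have sG : right_cdf s <= G q by apply: right_cdf_le; near: s; exact: nbhs_right_lt.
rewrite distrC ger0_norm ?subr_ge0//; lra.
Unshelve. all: by end_near. Qed.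

Lemma right_cdf_neg t : t < 0 -> right_cdf t = 0.
Proof.
move=> t0; have [q /itvP tq] := rat_in_itvoo t0.
apply/le_anti/andP; split.
  rewrite -(G_neg (q := q)); first by apply: right_cdf_le; rewrite tq.
  by rewrite -(@ltr_rat R) rmorph0 tq.
apply: lb_le_inf; first exact: (right_values_has_inf _).1.
by move=> _ [p _ <-]; exact: G_ge0.
Qed.

Lemma right_cdf_ge1 t : 1 <= t -> right_cdf t = c.
Proof.
move=> t1; apply/le_anti/andP; split.
  have [q tq] : exists q, t < ratr q.
    have [q /itvP tq] : exists q, ratr q \in `]t, t + 1[.
      by apply: rat_in_itvoo; rewrite ltrDl.
    by exists q; rewrite tq.
  rewrite -(G_ge1 (q := q)); first exact: right_cdf_le.
  by rewrite -(@ler_rat R) rmorph1 (le_trans t1)// ltW.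
apply: lb_le_inf; first exact: (right_values_has_inf _).1.
move=> _ [p /= tp <-]; rewrite G_ge1//.
by rewrite -(@ler_rat R) rmorph1 (le_trans t1)// ltW.
Qed.

End RationalCdf.

Section CdfMeasure.
Variable R : realType.

(** The Stieltjes measure of [F], restricted to []-1, 1]] to make finiteness evident. No mass is
    lost, and the endpoint [-1] leaves room for an atom at 0 of mass [F 0]. *)
Lemma cdf_measure (F : R -> R) : nondecreasing F -> right_continuous F ->
  (forall t, t < 0 -> F t = 0) -> (forall t, 1 <= t -> F t = F 1) ->
  exists l : {finite_measure set (measurableTypeR R) -> \bar R},
    (forall t, fine (l `]-oo, t]%classic) = F t) /\ fine (l setT) = F 1.
Proof.
move=> ndF rcF F0 F1.
pose Fm := isCumulative.Build R _ R F ndF rcF.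
pose Fc : cumulative R R := HB.pack F Fm.
pose m0 := lebesgue_stieltjes_measure Fc.
have m0E a b : a <= b -> m0 `]a, b]%classic = (F b - F a)%:E.
  move=> ab; rewrite /m0 /lebesgue_stieltjes_measure /measure_extension.
  rewrite measurable_mu_extE/=; last exact: is_ocitv.
  by rewrite wlength_itv_bnd.
have mD : measurable (`]-1, 1]%classic : set (measurableTypeR R)) by exact: measurable_itv.
pose m := mrestr m0 mD.
have fin : fin_num_fun m.
  move=> A mA; rewrite ge0_fin_numE ?measure_ge0//.
  apply: (@le_lt_trans _ _ (m0 `]-1, 1]%classic)).
    by apply: le_measure; rewrite ?inE//; exact: measurableI.
  by rewrite m0E// ltry.
pose mf := @Measure_isFinite.Build _ (measurableTypeR R) R m fin.
pose l : {finite_measure set (measurableTypeR R) -> \bar R} := HB.pack m mf.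
have h11 : -1 <= 1 :> R by lra.
have m1 : fine (l setT) = F 1.
  rewrite /l /= /m /mrestr setTI (m0E _ _ h11).
  by rewrite /= (F0 (-1)) ?subr0// ltrN10.
exists l; split=> // t.
rewrite /l /= /m /mrestr.
have [t1|t1] := leP t (-1).
  have -> : `]-oo, t]%classic `&` `]-1, 1]%classic = set0 :> set R.
    rewrite -subset0 => x [] /=; rewrite !in_itv /= => xt /andP[x1 _].
    by move: (lt_le_trans x1 (le_trans xt t1)); rewrite ltxx.
  have -> : m0 set0 = 0%E by exact: measure0.
  by rewrite F0// (le_lt_trans t1)// ltrN10.
have -> : `]-oo, t]%classic `&` `]-1, 1]%classic = `]-1, Num.min t 1]%classic :> set R.
  apply/seteqP; split=> x /=; rewrite !in_itv /= le_min.
    by move=> [-> /andP[-> ->]].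
  by move=> /andP[-> /andP[-> ->]].
rewrite m0E ?le_min ?(ltW t1) //=.
rewrite (F0 (-1)) ?ltrN10// subr0; case: (leP t 1) => // /ltW t2.
by rewrite F1.
Qed.

End CdfMeasure.

(** * Quadratic forms recovered by polarization *)

Section Polarization.
Variables (C : numClosedFieldType) (m : nat).

Definition polar_mx (q : 'cV[C]_m -> C) : 'M[C]_m := \matrix_(i, j)
  let u : 'cV[C]_m := delta_mx i 0 in let v : 'cV[C]_m := delta_mx j 0 in
  4^-1 * (q (u + v) - q (u + (-1) *: v) -
    'i * (q (u + 'i *: v) - q (u + (- 'i) *: v))).

Lemma polar_mx_sesq q (B : 'M[C]_m) : (forall u, sesq B u u = q u) -> polar_mx q = B.
Proof.
move=> qB; apply/matrixP => i j; rewrite mxE /= -!qB.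
by rewrite -[RHS]sesq_delta [RHS]polarization.
Qed.

Lemma sesqDmx (A B : 'M[C]_m) u : sesq (A + B) u u = sesq A u u + sesq B u u.
Proof. by rewrite /sesq mulmxDr mulmxDl mxE. Qed.

Lemma sesqNmx (B : 'M[C]_m) u : sesq (- B) u u = - sesq B u u.
Proof. by rewrite /sesq mulmxN mulNmx mxE. Qed.

Lemma sesq0mx (u : 'cV[C]_m) : sesq 0 u u = 0.
Proof. by rewrite /sesq mulmx0 mul0mx mxE. Qed.

End Polarization.

Section QuadraticFamilies.
Variables (R : realType) (m : nat).
Implicit Types (Q : 'cV[R[i]]_m -> R) (u : 'cV[R[i]]_m).

Local Notation polar Q := (polar_mx (fun u => (Q u)%:C)).

(** To be a quadratic form is expressed as an equation that [Q] satisfies with its own polarization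
    matrix. Such a condition is stable under sums, differences and pointwise limits. *)
Definition hermitian_form Q : Prop := forall u, sesq (polar Q) u u = (Q u)%:C.

Lemma hermitian_formP Q (B : 'M[R[i]]_m) :
  (forall u, sesq B u u = (Q u)%:C) -> hermitian_form Q.
Proof. by move=> QB u; rewrite (polar_mx_sesq QB). Qed.

Lemma polar_mx_cvg (Q : nat -> 'cV[R[i]]_m -> R) Q' :
  (forall u, (fun k => Q k u) @ \oo --> Q' u) ->
  forall i j, (fun k => polar (Q k) i j) ~~> polar Q' i j.
Proof.
move=> QQ i j; rewrite mxE; under eq_fun do rewrite mxE /=.
have h u : (fun k => (Q k u)%:C) ~~> (Q' u)%:C by exact: ccvg_real.
apply: ccvgM; first exact: ccvg_cst.
apply: ccvgD; first by apply: ccvgD; [exact: h|apply: ccvgN; exact: h].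
apply: ccvgN; apply: ccvgM; first exact: ccvg_cst.
by apply: ccvgD; [exact: h|apply: ccvgN; exact: h].
Qed.

Lemma sesq_cvg (B : nat -> 'M[R[i]]_m) (C : 'M[R[i]]_m) u :
  (forall i j, (fun k => B k i j) ~~> C i j) ->
  (fun k => sesq (B k) u u) ~~> sesq C u u.
Proof.
move=> h; rewrite sesqE; under eq_fun do rewrite sesqE.
apply: ccvg_sum => i _; apply: ccvg_sum => j _.
apply: ccvgM; last exact: ccvg_cst.
by apply: ccvgM; [exact: ccvg_cst|exact: h].
Qed.

Lemma hermitian_form_lim (Q : nat -> 'cV[R[i]]_m -> R) Q' :
  (forall k, hermitian_form (Q k)) ->
  (forall u, (fun k => Q k u) @ \oo --> Q' u) -> hermitian_form Q'.
Proof.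
move=> hQ QQ u; apply: (@ccvg_unique _ (fun k => sesq (polar (Q k)) u u)).
  by apply: sesq_cvg; exact: polar_mx_cvg.
by apply: (ccvg_ext (fun k => hQ k u) erefl); exact: ccvg_real.
Qed.

Lemma hermitian_form0 : hermitian_form (fun=> 0).
Proof. by apply: (@hermitian_formP _ 0) => u; rewrite /sesq mulmx0 mul0mx mxE. Qed.

Lemma hermitian_formD Q1 Q2 : hermitian_form Q1 -> hermitian_form Q2 ->
  hermitian_form (fun u => Q1 u + Q2 u).
Proof.
move=> h1 h2; apply: (@hermitian_formP _ (polar Q1 + polar Q2)) => u.
by rewrite sesqDmx h1 h2 rmorphD.
Qed.

Lemma hermitian_formB Q1 Q2 : hermitian_form Q1 -> hermitian_form Q2 ->
  hermitian_form (fun u => Q1 u - Q2 u).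
Proof.
move=> h1 h2; apply: (@hermitian_formP _ (polar Q1 - polar Q2)) => u.
by rewrite sesqDmx sesqNmx h1 h2 rmorphB.
Qed.

Lemma hermitian_form_sum (I : Type) (s : seq I) (Q : I -> 'cV[R[i]]_m -> R) :
  (forall i, hermitian_form (Q i)) ->
  hermitian_form (fun u => \sum_(i <- s) Q i u).
Proof.
move=> h; elim: s => [|i s IH].
  by under eq_fun do rewrite big_nil; exact: hermitian_form0.
by under eq_fun do rewrite big_cons; exact: hermitian_formD.
Qed.

Lemma fine_measure_cvg d (T : measurableType d)
    (mu : {finite_measure set T -> \bar R}) (F : (set T)^nat) :
  (forall i, measurable (F i)) -> trivIset setT F ->
  (fun N => \sum_(0 <= i < N) fine (mu (F i))) @ \oo --> fine (mu (\bigcup_i F i)).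
Proof.
move=> mF tF; have mU : measurable (\bigcup_i F i) by exact: bigcup_measurable.
have h := @measure_semi_sigma_additive _ _ _ mu _ mF tF mU.
have -> : (fun N => \sum_(0 <= i < N) fine (mu (F i))) =
    (fun N => fine (\sum_(0 <= i < N) mu (F i))%E).
  apply/funext => N; rewrite [X in fine X](_ : _ = (\sum_(0 <= i < N) fine (mu (F i)))%:E)//.
  by rewrite -sumEFin; apply: eq_bigr => i _; rewrite fineK// fin_num_measure.
by apply: fine_cvg; rewrite fineK ?fin_num_measure.
Qed.

(** Dynkin's theorem, starting from the half-open intervals: complements are differences, and
    countable disjoint unions are limits of finite sums. *)
Lemma hermitian_family_measure
    (l : 'cV[R[i]]_m -> {finite_measure set (measurableTypeR R) -> \bar R}) :
  (forall t, hermitian_form (fun u => fine (l u `]-oo, t]%classic))) ->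
  hermitian_form (fun u => fine (l u setT)) ->
  forall A, @measurable _ (measurableTypeR R) A ->
    hermitian_form (fun u => fine (l u A)).
Proof.
move=> ht hT.
pose P : set (set (measurableTypeR R)) := [set A | hermitian_form (fun u => fine (l u A))].
move=> A mA; apply: (@dynkin_induction _ (measurableTypeR R) (@ocitv R) P _ _ _ _ _ _ A) => //.
- exact: ocitvI.
- move=> _ [[a b] _ <-]; rewrite /P /=; have [ab|ba] := leP a b; last first.
    rewrite set_itv_ge; last by rewrite bnd_simp -leNgt ltW.
    have -> : (fun u => fine (l u set0)) = (fun=> 0).
      by apply/funext => u; rewrite measure0.
    exact: hermitian_form0.
  have e : (fun u => fine (l u `]-oo, b]%classic) - fine (l u `]-oo, a]%classic)) =
      (fun u => fine (l u `]a, b]%classic)).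
    apply/funext => u; apply/eqP; rewrite subr_eq addrC.
    have mI (i : interval R) : @measurable _ (measurableTypeR R) [set` i].
      exact: measurable_itv.
    rewrite -fine_measureU//.
      apply/eqP; congr (fine (l u _)); apply/seteqP; split=> x /=; rewrite !in_itv /=.
        by move=> xb; have [xa|ax] := leP x a; [left|right].
      by case=> [xa|/andP[_ //]]; exact: le_trans xa ab.
    rewrite -subset0 => x [] /=; rewrite !in_itv /= => xa /andP[ax _].
    by move: (lt_le_trans ax xa); rewrite ltxx.
  by have := hermitian_formB (ht b) (ht a); rewrite e.
- move=> S mS PS; rewrite /P /=.
  have -> : (fun u => fine (l u (~` S))) = (fun u => fine (l u setT) - fine (l u S)).
    apply/funext => u; have mSC := measurableC mS.
    have dS : ~` S `&` S = set0 by rewrite setIC setICr.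
    have := fine_measureU (l u) mSC mS dS; rewrite setUC setUv => ->.
    by rewrite addrK.
  exact: hermitian_formB.
- move=> F mF tF PF; rewrite /P /=.
  apply: (@hermitian_form_lim (fun N u => \sum_(0 <= i < N) fine (l u (F i)))).
    by move=> N; exact: hermitian_form_sum.
  by move=> u; exact: fine_measure_cvg.
Qed.

End QuadraticFamilies.

Lemma mx_cvg (R : realType) m (B : nat -> 'M[R[i]]_m) (C : 'M[R[i]]_m) :
  (forall i j, (fun k => B k i j) ~~> C i j) ->
  (B : nat -> 'M[R[i]^o]_m) @ \oo --> (C : 'M[R[i]^o]_m).
Proof.
move=> h A [P MP PA].
have : \forall k \near \oo, forall i j, P i j (B k i j).
  apply: filter_forall => i; apply: filter_forall => j.
  exact: (ccvg_lim (h i j)).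
by apply: filterS => k hk; exact: PA.
Qed.

Section MeasureOfFamily.
Variables (R : realType) (n : nat) (K : set (four_vector R)).

(** The operator is minus the signature times the polarization matrix of the masses, and countable
    additivity is inherited from the finitely many scalar measures that polarization involves. *)
Lemma operator_measure_of_family
    (mu : 'cV[R[i]]_(n + n) -> {finite_measure set (momentum R) -> \bar R}) :
  (forall A, @measurable _ (momentum R) A -> hermitian_form (fun u => fine (mu u A))) ->
  exists nu : operator_measure K n, represents nu mu.
Proof.
move=> hmu; pose B A := polar_mx (fun u => (fine (mu u A))%:C).
pose f A : 'M[R[i]^o]_(n + n) := - (signature R n *m B A).
have BU (F : (set (momentum R))^nat) N : (forall i, measurable (F i)) ->
    \sum_(0 <= i < N) f (F i) = - (signature R n *m
      polar_mx (fun u => (\sum_(0 <= i < N) fine (mu u (F i)))%:C)).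
  move=> mF; elim: N => [|N IH].
    rewrite big_geq// (polar_mx_sesq (B := 0)) ?mulmx0 ?oppr0// => u.
    by rewrite big_geq// sesq0mx.
  have SD (X Y : 'M[R[i]]_(n + n)) : - (signature R n *m X) + - (signature R n *m Y) =
    - (signature R n *m (X + Y)) by rewrite mulmxDr opprD.
  rewrite big_nat_recr; last by [].
  rewrite IH.
  apply: (etrans (SD _ _)).
  congr (- (_ *m _)).
  apply/esym/polar_mx_sesq => u.
  rewrite sesqDmx.
  rewrite big_nat_recr; last by [].
  rewrite rmorphD.
  congr (_ + _); last exact: hmu.
  apply: (@hermitian_form_sum _ _ _ _ (fun i u => fine (mu u (F i)))) => i.
  exact: hmu.
have ca : countably_additive K f.
  split.
    rewrite /f (_ : B set0 = 0) ?mulmx0 ?oppr0//; apply: polar_mx_sesq => u.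
    by rewrite measure0 sesq0mx.
  move=> F bF tF; have mF i : measurable (F i) by have [] := bF i.
  under eq_fun do rewrite (BU _ _ mF).
  apply: mx_cvg => i j; rewrite mxE; under eq_fun do rewrite mxE.
  apply: ccvgN; apply: mulmx_cvg; first by move=> *; exact: ccvg_cst.
  by apply: polar_mx_cvg => u; exact: fine_measure_cvg.
exists (VMeasure ca) => u A [mA _] /=.
rewrite /f opprK krein_sesqM mulmxA signatureK mul1mx.
exact: hmu.
Qed.

End MeasureOfFamily.

(** * Convergence of integrals along an increasing family of sets *)

Section HellyBray.
Variable R : realType.

Lemma abel_sum (c D : nat -> R) n :
  \sum_(k < n.+1) c k * (D k.+1 - D k) =
  c n * D n.+1 - c 0%N * D 0%N - \sum_(k < n) (c k.+1 - c k) * D k.+1.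
Proof.
elim: n => [|n IH]; first by rewrite big_ord_recr !big_ord0 /=; ring.
by rewrite big_ord_recr IH [in RHS]big_ord_recr /=; ring.
Qed.

Lemma telescope_ord (f : nat -> R) n : \sum_(k < n) (f k.+1 - f k) = f n - f 0%N.
Proof.
elim: n => [|n IH]; first by rewrite big_ord0 subrr.
by rewrite big_ord_recr IH /=; ring.
Qed.

Context d (T : measurableType d).
Variables (m : nat -> {finite_measure set T -> \bar R}) (E : R -> set T).
Hypothesis mE : forall t, measurable (E t).
Hypothesis E_nd : forall s t, s <= t -> E s `<=` E t.
Hypothesis E_neg : forall t, t < 0 -> E t = set0.
Variables (G : rat -> R) (l : {finite_measure set (measurableTypeR R) -> \bar R}).
Hypothesis mG : forall q, (fun k => fine (m k (E (ratr q)))) @ \oo --> G q.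
Hypothesis G_nd : forall p q : rat, p <= q -> G p <= G q.
Hypothesis G_neg : forall q : rat, q < 0 -> G q = 0.
Hypothesis G_ge1 : forall q : rat, 1 <= q -> G q = G 1.
Hypothesis lF : forall t, fine (l `]-oo, t]%classic) = right_cdf G t.
Hypothesis lT : fine (l setT) = G 1.
Variables (h : T -> R) (H : R -> R) (M : R).
Hypothesis mh : measurable_fun (E 1) h.
Hypothesis hM : forall x, E 1 x -> `|h x| <= M.
Hypothesis mH : measurable_fun setT (H : measurableTypeR R -> R).
Hypothesis HM : forall t, `|H t| <= M.
Hypothesis H_le0 : forall t, t <= 0 -> H t = H 0.
Hypothesis H_ge1 : forall t, 1 <= t -> H t = H 1.
Hypothesis uH : forall e, 0 < e -> exists N : nat, (0 < N)%N /\
  forall s t, `|s - t| <= N%:R^-1 -> `|H s - H t| <= e.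
(** The only link between the two sides: a point that enters between the parameters [s] and [t] has
    the value of [H] at some parameter in between. It holds for a curve with self-intersections,
    where a point enters at its first visit. *)
Hypothesis hH : forall s t x, E t x -> ~ E s x ->
  exists2 r, s < r <= t & h x = H r.

(* The step sums over the partition k/N of the two sides differ, by Abel
   summation, by oscillations of H times jumps of the limit distribution. *)
Lemma helly_bray : (fun k => \int[m k]_(x in E 1) h x) @ \oo --> \int[l]_x H x.
Proof.
have F1 : right_cdf G 1 = G 1 by exact: (right_cdf_ge1 (c := G 1)).
have F_nd := right_cdf_nondecreasing G_nd G_neg.
have G1_ge0 : 0 <= G 1 by rewrite -(G_neg (q := -1))// G_nd.
apply/cvgrPdist_le => e e0.
(* The error is at most [eta * (G 1 + 1)] for the step sum of [m j], [eta] for the convergence of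
   these sums, and [eta * G 1] for each of the two remaining comparisons. *)
pose eta := e / (3 * G 1 + 2).
have den0 : 0 < 3 * G 1 + 2 by lra.
have eta0 : 0 < eta by rewrite divr_gt0.
have [N [N0 uN]] := uH eta0.
have NR0 : 0 < N%:R :> R by rewrite ltr0n.
(* The nodes run from [- 1 / N] to 1 in [N.+1] cells: starting below 0, where the sets are empty,
   puts the mass at parameter 0 into the first cell. *)
pose tq (k : nat) : rat := (k%:R - 1) / N%:R.
pose tr (k : nat) : R := (k%:R - 1) / N%:R.
have tE k : tr k = ratr (tq k) by rewrite /tr /tq fmorph_div rmorphB rmorph1 /= !ratr_nat.
have tr_nd j k : (j <= k)%N -> tr j <= tr k.
  by move=> jk; rewrite ler_pM2r ?invr_gt0// lerD2r ler_nat.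
have trS k : tr k.+1 = tr k + N%:R^-1 by rewrite /tr -natr1; ring.
have tr0 : tr 0%N < 0 by rewrite /tr sub0r mulN1r oppr_lt0 invr_gt0.
have tr1 : tr 1%N = 0 by rewrite /tr subrr mul0r.
have trN : tr N.+1 = 1 by rewrite /tr -natr1 addrK divff// gt_eqF.
pose c k := H (tr k.+1).
pose S j := \sum_(k < N.+1) c k * (fine (m j (E (tr k.+1))) - fine (m j (E (tr k)))).
pose SG := \sum_(k < N.+1) c k * (G (tq k.+1) - G (tq k)).
pose SF := \sum_(k < N.+1) c k * (right_cdf G (tr k.+1) - right_cdf G (tr k)).
have hS j : `|\int[m j]_(x in E 1) h x - S j| <= eta * fine (m j (E 1)).
  rewrite -trN; apply: (@step_integral _ _ _ _ (E \o tr) h c eta M N.+1) => //=.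
  - exact: E_neg.
  - by move=> k; exact/E_nd/tr_nd.
  - by rewrite trN.
  - by rewrite trN.
  move=> k x _ xE xE'; have [r /andP[r1 r2] ->] := hH xE xE'.
  by apply: uN; rewrite ler_norml; apply/andP; split; move: (trS k); lra.
have hSG : S j @[j --> \oo] --> SG.
  apply: cvg_big => [|k _]; first exact: add_continuous.
  apply: cvgM; first exact: cvg_cst.
  by apply: cvgB; rewrite tE; exact: mG.
(* The first half-line is replaced by the empty set and the last by the whole line. This leaves the
   masses unchanged, and [H] is constant on the parts of the line that are added to the outer
   cells. *)
pose E2 k : set (measurableTypeR R) := if k is 0 then set0 else
  if (k <= N)%N then `]-oo, tr k]%classic else setT.
have lE2 k : (k <= N.+1)%N -> fine (l (E2 k)) = right_cdf G (tr k).
  case: k => [_|k kN]; first by rewrite /E2 measure0 right_cdf_neg.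
  rewrite /E2; have [kN'|Nk] := leqP k.+1 N; first exact: lF.
  have -> : k.+1 = N.+1 by apply/eqP; rewrite eqn_leq kN Nk.
  by rewrite trN F1; exact: lT.
have hSF : `|\int[l]_x H x - SF| <= eta * G 1.
  have -> : SF = \sum_(k < N.+1) c k * (fine (l (E2 k.+1)) - fine (l (E2 k))).
    apply: eq_bigr => k _; rewrite !lE2//.
    exact: ltnW.
  have E2T : E2 N.+1 = setT by rewrite /E2 ltnn.
  rewrite -lT -{1 2}E2T.
  apply: (@step_integral _ _ _ _ E2 H c eta M N.+1) => //.
  - move=> k; rewrite /E2; case: k => [|k]; first exact: measurable0.
    by have [_|_] := leqP k.+1 N; [exact: measurable_itv|exact: measurableT].
  - move=> [|k] //; rewrite /E2; have [k2|//] := leqP k.+2 N.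
    by rewrite (ltnW k2) => x /=; rewrite !in_itv /= => /le_trans; apply; exact: tr_nd.
  - by rewrite E2T.
  move=> k x kN x1 x2; have xk : tr k < x \/ (k = 0%N /\ x <= 0).
    case: k kN x1 x2 => [|k] kN; rewrite /E2.
      have [x0|x0] := leP x 0; first by right.
      by move=> _ _; left; exact: lt_trans x0.
    have kN' : (k < N)%N := kN.
    by rewrite kN' /= in_itv /= => _ /negP; rewrite -ltNge; left.
  case: xk => [xk|[-> x0]]; last first.
    by rewrite /c tr1 (H_le0 x0) subrr normr0 ltW.
  have [xk'|xk'] := leP x (tr k.+1).
    by apply: uN; rewrite ler_norml; apply/andP; split; move: (trS k); lra.
  have Nk : (N < k.+1)%N.
    rewrite ltnNge; apply/negP => kN'; move: x1; rewrite /E2 kN' /= in_itv /=.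
    by rewrite leNgt xk'.
  have kE : k.+1 = N.+1 by apply/eqP; rewrite eqn_leq Nk kN.
  by rewrite /c kE trN (H_ge1 (t := x)) ?subrr ?normr0 ?ltW// -trN -kE.
have hGF : `|SG - SF| <= eta * G 1.
  pose D k := G (tq k) - right_cdf G (tr k).
  have -> : SG - SF = \sum_(k < N.+1) c k * (D k.+1 - D k).
    by rewrite -sumrB; apply: eq_bigr => k _; rewrite /D; ring.
  rewrite abel_sum.
  have D0 : D 0%N = 0.
    by rewrite /D G_neg ?right_cdf_neg ?subrr// -(@ltr_rat R) rmorph0 -tE.
  have DN : D N.+1 = 0.
    rewrite /D trN F1 G_ge1 ?subrr//.
    by rewrite -(@ler_rat R) rmorph1 -tE trN.
  rewrite D0 DN !mulr0 subrr sub0r normrN.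
  apply: (le_trans (ler_norm_sum _ _ _)).
  have -> : G 1 = right_cdf G (tr N.+1) - right_cdf G (tr 0%N).
    by rewrite trN F1 right_cdf_neg ?subr0.
  apply: (@le_trans _ _ (eta * (right_cdf G (tr N) - right_cdf G (tr 0%N)))); last first.
    apply: ler_wpM2l; first exact: ltW.
    by rewrite lerD2r; exact/F_nd/tr_nd.
  rewrite -(telescope_ord (fun k => right_cdf G (tr k))) mulr_sumr; apply: ler_sum => k _.
  rewrite normrM ler_pM//.
    by apply: uN; rewrite trS addrAC subrr add0r ger0_norm// invr_ge0 ltW.
  (* At an interior node the value of [G] lies between the right limits at the preceding node and at
     the node itself, so the gap is at most the increment over the cell that ends there. *)
  rewrite /D distrC ger0_norm.
    rewrite lerD2l lerN2; apply: (right_cdf_le G_nd G_neg).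
    by rewrite -tE trS ltrDl invr_gt0.
  by rewrite subr_ge0 tE; apply: (right_cdf_ge G_nd G_neg).
have hm : fine (m j (E 1)) @[j --> \oo] --> G 1.
  by have := @mG 1; rewrite rmorph1.
near=> j.
have j1 : `|SG - S j| <= eta by near: j; move/cvgrPdist_le : hSG; exact.
have j2 : `|G 1 - fine (m j (E 1))| <= 1 by near: j; move/cvgrPdist_le : hm; exact.
have := hS j.
have eE : eta * (3 * G 1 + 2) = e by rewrite /eta divfK// gt_eqF.
move: j1 j2 hSF hGF; rewrite !ler_norml.
move=> /andP[? ?] /andP[? ?] /andP[? ?] /andP[? ?] /andP[? ?].
apply/andP; split; nra.
Unshelve. all: by end_near. Qed.

End HellyBray.

(** * Continuity, measurability and the distance to a closed set *)

Section Topology.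
Variable R : realType.

Lemma segment_uniformly_continuous (f : R -> R) (a b : R) : continuous f ->
  forall e, 0 < e -> exists N : nat, (0 < N)%N /\
    forall x s, a <= x <= b -> `|s - x| <= N%:R^-1 -> `|f s - f x| <= e.
Proof.
move=> cf e e0; have /compact_near_coveringP cab := @segment_compact R a b.
pose P (N : nat) (x : R) := forall s, `|s - x| <= N.+1%:R^-1 -> `|f s - f x| <= e.
have [x xab|N _ hN] := cab nat \oo P _.
  have e20 : 0 < e / 2 by rewrite divr_gt0.
  have /cvgrPdist_lt/(_ _ e20)/nbhs_ballP[r /= r0 hr] := cf x.
  near=> x' N => s sx'.
  have xx' : `|x - x'| < r / 2.
    by near: x'; apply/nbhs_ballP; exists (r / 2); rewrite /= ?divr_gt0.
  have Nr : N.+1%:R^-1 < r / 2.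
    near: N; have r20 : 0 < r / 2 by rewrite divr_gt0.
    exact: near_infty_natSinv_lt (PosNum r20).
  have h1 : `|f x - f x'| < e / 2.
    by apply: hr; rewrite /ball /= (lt_trans xx')// ltr_pdivrMr// ltr_pMr// ltr1n.
  have xs : `|x - s| < r.
    rewrite (splitr r) (le_lt_trans (ler_distD x' x s))// ltrD//.
    by rewrite distrC (le_lt_trans sx').
  have h2 : `|f x - f s| < e / 2 by exact: hr.
  rewrite (splitr e) (le_trans (ler_distD (f x) _ _))// lerD//; last exact: ltW.
  by rewrite distrC ltW.
exists N.+1; split=> // x s xab; apply: (hN N (leqnn N) x) => /=.
by rewrite in_itv.
Unshelve. all: by end_near. Qed.

Lemma continuous_momentum_measurable (g : four_vector R -> R) : continuous g ->
  @measurable_fun _ _ (momentum R) R setT g.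
Proof.
move=> cg; apply: (measurability _ (RGenOInfty.measurableE R)).
move=> _ [_ [a ->] <-]; rewrite setTI; apply: sub_sigma_algebra.
by apply: open_comp => // x _; exact: cg.
Qed.

Lemma measurable_curve (p : R -> four_vector R) : continuous p ->
  @measurable_fun _ _ (measurableTypeR R) (momentum R) setT p.
Proof.
move=> cp; apply: (@measurability _ _ (measurableTypeR R) (momentum R) setT p open) => //.
move=> _ [U oU <-]; rewrite setTI; apply: open_measurable.
by apply: open_comp => // x _; exact: cp.
Qed.

(* The distance to K, capped at 1. *)
Lemma distance_function (K : set (four_vector R)) : closed K -> K !=set0 ->
  exists g : four_vector R -> R, [/\ continuous g, forall x, 0 <= g x <= 1,
    forall x, K x -> g x = 0 & forall x, g x = 0 -> K x].
Proof.
move=> clK [x0 Kx0]; pose V x := [set `|x - y| | y in K].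
have iV x : has_inf (V x).
  by split; [exists `|x - x0|, x0|exists 0 => _ [y _ <-]].
pose f x := inf (V x).
have f0 x : 0 <= f x by apply: lb_le_inf; [exact: (iV x).1|move=> _ [y _ <-]].
have fle x y : f x <= `|x - y| + f y.
  rewrite -lerBlDl; apply: lb_le_inf; first exact: (iV y).1.
  move=> _ [z Kz <-]; rewrite lerBlDl (le_trans _ (ler_distD y x z))//.
  by apply: inf_lbound; [exact: (iV x).2|exists z].
have key (a b c e : R) : a <= c + b -> b <= c + a -> c <= e -> `|a - b| <= e.
  by move=> ? ? ?; rewrite ler_norml; apply/andP; split; lra.
exists (fun x => Num.min (f x) 1); split.
- move=> x; have cf : {for x, continuous f}.
    apply/cvgrPdist_le => e e0; near=> y.
    have xy : `|x - y| <= e by near: y; apply: cvgr_dist_le.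
    have h1 := fle x y; have h2 := fle y x; rewrite distrC in h2.
    exact: key h1 h2 xy.
  by apply: (continuous_min cf); exact: cvg_cst.
- by move=> x; rewrite le_min f0 ler01 ge_min lexx orbT.
- move=> x Kx; have -> : f x = 0; last by rewrite (min_idPl _).
  apply/le_anti; rewrite f0 andbT; apply: inf_lbound; first exact: (iV x).2.
  by exists x => //; rewrite subrr normr0.
move=> x; have [fx1|fx1] := ltP (f x) 1; last by move=> /eqP; rewrite oner_eq0.
move=> fx0; apply: clK => U /nbhs_ballP[e /= e0 eU].
have [_ [y Ky <-] xy] := inf_adherent e0 (iV x).
by exists y; split=> //; apply: eU; move: xy; rewrite -ball_normE /ball_ /= -/(f x) fx0 add0r.
Unshelve. all: by end_near. Qed.

End Topology.

Section Pushforward.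
Variable R : realType.

Lemma pushforward_finite (l : {finite_measure set (measurableTypeR R) -> \bar R})
    (p : R -> four_vector R) : continuous p ->
  exists mu : {finite_measure set (momentum R) -> \bar R},
    (forall A, mu A = l (p @^-1` A)) /\
    (forall g M, @measurable_fun _ _ (momentum R) R setT g -> (forall x, `|g x| <= M) ->
      \int[mu]_x g x = \int[l]_t g (p t)).
Proof.
move=> /measurable_curve mp.
pose pm := measure_function_pushforward__canonical__measure_function_Measure l mp.
have fin : fin_num_fun pm.
  move=> A mA; apply: fin_num_measure; rewrite -[X in measurable X]setTI.
  by have := mp; apply.
pose pmf := @Measure_isFinite.Build _ (momentum R) R pm fin.
pose mu : {finite_measure set (momentum R) -> \bar R} := HB.pack (Measure.sort pm) pmf.
exists mu; split=> // g M mg gM.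
rewrite /Rintegral (eq_measure_integral pm)//.
have ig : l.-integrable setT ((EFin \o g) \o p).
  exact: (bounded_integrable l measurableT (measurableT_comp mg mp) (fun x _ => gM (p x))).
have mEg : @measurable_fun _ _ (momentum R) _ setT (EFin \o g) by exact/measurable_EFinP.
by rewrite (integral_pushforward mp mEg ig measurableT).
Qed.

End Pushforward.

Section PsdBounds.
Variable R : realType.

(** The form is nonnegative at the sum of one basis vector and [z] times another; [z = 1, -1] bound
    the real part and [z = 'i, - 'i] the imaginary part. *)
Lemma psd_entry_bound m (B : 'M[R[i]]_m) x y : psd B ->
  `|complex.Re (B x y)| <= complex.Re (B x x) + complex.Re (B y y) /\
  `|complex.Im (B x y)| <= complex.Re (B x x) + complex.Re (B y y).
Proof.
move=> pB; have BH := psd_hermitian pB.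
have Byx : B y x = (B x y)^* by rewrite -{1}BH !mxE.
have key z : z * z^* = 1 ->
    0 <= complex.Re (B x x) + complex.Re (B y y) + complex.Re (z * B x y + (z * B x y)^*).
  move=> zz; have := pB (delta_mx x 0 + z *: delta_mx y 0).
  have -> : sesq B (delta_mx x 0 + z *: delta_mx y 0) (delta_mx x 0 + z *: delta_mx y 0) =
      B x x + z * z^* * B y y + (z * B x y + z^* * (B x y)^*).
    by rewrite !(sesqDl, sesqDr, sesqZl, sesqZr) !sesq_delta Byx; ring.
  by rewrite zz mul1r -rmorphM lecE !ReD => /andP[].
have cRe (w : R[i]) : complex.Re (w + w^*) = 2 * complex.Re w.
  by rewrite ReD; case: w => a b /=; rewrite mulr_natl mulr2n.
have ii : 'i * 'i^* = 1 :> R[i] by rewrite -normCK normCi expr1n.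
have z1 : 1 * 1^* = 1 :> R[i] by rewrite conjC1 mulr1.
have z2 : (-1) * (-1)^* = 1 :> R[i] by rewrite rmorphN /= conjC1 mulrNN mulr1.
have z4 : (- 'i) * (- 'i)^* = 1 :> R[i] by rewrite rmorphN /= mulrNN ii.
have ImI (w : R[i]) : complex.Re ('i * w) = - complex.Im w.
  by rewrite -complexiE; case: w => a b /=; ring.
have ReN (w : R[i]) : complex.Re (- w) = - complex.Re w by case: w.
move: (key _ z1) (key _ z2) (key _ ii) (key _ z4).
rewrite !cRe mul1r !mulNr !ReN mul1r !ImI.
move: (complex.Re (B x x)) (complex.Re (B y y)) (complex.Re (B x y)) (complex.Im (B x y)).
by move=> a b c e h1 h2 h3 h4; rewrite !ler_norml; split; apply/andP; split; lra.
Qed.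

End PsdBounds.

(** * Selection of a subsequence *)

Section Compactness.
Variables (R : realType) (n : nat) (K : set (four_vector R)) (cK : compact K).
Local Notation S := (signature R n).
Local Notation fmeasure := ({finite_measure set (momentum R) -> \bar R})%type.
Implicit Types (p : R -> four_vector R) (u : 'cV[R[i]]_(n + n)).

(** The parameters are confined to [[0, 1]], so the set is compact, empty for [t < 0], and constant
    for [t >= 1]. *)
Definition initial_part p t : set (four_vector R) :=
  K `&` p @` [set s | 0 <= s <= 1 /\ s <= t].

Lemma closed_K : closed K.
Proof. by apply: compact_closed => //; exact: norm_hausdorff. Qed.

Lemma initial_part_measurable p t : continuous p ->
  @measurable _ (momentum R) (initial_part p t).
Proof.
move=> cp; apply: measurable_compact; rewrite /initial_part setIC.
apply: compact_closedI closed_K; apply: continuous_compact.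
  exact: continuous_subspaceT.
have -> : [set s | 0 <= s <= 1 /\ s <= t] = `[0, Num.min 1 t]%classic :> set R.
  apply/seteqP; split=> s /=; rewrite in_itv /= le_min.
    by move=> [/andP[-> ->] ->].
  by move=> /and3P[-> -> ->].
exact: segment_compact.
Qed.

Lemma initial_part_neg p t : t < 0 -> initial_part p t = set0.
Proof.
move=> t0; rewrite -subset0 => x [_ [s [/andP[s0 _] st] _]].
by move: (lt_le_trans t0 s0); rewrite ltNge st.
Qed.

Lemma initial_part_nd p s t : s <= t -> initial_part p s `<=` initial_part p t.
Proof.
move=> st x [Kx [r [r01 rs] rx]]; split; first exact: Kx.
by exists r; [split; [exact: r01|exact: le_trans rs st]|exact: rx].
Qed.

Lemma initial_part_ge1 p t : K `<=` p @` `[0, 1] -> 1 <= t -> initial_part p t = K.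
Proof.
move=> Kp t1; apply/seteqP; split=> [x []//|x Kx]; split=> //.
have [s] := Kp x Kx; rewrite /= in_itv /= => /andP[s0 s1] sx.
by exists s => //=; split; [rewrite s0 s1|exact: le_trans s1 t1].
Qed.

Lemma represents_psd (nu : operator_measure K n) mu A : represents nu mu ->
  borel_subsets K A -> forall u, sesq (- S *m nu A) u u = (fine (mu u A))%:C.
Proof. by move=> hmu bA u; rewrite -(hmu u A bA) krein_sesqM mulNmx mulmxN. Qed.

Variables (nus : nat -> operator_measure K n)
  (mus : nat -> 'cV[R[i]]_(n + n) -> fmeasure) (C : R).
Hypothesis hmus : forall j, represents (nus j) (mus j).
Hypothesis trC : forall j, complex.Re (\tr (- S *m nus j K)) <= C.

Let mK : @measurable _ (momentum R) K.
Proof. exact: measurable_compact. Qed.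

Let bK : borel_subsets K K. Proof. by split. Qed.

Lemma entry_bound j A x y : borel_subsets K A ->
  `|complex.Re ((- S *m nus j A) x y)| <= 2 * C /\
  `|complex.Im ((- S *m nus j A) x y)| <= 2 * C.
Proof.
move=> bA; have pA B : borel_subsets K B -> psd (- S *m nus j B).
  by move=> bB u; rewrite (represents_psd (hmus j) bB) lecR fine_ge0.
have dA B z : borel_subsets K B ->
    complex.Re ((- S *m nus j B) z z) = fine (mus j (delta_mx z 0) B).
  by move=> bB; rewrite -sesq_delta (represents_psd (hmus j) bB).
(* A diagonal entry is a mass, hence at most the mass of [K], which is one of the nonnegative terms
   of the trace. *)
have dC z : complex.Re ((- S *m nus j A) z z) <= C.
  rewrite dA//; apply: (@le_trans _ _ (fine (mus j (delta_mx z 0) K))).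
    apply: fine_le; rewrite ?fin_num_measure//; first by case: bA.
    by apply: le_measure; rewrite ?inE//; case: bA.
  apply: le_trans (trC j); rewrite /mxtrace Re_sum (bigD1 z)//= dA// lerDl.
  by apply: sumr_ge0 => i _; rewrite dA// fine_ge0.
have [h1 h2] := psd_entry_bound x y (pA A bA).
by split; [apply: (le_trans h1)|apply: (le_trans h2)]; rewrite mulr_natl mulr2n lerD.
Qed.

Lemma initial_part_subsequence p : continuous p ->
  exists phi : nat -> nat, exists G : 'cV[R[i]]_(n + n) -> rat -> R,
  [/\ {homo phi : i j / (i < j)%N},
    forall q, hermitian_form (fun u => G u q) &
    forall u q, (fun k => fine (mus (phi k) u (initial_part p (ratr q)))) @ \oo --> G u q].
Proof.
move=> cp; pose E q := initial_part p (ratr q).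
have bE q : borel_subsets K (E q).
  by split; [exact: initial_part_measurable|move=> x []].
(* A rational parameter, a matrix position, and a flag for the real or imaginary part. Convergence
   of these countably many numbers gives convergence for all vectors along one subsequence. *)
pose I : countType := (rat * 'I_(n + n) * 'I_(n + n) * bool)%type.
pose a (j : nat) (i : I) : R := let B := - S *m nus j (E i.1.1.1) in
  if i.2 then complex.Re (B i.1.1.2 i.1.2) else complex.Im (B i.1.1.2 i.1.2).
have [|phi [L [phi_homo aL]]] := @diagonal_subsequence R I a (fun=> 2 * C).
  move=> j [[[q x] y] b]; rewrite /a /=.
  by have [? ?] := entry_bound j x y (bE q); case: b.
pose Gq q : 'M[R[i]]_(n + n) := \matrix_(x, y) (L (q, x, y, true) +i* L (q, x, y, false)).
have cG q x y : (fun k => (- S *m nus (phi k) (E q)) x y) ~~> Gq q x y.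
  rewrite mxE; apply/ccvg_ReIm; split => /=.
    exact: (aL (q, x, y, true)).
  exact: (aL (q, x, y, false)).
pose G u q := complex.Re (sesq (Gq q) u u).
have cGu u q : (fun k => fine (mus (phi k) u (E q))) @ \oo --> G u q.
  have /ccvg_ReIm[+ _] := sesq_cvg u (cG q).
  by under eq_fun do rewrite (represents_psd (hmus _) (bE q)).
exists phi, G; split=> // q.
apply: (@hermitian_form_lim _ _ (fun k u => fine (mus (phi k) u (E q)))) => // k.
exact: hermitian_formP (represents_psd (hmus _) (bE q)).
Qed.

End Compactness.

Lemma cvg_seq_unique (R : realType) (x : nat -> R) (a b : R) :
  x @ \oo --> a -> x @ \oo --> b -> a = b.
Proof. exact: (@cvg_unique R (@norm_hausdorff _ R) (x @ \oo) _ a b). Qed.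

(** * The limit of the scalar measures *)

Section ScalarLimit.
Variables (R : realType) (K : set (four_vector R)) (cK : compact K).
Hypothesis K_neq0 : K !=set0.
Local Notation fmeasure := ({finite_measure set (momentum R) -> \bar R})%type.
Variables (p : R -> four_vector R) (cp : continuous p) (Kp : K `<=` p @` `[0, 1]).

(** Extends the curve from [[0, 1]] to the line by constants, so that functions composed with it are
    uniformly continuous and constant outside the unit interval. *)
Definition clamp (t : R) : R := Num.max 0 (Num.min t 1).

Lemma clamp_continuous : continuous clamp.
Proof.
move=> t; have c0 (c : R) : {for t, continuous (fun=> c)} by exact: cvg_cst.
have ci : {for t, continuous (fun s : R => s)} by exact: cvg_id.
exact: (continuous_max (c0 0) (continuous_min ci (c0 1))).
Qed.

Lemma clamp_id t : 0 <= t <= 1 -> clamp t = t.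
Proof. by move=> /andP[t0 t1]; rewrite /clamp (min_idPl _)// (max_idPr _). Qed.

Lemma clamp_in t : 0 <= clamp t <= 1.
Proof. by rewrite /clamp le_max lexx /= ge_max ler01 /= ge_min lexx orbT. Qed.

Lemma clamp_le0 t : t <= 0 -> clamp t = 0.
Proof. by move=> t0; rewrite /clamp (max_idPl _)// ge_min t0. Qed.

Lemma clamp_ge1 t : 1 <= t -> clamp t = 1.
Proof. by move=> t1; rewrite /clamp (min_idPr _)// (max_idPr _)// ler01. Qed.

Lemma clamp_dist s t : `|clamp s - clamp t| <= `|s - t|.
Proof.
have h a b : a <= b -> 0 <= clamp b - clamp a <= b - a.
  rewrite /clamp => ab; case: (leP a 1) => a1; case: (leP b 1) => b1;
    try case: (leP 0 a) => a0; try case: (leP 0 b) => b0;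
    try case: (leP 0 (1 : R)) => h1; apply/andP; split; lra.
have [/h/andP[h0 h1]|/ltW/h/andP[h0 h1]] := leP s t.
  by rewrite distrC (ger0_norm h0) (le_trans h1)// distrC ler_norm.
by rewrite (ger0_norm h0) (le_trans h1)// ler_norm.
Qed.

Variables (m : nat -> fmeasure) (G : rat -> R).
Hypothesis mG : forall q, (fun k => fine (m k (initial_part K p (ratr q)))) @ \oo --> G q.
Local Notation E := (initial_part K p).

Let mE t : @measurable _ (momentum R) (E t).
Proof. exact: initial_part_measurable. Qed.

Lemma limit_nd (q r : rat) : q <= r -> G q <= G r.
Proof.
move=> qr; apply: (ler_cvg_to (@mG q) (@mG r)); apply: nearW => k.
apply: fine_le; rewrite ?fin_num_measure//; apply: le_measure; rewrite ?inE//.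
by apply: initial_part_nd; rewrite ler_rat.
Qed.

Lemma limit_neg (q : rat) : q < 0 -> G q = 0.
Proof.
move=> q0; have qR : ratr q < 0 :> R by rewrite -(rmorph0 (@ratr R)) ltr_rat.
have := @mG q; rewrite (initial_part_neg _ _ qR).
have -> : (fun k => fine (m k set0)) = (fun=> 0) by apply/funext => k; rewrite measure0.
by move=> h; apply: (cvg_seq_unique h (@cvg_cst R 0 nat \oo _)).
Qed.

Lemma limit_ge1 (q : rat) : 1 <= q -> G q = G 1.
Proof.
move=> q1; have h q' : 1 <= q' -> (fun k => fine (m k K)) @ \oo --> G q'.
  move=> q'1; have := @mG q'.
  by rewrite (initial_part_ge1 Kp)// -(rmorph1 (@ratr R)) ler_rat.
exact: cvg_seq_unique (h q q1) (h 1 (lexx 1)).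
Qed.

Lemma limit_measure : exists l : {finite_measure set (measurableTypeR R) -> \bar R},
  (forall t, fine (l `]-oo, t]%classic) = right_cdf G t) /\ fine (l setT) = G 1.
Proof.
have F1 := right_cdf_ge1 limit_nd limit_neg limit_ge1.
have [| | | |l [lF lT]] := @cdf_measure R (right_cdf G).
- exact: right_cdf_nondecreasing limit_nd limit_neg.
- exact: right_cdf_right_continuous limit_nd limit_neg.
- exact: right_cdf_neg limit_nd limit_neg.
- by move=> t t1; rewrite !F1.
by exists l; split=> //; rewrite lT F1.
Qed.

Variables (l : {finite_measure set (measurableTypeR R) -> \bar R}) (mu : fmeasure).
Hypothesis lF : forall t, fine (l `]-oo, t]%classic) = right_cdf G t.
Hypothesis lT : fine (l setT) = G 1.
Hypothesis mul : forall g M, @measurable_fun _ _ (momentum R) R setT g ->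
  (forall x, `|g x| <= M) -> \int[mu]_x g x = \int[l]_t g (p (clamp t)).

Lemma cvg_integral_continuous (g : four_vector R -> R) M : continuous g ->
  (forall x, `|g x| <= M) ->
  (fun k => \int[m k]_(x in K) g x) @ \oo --> \int[mu]_x g x.
Proof.
move=> cg gM; have mg := continuous_momentum_measurable cg.
rewrite (mul mg gM); have E1 : E 1 = K by exact: initial_part_ge1.
pose H t := g (p (clamp t)).
have cpg : continuous (fun t => g (p t)).
  by move=> t; apply: continuous_comp; [exact: cp|exact: cg].
have cH : continuous H.
  move=> t; apply: (@continuous_comp _ _ _ clamp (fun t => g (p t))).
    exact: clamp_continuous.
  exact: cpg.
have := @helly_bray R _ (momentum R) m E mE _ _ G l mG limit_nd limit_neg
  limit_ge1 lF lT g H M.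
rewrite E1; apply.
- by move=> s t; exact: initial_part_nd.
- by move=> t; exact: initial_part_neg.
- exact: measurable_funS mg.
- by move=> x _; exact: gM.
- exact: continuous_measurable_fun.
- by move=> t; exact: gM.
- by move=> t t0; rewrite /H !clamp_le0.
- by move=> t t1; rewrite /H !clamp_ge1.
- move=> e e0; have [N [N0 hN]] := segment_uniformly_continuous 0 1 cpg e0.
  exists N; split=> // s t st; apply: hN; first exact: clamp_in.
  exact: le_trans (clamp_dist _ _) st.
move=> s t x [Kx [r [r01 rt] rx]] nE; exists r; last by rewrite /H clamp_id// rx.
rewrite rt andbT ltNge; apply/negP => rs; apply: nE; split=> //.
by exists r => //; split.
Qed.

(** [mu] is carried by the curve, which may leave [K]. The distance to [K], capped at 1, has
    integral 0 against every [m k] over [K], hence integral 0 against [mu], so it vanishes almost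
    everywhere. *)
Lemma limit_support : mu (~` K) = 0%E.
Proof.
have [g [cg g01 gK gK']] := distance_function (closed_K cK) K_neq0.
have mg := continuous_momentum_measurable cg.
have g1 x : `|g x| <= 1 by have /andP[? ?] := g01 x; rewrite ger0_norm.
have mK : @measurable _ (momentum R) K by exact: measurable_compact.
have int0 : \int[mu]_x g x = 0.
  apply: (cvg_seq_unique (cvg_integral_continuous cg g1)).
  have -> : (fun k => \int[m k]_(x in K) g x) = (fun=> 0).
    apply/funext => k; transitivity (\int[m k]_(x in K) (cst 0 x : R)).
      by apply: eq_Rintegral => x /set_mem/gK.
    by rewrite Rintegral_cst// mul0r.
  exact: cvg_cst.
have ig := bounded_integrable mu (@measurableT _ (momentum R)) mg (fun x _ => g1 x).
have eint0 : (\int[mu]_x `|(g x)%:E|)%E = 0%E.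
  under eq_integral => x _ do rewrite abse_EFin ger0_norm ?(andP (g01 x)).1//.
  by rewrite -[LHS]fineK ?integrable_fin_num// -[fine _]/(\int[mu]_x g x) int0.
have mEg : @measurable_fun _ _ (momentum R) _ setT (EFin \o g) by exact/measurable_EFinP.
have ae := (ae_eq_integral_abs mu (@measurableT _ (momentum R)) mEg).1 eint0.
apply/(negligibleP mu (measurableC mK)); move: ae; apply: negligibleS.
move=> x Kx /= h; apply: Kx; apply: gK'.
by have [] := h I.
Qed.

(** Tietze extension reduces this to functions continuous on the whole space; [|M| + 1] supplies the
    positive bound that the extension requires. *)
Lemma cvg_integral_within (h : four_vector R -> R) M :
  {within K, continuous (h : four_vector R -> R^o)} ->
  (forall x, K x -> `|h x| <= M) ->
  (fun k => \int[m k]_(x in K) h x) @ \oo --> \int[mu]_(x in K) h x.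
Proof.
move=> ch hM; have M0 : 0 < `|M| + 1 by rewrite ltr_wpDl.
have hM' x : K x -> `|h x| <= `|M| + 1.
  by move=> /hM/le_trans; apply; rewrite (le_trans (ler_norm M))// lerDl.
have [g [hg cg gM]] := continuous_bounded_extension (@pseudometric_normal R _)
  (closed_K cK) M0 ch hM'.
have mg := continuous_momentum_measurable cg.
have mK : @measurable _ (momentum R) K by exact: measurable_compact.
have hE (m' : fmeasure) : \int[m']_(x in K) h x = \int[m']_(x in K) g x.
  by apply: eq_Rintegral => x; exact: hg.
under eq_fun do rewrite hE; rewrite hE.
have -> : \int[mu]_(x in K) g x = \int[mu]_x g x.
  have dK : [disjoint K & ~` K] by rewrite disj_set2E setICr.
  have ig : mu.-integrable (K `|` ~` K) (EFin \o g).
    rewrite setUv.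
    exact: (bounded_integrable mu (@measurableT _ (momentum R)) mg (fun x _ => gM x)).
  rewrite -[in RHS](setUv K) Rintegral_setU//; last exact: measurableC.
  rewrite [X in _ = _ + X](_ : _ = 0) ?addr0//.
  rewrite /Rintegral null_set_integral//; first exact: measurableC.
    by apply/measurable_EFinP; exact: measurable_funS mg.
  exact: limit_support.
exact: cvg_integral_continuous cg gM.
Qed.

End ScalarLimit.

Section CompactnessTheorem.
Variables (R : realType) (n : nat) (K : set (four_vector R)) (cK : compact K).
Hypothesis K_neq0 : K !=set0.
Local Notation fmeasure := ({finite_measure set (momentum R) -> \bar R})%type.

(** An infimum does not preserve quadratic forms in general, but this one is a limit along a single
    sequence of rationals tending to [t] from the right, the same for all [u]. *)
Lemma right_cdf_hermitian (G : 'cV[R[i]]_(n + n) -> rat -> R) t :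
  (forall u (p q : rat), p <= q -> G u p <= G u q) ->
  (forall u (q : rat), q < 0 -> G u q = 0) ->
  (forall q, hermitian_form (fun u => G u q)) ->
  hermitian_form (fun u => right_cdf (G u) t).
Proof.
move=> Gnd Gneg hG.
have hq0 (k : nat) : exists q : rat, t < ratr q :> R /\ ratr q < t + k.+1%:R^-1 :> R.
  have [q /itvP tq] : exists q, ratr q \in `]t, t + k.+1%:R^-1[.
    by apply: rat_in_itvoo; rewrite ltrDl invr_gt0 ltr0n.
  by exists q; rewrite !tq.
have [q hq] := choice hq0.
apply: (@hermitian_form_lim _ _ (fun k u => G u (q k))) => [k|u]; first exact: hG.
apply/cvgrPdist_le => e e0; have [r tr Gr] := right_cdf_approx (@Gnd u) (@Gneg u) t e0.
have d0 : 0 < ratr r - t by rewrite subr_gt0.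
near=> k.
have h1 : right_cdf (G u) t <= G u (q k).
  exact: (right_cdf_le (@Gnd u) (@Gneg u) (hq k).1).
have h2 : G u (q k) <= G u r.
  apply: Gnd; rewrite -(@ler_rat R) (le_trans (ltW (hq k).2))// -lerBrDl ltW//.
  by near: k; exact: near_infty_natSinv_lt (PosNum d0).
rewrite distrC ger0_norm ?subr_ge0//; lra.
Unshelve. all: by end_near. Qed.

Variables (nus : nat -> operator_measure K n)
  (mus : nat -> 'cV[R[i]]_(n + n) -> fmeasure) (C : R).
Hypothesis hmus : forall j, represents (nus j) (mus j).
Hypothesis trC : forall j, complex.Re (\tr (- signature R n *m nus j K)) <= C.

Lemma operator_measure_compactness :
  exists phi : nat -> nat, exists nu : operator_measure K n, exists mu,
  [/\ {homo phi : i j / (i < j)%N}, represents nu mu &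
    forall u (h : four_vector R -> R) M,
      {within K, continuous (h : four_vector R -> R^o)} ->
      (forall x, K x -> `|h x| <= M) ->
      (fun k => \int[mus (phi k) u]_(x in K) h x) @ \oo --> \int[mu u]_(x in K) h x].
Proof.
have [p cp Kp] := compact_curve cK.
have [phi [G [phi_homo hG mG]]] := initial_part_subsequence cK hmus trC cp.
have Gnd u : forall q r : rat, q <= r -> G u q <= G u r := limit_nd cK cp (mG u).
have Gneg u : forall q : rat, q < 0 -> G u q = 0 := limit_neg (mG u).
have [l hl] := choice (fun u => limit_measure cK cp Kp (mG u)).
have hl_herm A : @measurable _ (measurableTypeR R) A -> hermitian_form (fun u => fine (l u A)).
  apply: hermitian_family_measure => [t|].
    under eq_fun do rewrite (hl _).1.
    exact: right_cdf_hermitian.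
  by under eq_fun do rewrite (hl _).2; exact: hG.
have cpc : continuous (p \o @clamp R).
  by move=> t; apply: continuous_comp; [exact: clamp_continuous|exact: cp].
have [mu hmu] := choice (fun u => pushforward_finite (l u) cpc).
have [nu hnu] : exists nu : operator_measure K n, represents nu mu.
  apply: operator_measure_of_family => A mA.
  under eq_fun do rewrite (hmu _).1.
  apply: hl_herm; rewrite -[X in measurable X]setTI.
  exact: (measurable_curve cpc measurableT mA).
exists phi, nu, mu; split=> // u h M ch hM.
exact: (cvg_integral_within cK K_neq0 cp Kp (mG u) (hl u).1 (hl u).2 (hmu u).2 ch hM).
Qed.

End CompactnessTheorem.

(** * The causal action *)

Section TestFunctions.
Variables (R : realType) (K : set (four_vector R)) (cK : compact K).
Hypothesis K_neq0 : K !=set0.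

Lemma Re_continuous : continuous (@complex.Re R : R[i]^o -> R^o).
Proof.
move=> z; apply/(@cvgrPdist_lt _ _ _ (nbhs (z : R[i]^o))) => e e0.
have : \forall w \near (z : R[i]^o), `|z - w| < e%:C.
  by apply/nbhs_normP; exists e%:C => //=; rewrite ltcR.
apply: filterS => w; rewrite -ReB -norm_ReC ltcR; apply: le_lt_trans.
exact: ler_norm_Re.
Qed.

Lemma Im_continuous : continuous (@complex.Im R : R[i]^o -> R^o).
Proof.
move=> z; apply/(@cvgrPdist_lt _ _ _ (nbhs (z : R[i]^o))) => e e0.
have : \forall w \near (z : R[i]^o), `|z - w| < e%:C.
  by apply/nbhs_normP; exists e%:C => //=; rewrite ltcR.
apply: filterS => w; rewrite -ImB -norm_ReC ltcR; apply: le_lt_trans.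
exact: ler_norm_Im.
Qed.

Lemma continuous_within_measurable (h : four_vector R -> R) M :
  {within K, continuous (h : four_vector R -> R^o)} ->
  (forall x, K x -> `|h x| <= M) -> @measurable_fun _ _ (momentum R) R K h.
Proof.
move=> ch hM; have M0 : 0 < `|M| + 1 by rewrite ltr_wpDl.
have hM' x : K x -> `|h x| <= `|M| + 1.
  by move=> /hM/le_trans; apply; rewrite (le_trans (ler_norm M))// lerDl.
have [g [hg cg gM]] := continuous_bounded_extension (@pseudometric_normal R _)
  (closed_K cK) M0 ch hM'.
have mg := measurable_funS (@measurableT _ (momentum R)) (@subsetT _ K)
  (continuous_momentum_measurable cg).
apply: eq_measurable_fun mg => x xK; exact: esym (hg x xK).
Qed.

Lemma continuous_bounded_borel (g : four_vector R -> R[i]^o) :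
  {within K, continuous g} -> [bounded g k | k in K] ->
  exists M, [/\ bounded_borel K g,
    {within K, continuous (fun k => complex.Re (g k) : R^o)},
    {within K, continuous (fun k => complex.Im (g k) : R^o)},
    forall k, K k -> `|complex.Re (g k)| <= M &
    forall k, K k -> `|complex.Im (g k)| <= M].
Proof.
move=> cg; have [a Ka] := K_neq0.
move=> /(@ex_bound _ _ _ g _ (globally_properfilter Ka))[M hM]; exists (complex.Re M).
have gM k : K k -> complex.Re `|g k| <= complex.Re M.
  by move=> /hM h; have : `|g k| <= M := h; rewrite lecE => /andP[].
have cR : {within K, continuous (fun k => complex.Re (g k) : R^o)}.
  by move=> x; exact: (cvg_comp _ _ (cg x) (@Re_continuous (g x))).
have cI : {within K, continuous (fun k => complex.Im (g k) : R^o)}.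
  by move=> x; exact: (cvg_comp _ _ (cg x) (@Im_continuous (g x))).
have RM k : K k -> `|complex.Re (g k)| <= complex.Re M.
  by move=> Kk; exact: le_trans (ler_norm_Re _) (gM k Kk).
have IM k : K k -> `|complex.Im (g k)| <= complex.Re M.
  by move=> Kk; exact: le_trans (ler_norm_Im _) (gM k Kk).
split=> //; split; [exact: continuous_within_measurable cR RM|
  exact: continuous_within_measurable cI IM|by exists (complex.Re M)].
Qed.

Lemma lorentz_pairing_continuous (xi : four_vector R) :
  continuous (fun k => lorentz_pairing k xi).
Proof.
move=> k; rewrite /lorentz_pairing.
have c1 : {for k, continuous (fun k : four_vector R => k.1.1.1)}.
  by apply: cvg_comp; [apply: cvg_comp; [exact: cvg_fst|exact: cvg_fst]|exact: cvg_fst].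
have c2 : {for k, continuous (fun k : four_vector R => k.1.1.2)}.
  by apply: cvg_comp; [apply: cvg_comp; [exact: cvg_fst|exact: cvg_fst]|exact: cvg_snd].
have c3 : {for k, continuous (fun k : four_vector R => k.1.2)}.
  by apply: cvg_comp; [exact: cvg_fst|exact: cvg_snd].
have c4 : {for k, continuous (fun k : four_vector R => k.2)} by exact: cvg_snd.
have cM (f : four_vector R -> R) a : {for k, continuous f} ->
    {for k, continuous (fun k => f k * a)}.
  by move=> cf; apply: cvgM; [exact: cf|exact: cvg_cst].
apply: cvgB; first exact: cM.
by apply: cvgD; [apply: cvgD; exact: cM|exact: cM].
Qed.

Lemma expi_continuous (xi : four_vector R) :
  continuous (fun k => cos (lorentz_pairing k xi)) /\
  continuous (fun k => sin (lorentz_pairing k xi)).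
Proof.
split=> k; apply: continuous_comp.
- exact: lorentz_pairing_continuous.
- exact: continuous_cos.
- exact: lorentz_pairing_continuous.
- exact: continuous_sin.
Qed.

Lemma expi_bounded_borel (xi : four_vector R) :
  bounded_borel K (fun k => expi (lorentz_pairing k xi)).
Proof.
have [cc cs] := expi_continuous xi.
split.
- exact: measurable_funS (continuous_momentum_measurable cc).
- exact: measurable_funS (continuous_momentum_measurable cs).
exists 2 => k _; apply: (le_trans (ler_Re_norm_parts _)) => /=.
have := cos_max (lorentz_pairing k xi); have := sin_max (lorentz_pairing k xi); lra.
Qed.

End TestFunctions.

(** * Measurability on position space *)

Section Discretization.
Variable R : realType.
Local Notation space := (measurableTypeR R * measurableTypeR R * measurableTypeR R * measurableTypeR R)%type.

Lemma measurable_countable_valued d (T : measurableType d) (I : countType)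
    (D : T -> I) (h : I -> R) :
  (forall i, measurable (D @^-1` [set i])) -> measurable_fun setT (h \o D).
Proof.
move=> mD _ B mB; rewrite setTI.
have -> : (h \o D) @^-1` B = \bigcup_i (if h i \in B then D @^-1` [set i] else set0).
  apply/seteqP; split=> [x hx|x [i _]].
    by exists (D x) => //; rewrite (mem_set (hx : B (h (D x)))).
  by case: ifPn => // /set_mem hB /= Dx; rewrite /= Dx.
apply: countable_bigcupT_measurable => [|i]; first exact: countableP.
by case: ifPn.
Qed.

Definition grid (m : nat) (x : R) : int := Num.floor (m.+1%:R * x).

Lemma grid_cvg x : (fun m => (grid m x)%:~R / m.+1%:R) @ \oo --> x.
Proof.
apply/cvgrPdist_le => e e0; near=> m.
have m0 : 0 < m.+1%:R :> R by rewrite ltr0n.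
have /andP[h1 h2] := real_floor_itv (num_real (m.+1%:R * x)).
have hm : m.+1%:R^-1 <= e by apply: ltW; near: m; exact: near_infty_natSinv_lt (PosNum e0).
apply: le_trans hm; rewrite -[X in X - _](mulrK (unitf_gt0 m0)) -mulrBl normrM.
rewrite [`|_^-1|]ger0_norm ?invr_ge0 ?(ltW m0)// ler_piMl ?invr_ge0 ?(ltW m0)//.
move: h1 h2; rewrite intrD [x * _]mulrC /grid => h1 h2.
by rewrite ger0_norm; lra.
Unshelve. all: by end_near. Qed.

Lemma grid_measurable d (T : measurableType d) (g : T -> R) m z :
  measurable_fun setT g -> measurable ((grid m \o g) @^-1` [set z]).
Proof.
move=> mg; have m0 : 0 < m.+1%:R :> R by rewrite ltr0n.
have -> : (grid m \o g) @^-1` [set z] =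
    g @^-1` `[z%:~R / m.+1%:R, (z + 1)%:~R / m.+1%:R[%classic.
  apply/seteqP; split=> x /=; rewrite in_itv /= ler_pdivrMr// ltr_pdivlMr// [g x * _]mulrC.
    by move=> <-; exact: real_floor_itv (num_real _).
  by move=> h; apply/eqP; rewrite -(rwP eqP); apply: floor_def.
by rewrite -[X in measurable X]setTI; apply: mg => //; exact: measurable_itv.
Qed.

(** The action is an integral over a product of four real lines. Functions of the grid cell are
    measurable for the product structure, and sequential continuity makes [f] their pointwise limit
    as the grid is refined. *)
Lemma sequentially_continuous_measurable (f : four_vector R -> R) :
  (forall (s : nat -> four_vector R) x,
    (fun m => (s m).1.1.1) @ \oo --> x.1.1.1 -> (fun m => (s m).1.1.2) @ \oo --> x.1.1.2 ->
    (fun m => (s m).1.2) @ \oo --> x.1.2 -> (fun m => (s m).2) @ \oo --> x.2 ->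
    (fun m => f (s m)) @ \oo --> f x) ->
  measurable_fun setT (f : space -> R).
Proof.
move=> cf; pose I : countType := (int * int * int * int)%type.
pose D m (x : space) : I := (grid m x.1.1.1, grid m x.1.1.2, grid m x.1.2, grid m x.2).
pose v m (z : int) : R := z%:~R / m.+1%:R.
pose h m (i : I) := f (v m i.1.1.1, v m i.1.1.2, v m i.1.2, v m i.2).
apply: (@measurable_fun_cvg _ _ _ _ (fun m => h m \o D m)) => [m|x _]; last first.
  by apply: (cf (fun m => (v m (D m x).1.1.1, v m (D m x).1.1.2, v m (D m x).1.2, v m (D m x).2)));
    exact: grid_cvg.
apply: measurable_countable_valued => -[[[a b] c] e].
have m1 : measurable_fun setT (fun x : space => x.1.1.1).
  by apply: measurableT_comp => //; apply: measurableT_comp.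
have m2 : measurable_fun setT (fun x : space => x.1.1.2).
  by apply: measurableT_comp => //; apply: measurableT_comp.
have m3 : measurable_fun setT (fun x : space => x.1.2) by apply: measurableT_comp.
have m4 : measurable_fun setT (fun x : space => x.2) by exact: measurable_snd.
have -> : D m @^-1` [set (a, b, c, e)] =
    (((grid m \o (fun x : space => x.1.1.1)) @^-1` [set a] `&`
      (grid m \o (fun x : space => x.1.1.2)) @^-1` [set b]) `&`
      (grid m \o (fun x : space => x.1.2)) @^-1` [set c]) `&`
      (grid m \o (fun x : space => x.2)) @^-1` [set e].
  apply/seteqP; split=> x /=; first by case=> -> -> -> ->.
  by rewrite /D => -[[[-> ->] ->] ->].
by repeat first [exact: grid_measurable|apply: measurableI].
Qed.

End Discretization.

Lemma bounded_integral_cvg d (T : measurableType d) (R : realType)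
    (m : {finite_measure set T -> \bar R}) (D : set T) (g : nat -> T -> R) (h : T -> R) (M : R) :
  measurable D -> (forall k, measurable_fun D (g k)) -> measurable_fun D h ->
  (forall k x, D x -> `|g k x| <= M) ->
  (forall x, D x -> (fun k => g k x) @ \oo --> h x) ->
  (fun k => \int[m]_(x in D) g k x) @ \oo --> \int[m]_(x in D) h x.
Proof.
move=> mD mg mh gM gh.
have hM x : D x -> `|h x| <= M.
  move=> Dx; have gx : (fun k => `|g k x|) @ \oo --> `|h x| by apply: cvg_norm; exact: gh.
  have cM : (fun=> M) @ \oo --> M by exact: cvg_cst.
  by apply: (ler_cvg_to gx cM); apply: nearW => k; exact: gM.
have ih := bounded_integrable m mD mh hM.
have ic : m.-integrable D (EFin \o (fun=> M)).
  by apply: (@bounded_integrable _ _ _ m D _ `|M|) => //; exact: measurable_cst.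
apply: fine_cvg.
rewrite fineK ?integrable_fin_num//.
apply: (@dominated_cvg _ _ _ m D mD (fun k => EFin \o g k) (EFin \o h) (EFin \o (fun=> M))) => //.
- by move=> k; apply/measurable_EFinP.
- by move=> x Dx; apply: cvg_EFin; [exact: nearW|exact: gh].
Qed.

(** * Invariance, continuity and lower semicontinuity *)

Section Lagrangian.
Variables (R : realType) (n : nat) (K : set (four_vector R)) (cK : compact K).
Implicit Types (nu : operator_measure K n) (U : 'M[R[i]]_(n + n)).

Lemma lagrangian_ge0 nu xi : 0 <= lagrangian cK nu xi.
Proof. exact: lagrangian_mx_ge0. Qed.

Lemma conjugate_mulmx U (A B : 'M[R[i]]_(n + n)) : U \in unitmx ->
  (U *m A *m invmx U) *m (U *m B *m invmx U) = U *m (A *m B) *m invmx U.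
Proof. by move=> uU; rewrite !mulmxA mulmxKV. Qed.

Lemma closed_chain_conjugate U nu xi : krein_unitary U ->
  closed_chain cK (conjugate_measure U nu) xi = U *m closed_chain cK nu xi *m invmx U.
Proof.
move=> uU; rewrite /closed_chain /fourier_kernel.
rewrite !(operator_integral_conjugate _ _ uU (expi_bounded_borel _ _)).
exact: conjugate_mulmx (proj1 uU).
Qed.

Lemma lagrangian_conjugate U nu xi : krein_unitary U ->
  lagrangian cK (conjugate_measure U nu) xi = lagrangian cK nu xi.
Proof.
move=> uU; have uU1 := proj1 uU.
rewrite /lagrangian (closed_chain_conjugate _ _ uU) (conjugate_mulmx _ _ uU1).
by rewrite !(spectral_weight_conj _ uU1).
Qed.

Lemma causal_action_conjugate U nu : krein_unitary U ->
  causal_action cK (conjugate_measure U nu) = causal_action cK nu.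
Proof.
by move=> uU; apply: eq_integral => xi _; rewrite (lagrangian_conjugate _ _ uU).
Qed.

(** The measure and the point vary together, so that the lemma serves both the weak limit at a fixed
    point and continuity in the point for a fixed measure. *)
Lemma lagrangian_cvg (nus : nat -> operator_measure K n) (x : nat -> four_vector R) nu y :
  (forall i j, (fun k => fourier_kernel cK (nus k) (x k) i j) ~~> fourier_kernel cK nu y i j) ->
  (forall i j, (fun k => fourier_kernel cK (nus k) (- x k) i j) ~~>
    fourier_kernel cK nu (- y) i j) ->
  (fun k => lagrangian cK (nus k) (x k)) @ \oo --> lagrangian cK nu y.
Proof.
move=> h1 h2; have hA := mulmx_cvg h1 h2; have hAA := mulmx_cvg hA hA.
apply: cvgB; first exact: spectral_weight_cvg hAA.
apply: cvgM; first exact: cvg_cst.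
by apply: cvgM; exact: spectral_weight_cvg hA.
Qed.

Lemma fourier_kernel_continuous nu mu (s : nat -> four_vector R) x :
  represents nu mu ->
  (fun m => (s m).1.1.1) @ \oo --> x.1.1.1 -> (fun m => (s m).1.1.2) @ \oo --> x.1.1.2 ->
  (fun m => (s m).1.2) @ \oo --> x.1.2 -> (fun m => (s m).2) @ \oo --> x.2 ->
  forall i j, (fun m => fourier_kernel cK nu (s m) i j) ~~> fourier_kernel cK nu x i j.
Proof.
move=> hmu c1 c2 c3 c4; have mK := measurable_compact cK.
apply: (@krein_diag_cvg _ _ (fun k => fourier_kernel cK nu (s k))) => u.
apply: (ccvg_ext (fun k => operator_integral_represents cK u hmu (expi_bounded_borel K (s k)))
  (operator_integral_represents cK u hmu (expi_bounded_borel K x))).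
have cp k : (fun m => lorentz_pairing k (s m)) @ \oo --> lorentz_pairing k x.
  have cM (f : nat -> R) a b : f @ \oo --> b -> (fun m => a * f m) @ \oo --> a * b.
    by move=> cf; apply: cvgM; [exact: cvg_cst|exact: cf].
  apply: cvgB; first exact: cM.
  by apply: cvgD; [apply: cvgD; exact: cM|exact: cM].
have mc y : @measurable_fun _ _ (momentum R) R K (fun k => cos (lorentz_pairing k y)).
  by case: (expi_bounded_borel K y).
have ms y : @measurable_fun _ _ (momentum R) R K (fun k => sin (lorentz_pairing k y)).
  by case: (expi_bounded_borel K y).
have cC : (fun m => \int[mu u]_(k in K) cos (lorentz_pairing k (s m))) @ \oo -->
    \int[mu u]_(k in K) cos (lorentz_pairing k x).
  apply: (@bounded_integral_cvg _ (momentum R) R (mu u) K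
    (fun m k => cos (lorentz_pairing k (s m))) (fun k => cos (lorentz_pairing k x))
    1 mK (fun m => mc (s m)) (mc x)) => [m k _|k _]; first exact: cos_max.
  by apply: continuous_cvg; [exact: continuous_cos|exact: cp].
have cS : (fun m => \int[mu u]_(k in K) sin (lorentz_pairing k (s m))) @ \oo -->
    \int[mu u]_(k in K) sin (lorentz_pairing k x).
  apply: (@bounded_integral_cvg _ (momentum R) R (mu u) K
    (fun m k => sin (lorentz_pairing k (s m))) (fun k => sin (lorentz_pairing k x))
    1 mK (fun m => ms (s m)) (ms x)) => [m k _|k _]; first exact: sin_max.
  by apply: continuous_cvg; [exact: continuous_sin|exact: cp].
by apply/ccvgN/ccvg_ReIm; split; [exact: cC|exact: cS].
Qed.

Lemma lagrangian_measurable nu mu : represents nu mu ->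
  measurable_fun setT (lagrangian cK nu : (measurableTypeR R * measurableTypeR R *
    measurableTypeR R * measurableTypeR R)%type -> R).
Proof.
move=> hmu; apply: sequentially_continuous_measurable => s x c1 c2 c3 c4.
apply: (@lagrangian_cvg (fun=> nu)); first exact: fourier_kernel_continuous hmu c1 c2 c3 c4.
by apply: (fourier_kernel_continuous hmu); apply: cvgN.
Qed.

Lemma causal_action_fatou (nus : nat -> operator_measure K n) mus nu :
  (forall k, represents (nus k) (mus k)) ->
  (forall xi, (fun k => lagrangian cK (nus k) xi) @ \oo --> lagrangian cK nu xi) ->
  (causal_action cK nu <= limn_einf (fun k => causal_action cK (nus k)))%E.
Proof.
move=> hmus hL.
have L xi : (lagrangian cK nu xi)%:E = limn_einf (fun k => (lagrangian cK (nus k) xi)%:E).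
  have cL : (fun k => (lagrangian cK (nus k) xi)%:E) @ \oo --> (lagrangian cK nu xi)%:E.
    by apply: cvg_EFin; [exact: nearW|exact: hL].
  rewrite is_cvg_limn_einfE; last by apply/cvg_ex; exists (lagrangian cK nu xi)%:E.
  by rewrite (cvg_lim _ cL).
have mL k := (measurable_EFinP _ _).2 (lagrangian_measurable (hmus k)).
have L0 k xi : setT xi -> (0 <= (lagrangian cK (nus k) xi)%:E)%E.
  by move=> _; rewrite lee_fin; exact: lagrangian_ge0.
apply: le_trans (fatou _ measurableT mL L0).
by rewrite le_eqVlt; apply/orP; left; apply/eqP; apply: eq_integral => xi _; exact: L.
Qed.

End Lagrangian.

Lemma cvg_subsequence (T : topologicalType) (x : nat -> T) (l : T) (phi : nat -> nat) :
  {homo phi : i j / (i < j)%N} -> x @ \oo --> l -> (fun k => x (phi k)) @ \oo --> l.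
Proof.
move=> hphi xl A /xl[N _ h]; exists N => // k Nk; apply: h; apply: (leq_trans Nk).
by elim: k {Nk} => // k /leq_ltn_trans; apply; exact: hphi.
Qed.

(** * Passage to the limit in the action and the side conditions *)

Section WeakLimit.
Variables (R : realType) (n : nat) (K : set (four_vector R)) (cK : compact K).
Hypothesis K_neq0 : K !=set0.
Local Notation fmeasure := ({finite_measure set (momentum R) -> \bar R})%type.
Variables (nus : nat -> operator_measure K n) (nu : operator_measure K n).
Variables (mus : nat -> 'cV[R[i]]_(n + n) -> fmeasure) (mu : 'cV[R[i]]_(n + n) -> fmeasure).
Hypotheses (hmus : forall k, represents (nus k) (mus k)) (hmu : represents nu mu).
Hypothesis mus_cvg : forall u (h : four_vector R -> R) M,
  {within K, continuous (h : four_vector R -> R^o)} -> (forall x, K x -> `|h x| <= M) ->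
  (fun k => \int[mus k u]_(x in K) h x) @ \oo --> \int[mu u]_(x in K) h x.

Lemma represents_converges_weakly : converges_weakly cK nus nu.
Proof.
move=> u v g cg bg; have [M [bbg cR cI RM IM]] := continuous_bounded_borel cK K_neq0 cg bg.
apply: ccvg_lim.
apply: (ccvg_ext (fun k => esym (operator_integralP cK (nus k) u v bbg))
  (esym (operator_integralP cK nu u v bbg))).
apply: (@krein_product_cvg _ _ (fun k => operator_integral cK (nus k) g)).
apply: (operator_integral_cvg cK hmus hmu bbg) => w; [exact: mus_cvg cR RM|exact: mus_cvg cI IM].
Qed.

Lemma fourier_kernel_cvg xi i j :
  (fun k => fourier_kernel cK (nus k) xi i j) ~~> fourier_kernel cK nu xi i j.
Proof.
have [cc cs] := expi_continuous xi.
apply: (operator_integral_cvg cK hmus hmu (expi_bounded_borel K xi)) => u.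
  apply: (mus_cvg (M := 1)) => [|k _]; last exact: cos_max.
  by apply: continuous_subspaceT; exact: cc.
apply: (mus_cvg (M := 1)) => [|k _]; last exact: sin_max.
by apply: continuous_subspaceT; exact: cs.
Qed.

(** The total mass is the integral of the constant function 1, which is an admissible test function
    on [K]. *)
Lemma total_measure_cvg i j : (fun k => nus k K i j) ~~> nu K i j.
Proof.
rewrite -(operator_integral1 cK hmu).
have -> : (fun k => nus k K i j) = (fun k => operator_integral cK (nus k) (fun=> 1) i j).
  by apply/funext => k; rewrite (operator_integral1 cK (hmus k)).
apply: (operator_integral_cvg cK hmus hmu (bounded_borel1 K)) => u /=.
  apply: (mus_cvg (M := 1)) => [|k _]; last by rewrite normr1.
  by move=> x; exact: cvg_cst.
apply: (mus_cvg (M := 1)) => [|k _]; last by rewrite normr0.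
by move=> x; exact: cvg_cst.
Qed.

Lemma side_value_cvg q : (fun k => side_value q (nus k)) ~~> side_value q nu.
Proof.
case: q => /=; last exact/ccvg_real/spectral_weight_cvg/total_measure_cvg.
apply: ccvg_sum => i _; apply: mulmx_cvg => i' j'; first exact: ccvg_cst.
exact: total_measure_cvg.
Qed.

Lemma admissible_closed q b c f :
  (forall k, admissible q b c f (nus k)) -> admissible q b c f nu.
Proof.
move=> hN; split.
- by apply/negative_definiteP; exists mu.
- apply: (@ccvg_unique _ (fun k => \tr (nus k K))).
    by apply: ccvg_sum => i _; exact: total_measure_cvg.
  have -> : (fun k => \tr (nus k K)) = (fun=> c%:C).
    by apply/funext => k; have [_ ->] := hN k.
  exact: ccvg_cst.
have /ccvg_ReIm[sR sI] := side_value_cvg q.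
case: b hN => hN.
  have hv k : complex.Im (side_value q (nus k)) = 0 /\ complex.Re (side_value q (nus k)) <= f.
    by have [_ _] := hN k; rewrite lecE => /andP[/eqP <- ?].
  rewrite lecE; apply/andP; split.
    rewrite /=; apply/eqP; apply: (cvg_seq_unique _ sI).
    have -> : (fun k => complex.Im (side_value q (nus k))) = (fun=> 0).
      by apply/funext => k; exact: (hv k).1.
    exact: cvg_cst.
  have cf : (fun=> f) @ \oo --> f by exact: cvg_cst.
  by apply: (ler_cvg_to sR cf); apply: nearW => k; exact: (hv k).2.
apply: (@ccvg_unique _ (fun k => side_value q (nus k))); first exact: side_value_cvg.
have -> : (fun k => side_value q (nus k)) = (fun=> f%:C).
  by apply/funext => k; have [_ _ ->] := hN k.
exact: ccvg_cst.
Qed.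

End WeakLimit.

(** For the trace quantity [U] is the identity, since a general pseudo-unitary conjugation changes
    that quantity; the spectral weight and the trace of [nu K] are invariant. The bound [f + 1]
    serves both cases. *)
Lemma gauge_fixing (R : realType) (n : nat) (K : set (four_vector R)) (cK : compact K)
    q b c f (nu : operator_measure K n) : admissible q b c f nu ->
  exists U : 'M[R[i]]_(n + n), [/\ krein_unitary U,
    admissible q b c f (conjugate_measure U nu) &
    complex.Re (\tr (- signature R n *m conjugate_measure U nu K)) <= f + 1].
Proof.
move=> [nd trc sv]; have bK : borel_subsets K K by split; [exact: measurable_compact|].
have [mu hmu] := (negative_definiteP nu).1 nd.
have svf : complex.Re (side_value q nu) <= f.
  by case: b sv => [|->//]; rewrite lecE => /andP[].
have [U [uU sU trU]] : exists U : 'M[R[i]]_(n + n), [/\ krein_unitary U,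
    side_value q (conjugate_measure U nu) = side_value q nu &
    complex.Re (\tr (- signature R n *m (U *m nu K *m invmx U))) <= f + 1].
  case: q {sv} svf => /= svf.
    exists 1%:M; rewrite /= invmx1 mul1mx mulmx1; split=> //; first exact: krein_unitary1.
    by rewrite (le_trans svf)// lerDl.
  have [u|U uU tU] := @trace_bounded_by_spectral_weight R n (nu K).
    by rewrite (hmu u K bK) lecR fine_ge0.
  exists U; split; [exact: uU| |].
    exact: (congr1 (fun x : R => x%:C) (@spectral_weight_conj R n U (nu K) (proj1 uU))).
  by apply: (le_trans tU); rewrite lerD2r.
exists U; split; [exact: uU| |exact: trU].
split; [|rewrite -trc /=|by rewrite sU].
  by apply/negative_definiteP; exists (fun u => mu (invmx U *m u)); exact: (represents_conjugate uU hmu).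
by rewrite mxtrace_mulC mulmxA (mulVmx (proj1 uU)) mul1mx.
Qed.

Theorem theorem4p1 (R : realType) (n : nat) (n_gt0 : (0 < n)%N)
    (K : set (four_vector R)) (cK : compact K)
    (c f : R) (c_gt0 : 0 < c) (f_gt0 : 0 < f)
    (q : side_quantity) (b : side_bound)
    (nus : nat -> operator_measure K n) :
  let N := admissible (n := n) (K := K) q b c f in
  (forall j, N (nus j)) ->
  causal_action cK (nus j) @[j --> \oo] -->
    ereal_inf [set causal_action cK nu | nu in N] ->
  exists (U : nat -> 'M[R[i]]_(n + n)) (phi : nat -> nat)
         (nu : operator_measure K n),
    [/\ forall j, krein_unitary (U j),
        {homo phi : i j / (i < j)%N},
        converges_weakly cK
          (fun k => conjugate_measure (U (phi k)) (nus (phi k))) nu &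
        [/\ negative_definite nu, nontrivial nu,
            (causal_action cK nu <=
              limn_einf (fun k => causal_action cK (nus (phi k))))%E,
            N nu &
            forall nu', N nu' ->
              (causal_action cK nu <= causal_action cK nu')%E]].
Proof.
move=> N hN cS.
have cC0 : c%:C != 0 :> R[i] by rewrite gt_eqF// ltcR.
have bK : borel_subsets K K by split; [exact: measurable_compact|].
(* On an empty [K] the total mass would vanish, contradicting the trace [c]. *)
have K_neq0 : K !=set0.
  apply/set0P/eqP => K0; have [_ + _] := hN 0%N.
  rewrite [X in nus 0%N X]K0 (vmeasureP (nus 0%N)).1 mxtrace0 => /esym/eqP.
  by rewrite (negbTE cC0).
have [U hU] := choice (fun j => gauge_fixing cK (hN j)).
pose nus' j := conjugate_measure (U j) (nus j).
have hmu0 j : exists mu, represents (nus' j) mu.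
  by apply/negative_definiteP; have [_ []] := hU j.
have [mus hmus] := choice hmu0.
have trC j : complex.Re (\tr (- signature R n *m nus' j K)) <= f + 1.
  by have [] := hU j.
have [phi [nu [mu [phi_homo hmu mus_cvg]]]] :=
  operator_measure_compactness cK K_neq0 hmus trC.
have hmusphi k : represents (nus' (phi k)) (mus (phi k)) := hmus (phi k).
have Nnu : N nu.
  by apply: (admissible_closed cK hmusphi hmu mus_cvg) => k; have [] := hU (phi k).
have Sle : (causal_action cK nu <= limn_einf (fun k => causal_action cK (nus (phi k))))%E.
  have -> : (fun k => causal_action cK (nus (phi k))) =
      (fun k => causal_action cK (nus' (phi k))).
    by apply/funext => k; rewrite causal_action_conjugate//; have [] := hU (phi k).
  apply: (causal_action_fatou hmusphi) => xi.
  by apply: (lagrangian_cvg (x := fun=> xi)); exact: (fourier_kernel_cvg cK hmusphi hmu mus_cvg).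
have Smin nu' : N nu' -> (causal_action cK nu <= causal_action cK nu')%E.
  move=> Nnu'; apply: (le_trans Sle).
  have cSphi := cvg_subsequence phi_homo cS.
  rewrite is_cvg_limn_einfE; last by apply/cvg_ex; eexists; exact: cSphi.
  rewrite (cvg_lim _ cSphi)//.
  by apply: ereal_inf_lbound; exists nu'.
have nt : nontrivial nu.
  exists K; first exact: bK.
  apply: contra_neq cC0 => nuK0.
  by have [_ <- _] := Nnu; rewrite nuK0 mxtrace0.
exists U, phi, nu; split; [|exact: phi_homo| |].
- by move=> j; have [] := hU j.
- exact: (represents_converges_weakly K_neq0 hmusphi hmu mus_cvg).
by split; [case: Nnu|exact: nt|exact: Sle|exact: Nnu|exact: Smin].
Qed.
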